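(* The equation $-Qu=f(u)$ in $\mathbb{R}^N$ does not admit a positive stable weak solution in either of the following cases: (i) $f(u)=u^{p}$ with $p>3$ and $N<\dfrac{6p+4\sqrt{p^{2}-p}-2}{p-1}$; (ii) $f(u)=-u^{-p}$ with $p>\frac13$ and $N<\dfrac{6p+4\sqrt{p^{2}+p}+2}{p+1}$.
   Context: Let $F:\mathbb{R}^{N}\to[0,+\infty)$ be a convex function, $F\in C^{2}(\mathbb{R}^{N}\setminus\{0\})$, with $F(t\xi)=|t|F(\xi)$ for all $t\in\mathbb{R}$, $\xi\in\mathbb{R}^{N}$, and $F(\xi)>0$ for $\xi\neq0$. Assume there are constants $0<a\le b<\infty$ and $0<\lambda\le\Lambda<\infty$ such that $a|\xi|\le F(\xi)\le b|\xi|$ for all $\xi\in\mathbb{R}^N$, and $\lambda^{2}|V|^{2}\le \sum_{i,j}F_{\xi_i\xi_j}(\xi)V_iV_j\le\Lambda|V|^{2}$ for all $\xi$ with $|\xi|=1$ and all $V\in\mathbb{R}^N$ with $\langle V,\xi\rangle=0$. Here $F_{\xi_i}=\partial F/\partial\xi_i$, $F_\xi=\nabla F$, and $F_{\xi_i\xi_j}$ are the second partial derivatives. The Finsler-Laplacian is $Qu:=\sum_{i=1}^{N}\frac{\partial}{\partial x_i}\big(F(\nabla u)F_{\xi_i}(\nabla u)\big)$. Weak solution of $-Qu=f(u)$ in $\Omega$: $u\in H^{1}_{loc}(\Omega)$, $f(u)\in L^{1}_{loc}(\Omega)$ and $\int_\Omega F(\nabla u)F_\xi(\nabla u)\cdot\nabla\phi\,dx=\int_\Omega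 f(u)\phi\,dx$ for all $\phi\in C_c^\infty(\Omega)$. A weak solution is stable if $f'(u)\in L^1_{loc}(\Omega)$ and, for all $\phi\in C_c^1(\Omega)$ (sum over repeated indices), $$\int_\Omega F_{\xi_i}(\nabla u)F_{\xi_j}(\nabla u)\phi_{x_i}\phi_{x_j}+F(\nabla u)F_{\xi_i\xi_j}(\nabla u)\phi_{x_i}\phi_{x_j}-f'(u)\phi^2\,dx\ge0.$$ Here $\Omega=\mathbb{R}^N$. *)

(* Defs.v *)
From HB Require Import structures.
From mathcomp Require Import all_boot all_order all_algebra.
From mathcomp Require Import all_classical all_reals all_analysis.

Set Implicit Arguments.
Unset Strict Implicit.
Unset Printing Implicit Defensive.

Import Order.TTheory GRing.Theory Num.Theory.
Import numFieldNormedType.Exports.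

Local Open Scope classical_set_scope.
Local Open Scope ring_scope.

(* The Borel sigma-algebra of R^n, generated by the coordinate maps (the same
   construction as the library's sigma-algebra on n.-tuple T). *)
Definition measure_rV_display : measure_display -> measure_display.
Proof. exact. Qed.

Section measurable_rV.
Context {d} {T : sigmaRingType d}.
Variable n : nat.

Let coors : 'I_n -> 'rV[T]_n -> T := fun i v => v ord0 i.

Let rV_set0 : g_sigma_preimage coors set0.
Proof. exact: sigma_algebra0. Qed.

Let rV_setC A : g_sigma_preimage coors A -> g_sigma_preimage coors (~` A).
Proof. exact: sigma_algebraC. Qed.

Let rV_bigcup (F : _^nat) : (forall i, g_sigma_preimage coors (F i)) ->
  g_sigma_preimage coors (\bigcup_i (F i)).
Proof. exact: sigma_algebra_bigcup. Qed.

HB.instance Definition _ := @isMeasurable.Build (measure_rV_display d)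
  'rV[T]_n (g_sigma_preimage coors) rV_set0 rV_setC rV_bigcup.

End measurable_rV.

Lemma measurable_coord d (T : sigmaRingType d) n (i : 'I_n) :
  measurable_fun [set: 'rV[T]_n] (fun v => v ord0 i).
Proof.
move=> _ Y mY; rewrite setTI; apply: sub_sigma_algebra => /=.
rewrite -bigcup_seq/=; exists i => /=; first by rewrite mem_index_enum.
by exists Y => //; rewrite setTI.
Qed.

Lemma measurable_fun_rVP d1 d2 (T1 : measurableType d1) (T2 : measurableType d2)
    n (f : T1 -> 'rV[T2]_n) :
  measurable_fun [set: T1] f <->
  forall i, measurable_fun [set: T1] (fun x => f x ord0 i).
Proof.
split=> [mf i|mf].
  by apply: (@measurableT_comp _ _ _ _ _ _ (fun v : 'rV_n => v ord0 i)) => //;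
    exact: measurable_coord.
suff : g_sigma_preimage (fun i => (fun v : 'rV[T2]_n => v ord0 i) \o f)
    `<=` measurable.
  rewrite g_sigma_preimage_comp => prefS _ A mA; apply: prefS; exists A => //.
apply: smallest_sub; first exact: sigma_algebra_measurable.
case: n => [|n] in f mf *; first by rewrite big_ord0.
rewrite -bigcup_mkord_ord; apply: bigcup_sub => i Ii.
by move=> A [B mB <-]; exact: mf.
Qed.

Section lebesgue_rV.
Variable R : realType.

Definition cons_rV n (p : measurableTypeR R * 'rV[R]_n) : 'rV[R]_n.+1 :=
  row_mx (const_mx p.1 : 'rV_1) p.2.

Definition uncons_rV n (v : 'rV[R]_n.+1) : measurableTypeR R * 'rV[R]_n :=
  (v ord0 ord0, rsubmx (v : 'rV_(1 + n))).

Lemma cons_rVK n : cancel (@cons_rV n) (@uncons_rV n).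
Proof.
move=> [x v]; rewrite /uncons_rV /cons_rV /= row_mxKr; congr (_, _).
by rewrite mxE; case: splitP => // j _; rewrite mxE.
Qed.

Lemma measurable_cons_rV n : measurable_fun setT (@cons_rV n).
Proof.
apply/measurable_fun_rVP => i; case: (@splitP 1 n i) => j ij.
- rewrite (_ : (fun _ => _) = fst)//; apply/funext => -[x v] /=.
  rewrite /cons_rV /= (_ : i = lshift n j); last exact/val_inj.
  by rewrite (row_mxEl (const_mx x : 'rV_1)) mxE.
- rewrite (_ : (fun _ => _) = (fun v : 'rV_n => v ord0 j) \o snd).
    by apply: measurableT_comp => //; exact: measurable_coord.
  apply/funext => -[x v] /=.
  rewrite /cons_rV /= (_ : i = rshift 1 j); last exact/val_inj.
  by rewrite (row_mxEr (const_mx x : 'rV_1)).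
Qed.

Lemma measurable_uncons_rV n : measurable_fun setT (@uncons_rV n).
Proof.
apply/measurable_fun_pair; first exact: measurable_coord.
apply/measurable_fun_rVP => i.
rewrite (_ : (fun _ => _) = fun v : 'rV[R]_n.+1 => v ord0 (rshift 1 i : 'I_n.+1)).
  exact: measurable_coord.
by apply/funext => v; rewrite mxE.
Qed.

Lemma sigma_finite_product d1 d2 (T1 : measurableType d1)
    (T2 : measurableType d2) (m1 : {sigma_finite_measure set T1 -> \bar R})
    (m2 : {sigma_finite_measure set T2 -> \bar R}) :
  sigma_finite setT (m1 \x m2)%E.
Proof.
have /sigma_finiteP[F [TF ndF Foo]] := sigma_finiteT m1.
have /sigma_finiteP[G [TG ndG Goo]] := sigma_finiteT m2.
exists (fun n => F n `*` G n).
  rewrite -setXTT TF TG predeqE => -[x y]; split.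
    move=> [/= [n _ Fnx] [k _ Gky]]; exists (maxn n k) => //; split.
    - by move: x Fnx; exact/subsetPset/ndF/leq_maxl.
    - by move: y Gky; exact/subsetPset/ndG/leq_maxr.
  by move=> [n _ []/= ? ?]; split; exists n.
move=> k; have [? ?] := Foo k; have [? ?] := Goo k.
split; first exact: measurableX.
by rewrite product_measure1E// lte_mul_pinfty// ge0_fin_numE.
Qed.

Lemma sigma_finite_pushforward_cons_rV n
    (m : {sigma_finite_measure set 'rV[R]_n -> \bar R}) :
  sigma_finite setT
    (pushforward (@lebesgue_measure R \x m)%E (@cons_rV n)).
Proof.
have [G GT Goo] : sigma_finite setT (@lebesgue_measure R \x m)%E.
  exact: sigma_finite_product.
exists (fun k => @uncons_rV n @^-1` G k).
  by rewrite -preimage_bigcup -GT preimage_setT.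
move=> k; have [mGk Gkoo] := Goo k; split.
  by rewrite -[_ @^-1` _]setTI; exact: measurable_uncons_rV.
rewrite /pushforward (_ : _ @^-1` _ = G k)//.
by apply/seteqP; split=> p /=; rewrite cons_rVK.
Qed.

Section step.
Variables (n : nat) (m : {sigma_finite_measure set 'rV[R]_n -> \bar R}).

Definition lebesgue_rV_step : set 'rV[R]_n.+1 -> \bar R :=
  pushforward (@lebesgue_measure R \x m)%E (@cons_rV n).

HB.instance Definition _ := Measure.copy lebesgue_rV_step
  (measure_function_pushforward__canonical__measure_function_Measure
    (@lebesgue_measure R \x m)%E (@measurable_cons_rV n)).

HB.instance Definition _ := Measure_isSigmaFinite.Build _ _ _
  lebesgue_rV_step (sigma_finite_pushforward_cons_rV m).

End step.

(* Lebesgue measure on R^n: the n-fold product of the Lebesgue measure of R. *)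
Fixpoint lebesgue_rV n : {sigma_finite_measure set 'rV[R]_n -> \bar R} :=
  if n is n'.+1 then lebesgue_rV_step (lebesgue_rV n')
  else (\d_(0 : 'rV[R]_0))%R.

Lemma lebesgue_rV_box n (A : 'I_n -> set R) : (forall i, measurable (A i)) ->
  lebesgue_rV n [set v | forall i, A i (v ord0 i)] =
  (\prod_(i < n) @lebesgue_measure R (A i))%E.
Proof.
elim: n A => [|n IH] A mA.
  by rewrite big_ord0 /= diracE mem_set// => -[].
have mB : measurable [set v : 'rV[R]_n | forall i, A (lift ord0 i) (v ord0 i)].
  rewrite (_ : [set _ | _] = \bigcap_(i in [set: 'I_n])
      (fun v : 'rV[R]_n => v ord0 i) @^-1` A (lift ord0 i)); last first.
    by apply/seteqP; split=> v /= h i; [move=> _|]; exact: h.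
  apply: fin_bigcap_measurable => // i _; rewrite -[_ @^-1` _]setTI.
  exact: measurable_coord.
rewrite big_ord_recl -(IH (A \o lift ord0))//= -product_measure1E//; last first.
  exact: mA.
rewrite /lebesgue_rV_step /pushforward; congr (_ _).
have consE x (v : 'rV[R]_n) :
    (cons_rV (x, v) ord0 ord0 = x) *
    (forall i, cons_rV (x, v) ord0 (lift ord0 i) = v ord0 i).
  split=> [|i].
    by have /(congr1 fst) := cons_rVK (x, v).
  have := congr1 (fun p : measurableTypeR R * 'rV[R]_n => p.2 ord0 i)
    (cons_rVK (x, v)).
  by rewrite /= mxE => <-; congr (cons_rV _ _ _); exact/val_inj.
apply/seteqP; split=> -[x v] /=.
  by move=> h; split=> [|i] /=; [rewrite -(consE x v).1|rewrite -(consE x v).2].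
move=> [h0 h] i; have [j ->|->] := unliftP ord0 i.
  by rewrite (consE x v).2; exact: h.
by rewrite (consE x v).1.
Qed.

End lebesgue_rV.

Section finsler.
Variables (R : realType) (N : nat).
Local Notation rV := 'rV[R]_N.
Local Notation mu := (lebesgue_rV R N).

(* The library norm on 'rV[R]_N is the sup norm, hence the Euclidean one here. *)
Definition dot (v w : rV) : R := \sum_i v ord0 i * w ord0 i.
Definition enorm (v : rV) : R := Num.sqrt (dot v v).

Definition partial (i : 'I_N) (f : rV -> R) (x : rV) : R :=
  'D_(delta_mx ord0 i) f x.
Definition grad (f : rV -> R) (x : rV) : rV := \row_i partial i f x.

(* f is of class C^k on A; meant for A open. *)
Fixpoint class_C (k : nat) (A : set rV) (f : rV -> R) : Prop :=
  if k is k'.+1 then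
    (forall x, A x -> differentiable f x) /\
    (forall i, class_C k' A (partial i f))
  else forall x, A x -> {for x, continuous f}.

Definition compactly_supported (f : rV -> R) : Prop :=
  compact (closure [set x | f x != 0]).
Definition Cc (k : nat) (f : rV -> R) : Prop :=
  class_C k setT f /\ compactly_supported f.
Definition Cc_infty (f : rV -> R) : Prop := forall k, Cc k f.

Record finsler_norm (F : rV -> R) : Prop := FinslerNorm {
  finsler_ge0 : forall xi, 0 <= F xi ;
  finsler_convex : convex_function [set: convex_lmodType rV] F ;
  finsler_C2 : class_C 2 [set xi | xi != 0] F ;
  finsler_homogeneous : forall (t : R) xi, F (t *: xi) = `|t| * F xi ;
  finsler_gt0 : forall xi, xi != 0 -> 0 < F xi ;
  finsler_bounds : exists a b : R, [/\ 0 < a, a <= b &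
    forall xi, a * enorm xi <= F xi <= b * enorm xi] ;
  finsler_elliptic : exists lam Lam : R, [/\ 0 < lam, lam <= Lam &
    forall xi V, enorm xi = 1 -> dot V xi = 0 ->
      lam ^+ 2 * enorm V ^+ 2
        <= \sum_i \sum_j partial j (partial i F) xi * V ord0 i * V ord0 j
        <= Lam * enorm V ^+ 2]
}.

(* L^p_loc(R^N), with functions given by Borel representatives *)
Definition Lloc (p : nat) (f : rV -> R) : Prop :=
  measurable_fun setT f /\
  forall K, compact K -> (\int[mu]_(x in K) (`|f x| ^+ p)%:E < +oo)%E.

(* du is the gradient of u in the sense of distributions *)
Definition weak_grad (u : rV -> R) (du : rV -> rV) : Prop :=
  forall phi, Cc_infty phi -> forall i,
    (\int[mu]_x (u x * partial i phi x)%:E =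
     - \int[mu]_x (du x ord0 i * phi x)%:E)%E.

(* u belongs to H^1_loc(R^N) and du represents its weak gradient (which is
   unique up to a null set) *)
Definition H1loc (u : rV -> R) (du : rV -> rV) : Prop :=
  [/\ Lloc 2 u, forall i, Lloc 2 (fun x => du x ord0 i) & weak_grad u du].

(* In the next two definitions the derivatives of F are evaluated at du x, which
   may vanish.  There F is not differentiable, but F 0 = 0 cancels the terms
   F F_i and F F_ij; for F_i F_j the value of [partial i F 0] is the library's
   default 0 for a divergent limit (see partial_finsler0). *)
Definition weak_solution (F : rV -> R) (f : R -> R) (u : rV -> R)
    (du : rV -> rV) : Prop :=
  [/\ H1loc u du, Lloc 1 (f \o u) &
    forall phi, Cc_infty phi ->
      (\int[mu]_x (F (du x) * dot (grad F (du x)) (grad phi x))%:E =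
       \int[mu]_x (f (u x) * phi x)%:E)%E].

Definition stability_integrand (F : rV -> R) (f : R -> R) (u : rV -> R)
    (du : rV -> rV) (phi : rV -> R) (x : rV) : R :=
  \sum_i \sum_j partial i F (du x) * partial j F (du x)
                * partial i phi x * partial j phi x
  + \sum_i \sum_j F (du x) * partial j (partial i F) (du x)
                * partial i phi x * partial j phi x
  - derive1 f (u x) * phi x ^+ 2.

Definition stable (F : rV -> R) (f : R -> R) (u : rV -> R) (du : rV -> rV) :
    Prop :=
  Lloc 1 (derive1 f \o u) /\
  forall phi, Cc 1 phi ->
    (0 <= \int[mu]_x (stability_integrand F f u du phi x)%:E)%E.

Definition has_positive_stable_weak_solution (F : rV -> R) (f : R -> R) :
    Prop :=
  exists u du, [/\ {ae mu, forall x, 0 < u x},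
    weak_solution F f u du & stable F f u du].

Lemma partial_finsler0 (F : rV -> R) (i : 'I_N) :
  finsler_norm F -> partial i F 0 = 0.
Proof.
move=> hF; set e : rV := delta_mx ord0 i.
have e0 : e != 0.
  by apply/eqP => /rowP/(_ i)/eqP; rewrite !mxE !eqxx oner_eq0.
have Fe := finsler_gt0 hF e0.
have quot (h : R) : h^-1 *: (F (h *: e + 0) - F 0) = h^-1 * `|h| * F e.
  have F0 : F 0 = 0 by rewrite -(scale0r e) (finsler_homogeneous hF) normr0 mul0r.
  by rewrite addr0 F0 subr0 (finsler_homogeneous hF) /GRing.scale /= mulrA.
rewrite /partial -/e /derive dvgP// => /cvg_ex[/= l hl].
have right_lim : F e = l.
  apply/esym; apply: (cvg_unique _ (cvg_dnbhs_at_right hl)) => //.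
  apply: cvg_near_cst; near=> h.
  by rewrite quot gtr0_norm ?mulVf ?mul1r// gt_eqF.
have left_lim : - F e = l.
  apply/esym; apply: (cvg_unique _ (cvg_dnbhs_at_left hl)) => //.
  apply: cvg_near_cst; near=> h.
  by rewrite quot ltr0_norm// mulrN mulVf ?mulN1r// lt_eqF.
by move: Fe (Fe); rewrite {1}right_lim -left_lim oppr_gt0 => /lt_trans h /h; rewrite ltxx.
Unshelve. all: by end_near. Qed.

End finsler.

(* Main.v *)
From HB Require Import structures.
From mathcomp Require Import all_boot all_order all_algebra.
From mathcomp Require Import all_classical all_reals all_analysis.
From mathcomp Require Import measurable_realfun ring lra.
Require Import Defs.

Set Implicit Arguments.
Unset Strict Implicit.
Unset Printing Implicit Defensive.

Import Order.TTheory GRing.Theory Num.Theory.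
Import numFieldNormedType.Exports.

Local Open Scope classical_set_scope.
Local Open Scope ring_scope.

(** * Real-valued integrals and square-integrable functions *)

Section integrals.
Context d (T : measurableType d) (R : realType) (mu : {measure set T -> \bar R}).
Implicit Types f g q : T -> R.

Definition L1 f := mu.-integrable setT (EFin \o f).

Lemma L1_measurable f : L1 f -> measurable_fun setT f.
Proof. by move=> /integrableP[/measurable_EFinP]. Qed.

Lemma L1_le f g : measurable_fun setT f -> (forall x, `|f x| <= g x) ->
  L1 g -> L1 f.
Proof.
move=> mf fg; apply: le_integrable => //; first exact/measurable_EFinP.
by move=> x _ /=; rewrite lee_fin (le_trans (fg x))// ler_norm.
Qed.

Lemma L1D f g : L1 f -> L1 g -> L1 (fun x => f x + g x).
Proof. by move=> f1 g1; have := integrableD measurableT f1 g1; apply: eq_integrable. Qed.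

Lemma L1Z (c : R) f : L1 f -> L1 (fun x => c * f x).
Proof. by move=> f1; have := integrableZl measurableT c f1; apply: eq_integrable. Qed.

Lemma L1N f : L1 f -> L1 (fun x => - f x).
Proof. by move=> /(L1Z (-1)); apply: eq_integrable => // x _ /=; rewrite mulN1r. Qed.

Lemma L1B f g : L1 f -> L1 g -> L1 (fun x => f x - g x).
Proof. by move=> f1 /L1N; exact: L1D. Qed.

Lemma L1_norm f : L1 f -> L1 (fun x => `|f x|).
Proof. by move=> f1; exact: integrable_norm. Qed.

Lemma L1_0 : L1 (fun _ => 0).
Proof. exact: integrable0. Qed.

Lemma L1_sum (I : Type) (s : seq I) (F : I -> T -> R) :
  (forall i, L1 (F i)) -> L1 (fun x => \sum_(i <- s) F i x).
Proof.
move=> F1; elim: s => [|i s IH].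
  by under [X in L1 X]eq_fun do rewrite big_nil; exact: L1_0.
by under [X in L1 X]eq_fun do rewrite big_cons; exact: L1D.
Qed.

Lemma L1_eq f g : f =1 g -> L1 f -> L1 g.
Proof. by move=> /funext ->. Qed.

Lemma Rintegral_sum (I : Type) (s : seq I) (F : I -> T -> R) :
  (forall i, L1 (F i)) ->
  \int[mu]_x (\sum_(i <- s) F i x) = \sum_(i <- s) \int[mu]_x F i x.
Proof.
move=> F1; elim: s => [|i s IH].
  by under eq_Rintegral do rewrite big_nil; rewrite big_nil Rintegral_cst// mul0r.
under eq_Rintegral do rewrite big_cons.
rewrite RintegralD//; [|exact: F1|exact: L1_sum].
by rewrite IH big_cons.
Qed.

Lemma RintegralN f : L1 f -> \int[mu]_x (- f x) = - \int[mu]_x f x.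
Proof.
move=> f1; under eq_Rintegral do rewrite -mulN1r.
by rewrite RintegralZl// mulN1r.
Qed.

Lemma EFin_Rintegral f : L1 f -> (\int[mu]_x f x)%:E = (\int[mu]_x (f x)%:E)%E.
Proof. by move=> f1; rewrite fineK// integrable_fin_num. Qed.

Lemma Rintegral_ae_eq f g : measurable_fun setT f -> measurable_fun setT g ->
  {ae mu, forall x, f x = g x} -> (\int[mu]_x (f x)%:E = \int[mu]_x (g x)%:E)%E.
Proof.
move=> mf mg fg; apply: ae_eq_integral => //; try exact/measurable_EFinP.
by apply: filterS fg => x /= -> _.
Qed.

(** Dominated convergence, with an everywhere domination. *)
Lemma Rdominated_cvg (f_ : nat -> T -> R) f g :
  (forall n, measurable_fun setT (f_ n)) -> measurable_fun setT f ->
  {ae mu, forall x, f_ ^~ x @ \oo --> f x} ->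
  L1 g -> (forall n x, `|f_ n x| <= g x) ->
  L1 f /\ (fun n => \int[mu]_x f_ n x) @ \oo --> \int[mu]_x f x.
Proof.
move=> mf_ mf ff g1 fg.
have emf_ n : measurable_fun setT (EFin \o f_ n) by exact/measurable_EFinP.
have emf : measurable_fun setT (EFin \o f) by exact/measurable_EFinP.
have eff : {ae mu, forall x, setT x -> (fun n => (EFin \o f_ n) x) @ \oo --> (EFin \o f) x}.
  apply: filterS ff => x /= h _; apply/fine_cvgP; split => //.
  by apply: nearW.
have efg : {ae mu, forall x n, setT x -> (`|(EFin \o f_ n) x| <= (EFin \o g) x)%E}.
  by apply: nearW => x n _; rewrite lee_fin.
have [f1 _ h] := dominated_convergence measurableT emf_ emf eff g1 efg.
by split => //; move: h; rewrite -(EFin_Rintegral f1) => /fine_cvgP[].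
Qed.

Definition L2 f := measurable_fun setT f /\ L1 (fun x => f x ^+ 2).

Definition norm2 f := \int[mu]_x f x ^+ 2.

Lemma norm2_ge0 f : 0 <= norm2 f.
Proof. by apply: Rintegral_ge0 => x _; rewrite sqr_ge0. Qed.

Lemma L2M f g : L2 f -> L2 g -> L1 (fun x => f x * g x).
Proof.
move=> [mf f2] [mg g2]; apply: (L1_le (g := fun x => f x ^+ 2 + g x ^+ 2)).
- exact: measurable_funM.
- move=> x; rewrite normrM -(real_normK (num_real (f x))) -(real_normK (num_real (g x))).
  have := sqr_ge0 (`|f x| - `|g x|); nra.
- exact: L1D.
Qed.

Lemma L2D f g : L2 f -> L2 g -> L2 (fun x => f x + g x).
Proof.
move=> Hf Hg; have [[mf f2] [mg g2]] := (Hf, Hg); split; first exact: measurable_funD.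
apply: L1_eq (L1D (L1D f2 (L1Z 2 (L2M Hf Hg))) g2) => x /=; ring.
Qed.

Lemma L2Z (c : R) f : L2 f -> L2 (fun x => c * f x).
Proof.
move=> [mf f2]; split; first by apply: measurable_funM => //; exact: measurable_cst.
by apply: L1_eq (L1Z (c ^+ 2) f2) => x /=; ring.
Qed.

Lemma L2B f g : L2 f -> L2 g -> L2 (fun x => f x - g x).
Proof.
move=> Hf Hg; have := L2D Hf (L2Z (-1) Hg).
by under [X in L2 X -> _]eq_fun do rewrite mulN1r.
Qed.

Lemma L2_le f g : measurable_fun setT f -> (forall x, `|f x| <= g x) ->
  L2 g -> L2 f.
Proof.
move=> mf fg [mg g2]; split => //; apply: L1_le g2.
  exact: measurable_funX.
by move=> x; rewrite normrX lerXn2r ?nnegrE// (le_trans _ (fg x)).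
Qed.

(** Multiplication by a bounded function. *)
Lemma L2Mb (M : R) q f : measurable_fun setT q -> (forall x, `|q x| <= M) ->
  L2 f -> L2 (fun x => q x * f x).
Proof.
move=> mq qM Hf; have [mf f2] := Hf; split; first exact: measurable_funM.
apply: L1_le (L1Z (M ^+ 2) f2).
  by apply: measurable_funX; exact: measurable_funM.
move=> x; rewrite normrX normrM exprMn real_normK ?num_real//.
rewrite (_ : f x ^+ 2 = `|f x| ^+ 2) ?real_normK ?num_real//.
rewrite ler_wpM2r ?sqr_ge0// -[leLHS]real_normK ?num_real//.
by rewrite lerXn2r ?nnegrE// (le_trans _ (qM x)).
Qed.

(** Weighted Young inequality: a Cauchy-Schwarz inequality with a free
    parameter, sufficient for all limit arguments. *)
Lemma young_integral (e : R) f g : 0 < e -> L2 f -> L2 g ->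
  \int[mu]_x `|f x * g x| <= e * norm2 f + e^-1 * norm2 g.
Proof.
move=> e0 Hf Hg; have [[mf f2] [mg g2]] := (Hf, Hg).
rewrite -!RintegralZl// -RintegralD//; [|exact: L1Z|exact: L1Z].
apply: le_Rintegral => //; [exact: L1_norm (L2M Hf Hg)| |].
  by apply: L1D; exact: L1Z.
move=> x _; rewrite normrM.
rewrite -(real_normK (num_real (f x))) -(real_normK (num_real (g x))).
have := sqr_ge0 (e * `|f x| - `|g x|).
have -> : e * `|f x| ^+ 2 + e^-1 * `|g x| ^+ 2 =
  e^-1 * ((e * `|f x|) ^+ 2 + `|g x| ^+ 2) by field; rewrite gt_eqF.
have -> : `|f x| * `|g x| = e^-1 * (e * `|f x| * `|g x|) by field; rewrite gt_eqF.
move=> h; rewrite ler_pM2l ?invr_gt0//.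
have : 0 <= e * `|f x| * `|g x| by rewrite !mulr_ge0// ltW.
nra.
Qed.

Lemma norm2D f g : L2 f -> L2 g ->
  norm2 (fun x => f x + g x) <= 2 * norm2 f + 2 * norm2 g.
Proof.
move=> Hf Hg; rewrite -!RintegralZl//; [|exact: Hg.2|exact: Hf.2].
rewrite -RintegralD//; [|exact: L1Z Hf.2|exact: L1Z Hg.2].
apply: le_Rintegral => //; [exact: (L2D Hf Hg).2|apply: L1D;[exact: L1Z Hf.2|exact: L1Z Hg.2]|].
by move=> x _; have := sqr_ge0 (f x - g x); nra.
Qed.

Definition cvg2 (f_ : nat -> T -> R) f :=
  (fun n => norm2 (fun x => f_ n x - f x)) @ \oo --> (0 : R).

Lemma norm2_bounded (M : R) q f : measurable_fun setT q -> (forall x, `|q x| <= M) ->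
  L2 f -> norm2 (fun x => q x * f x) <= M ^+ 2 * norm2 f.
Proof.
move=> mq qM Lf; rewrite -RintegralZl//; last exact: Lf.2.
apply: le_Rintegral => //; [exact: (L2Mb mq qM Lf).2|exact: L1Z Lf.2|].
move=> x _; rewrite exprMn ler_wpM2r ?sqr_ge0//.
rewrite -[leLHS]real_normK ?num_real// lerXn2r ?nnegrE//.
exact: le_trans (normr_ge0 _) (qM x).
Qed.

Lemma norm2_dominated_cvg (d_ : nat -> T -> R) g :
  (forall n, measurable_fun setT (d_ n)) ->
  {ae mu, forall x, d_ ^~ x @ \oo --> (0 : R)} ->
  L2 g -> (forall n x, `|d_ n x| <= g x) ->
  (fun n => norm2 (d_ n)) @ \oo --> (0 : R).
Proof.
move=> md cd Lg dg.
have m1 n : measurable_fun setT (fun x => d_ n x ^+ 2) by exact: measurable_funX.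
have m2 : measurable_fun setT (cst 0 : T -> R) by exact: measurable_cst.
have m3 : {ae mu, forall x, (fun n => d_ n x ^+ 2) @ \oo --> cst 0 x}.
  apply: filterS cd => x cx.
  rewrite -[X in _ --> X](_ : 0 ^+ 2 = 0); last by rewrite expr0n.
  by apply: cvgM; exact: cx.
have m4 n x : `|d_ n x ^+ 2| <= g x ^+ 2.
  by rewrite normrX lerXn2r ?nnegrE// (le_trans _ (dg n x)).
have [_] := Rdominated_cvg m1 m2 m3 Lg.2 m4.
by rewrite Rintegral_cst// mul0r.
Qed.

(** Real sequences dominated by arbitrarily small multiples, up to a null
    sequence. *)
Lemma cvg0_eps (u : nat -> R) (c : R) : 0 <= c -> (forall n, 0 <= u n) ->
  (forall e : R, 0 < e -> exists2 v : nat -> R, v @ \oo --> (0 : R) &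
    forall n, u n <= e * c + v n) -> u @ \oo --> (0 : R).
Proof.
move=> c0 u0 H; apply/cvgrPdist_le => e e0.
have c10 : 0 < c + 1 by lra.
have [|v v0 uv] := H (e / 2 / (c + 1)); first by rewrite !divr_gt0.
have /cvgrPdist_le/(_ (e / 2)) := v0; rewrite divr_gt0// => /(_ isT).
apply: filterS => n; rewrite !sub0r !normrN (ger0_norm (u0 n)) => hv'.
have hv := le_trans (ler_norm (v n)) hv'; rewrite (le_trans (uv n))//.
suff : e / 2 / (c + 1) * c <= e / 2 by lra.
rewrite -[leLHS]mulrA ler_piMr ?divr_ge0 ?(ltW e0)//.
by rewrite mulrC ler_pdivrMr// mul1r; lra.
Qed.

(** Products of two L^2-convergent sequences converge in the mean, also against
    a bounded weight: this passes to the limit in quadratic forms. *)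
Lemma cvg2_prod (M : R) q (a_ b_ : nat -> T -> R) a b :
  measurable_fun setT q -> (forall x, `|q x| <= M) ->
  (forall n, L2 (a_ n)) -> (forall n, L2 (b_ n)) -> L2 a -> L2 b ->
  cvg2 a_ a -> cvg2 b_ b ->
  (fun n => \int[mu]_x (q x * (a_ n x * b_ n x))) @ \oo -->
    \int[mu]_x (q x * (a x * b x)).
Proof.
move=> mq qM La_ Lb_ La Lb ca cb.
have M0 : 0 <= M by exact: le_trans (normr_ge0 _) (qM point).
have L f g : L2 f -> L2 g -> L1 (fun x => q x * (f x * g x)).
  move=> Lf Lg; apply: L1_eq (L2M (L2Mb mq qM Lf) Lg) => x; ring.
have bnd f g e : 0 < e -> L2 f -> L2 g ->
    `|\int[mu]_x (q x * (f x * g x))| <= M * (e * norm2 f + e^-1 * norm2 g).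
  move=> e0 Lf Lg; apply: le_trans (le_normr_Rintegral measurableT (L _ _ Lf Lg)) _.
  have Lfg := L1_norm (L2M Lf Lg).
  apply: (@le_trans _ _ (\int[mu]_x (M * `|f x * g x|))).
    apply: le_Rintegral => //; [exact/L1_norm/L|exact: L1Z|].
    by move=> x _; rewrite normrM ler_wpM2r.
  by rewrite RintegralZl// ler_wpM2l// young_integral.
pose da n x := a_ n x - a x; pose db n x := b_ n x - b x.
have Lda n : L2 (da n) by exact: L2B.
have Ldb n : L2 (db n) by exact: L2B.
have E n : \int[mu]_x (q x * (a_ n x * b_ n x)) - \int[mu]_x (q x * (a x * b x)) =
    \int[mu]_x (q x * (da n x * db n x)) + \int[mu]_x (q x * (a x * db n x))
    + \int[mu]_x (q x * (da n x * b x)).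
  rewrite -RintegralB//; [|exact: L|exact: L].
  have l1 := L _ _ (Lda n) (Ldb n); have l2 := L _ _ La (Ldb n).
  have l3 := L _ _ (Lda n) Lb.
  rewrite -(RintegralD measurableT l1 l2) -(RintegralD measurableT (L1D l1 l2) l3).
  by apply: eq_Rintegral => x _; rewrite /da /db; ring.
apply/subr_cvg0/norm_cvg0P.
apply: (@cvg0_eps _ (M * (norm2 a + norm2 b))) => //.
  by rewrite mulr_ge0// addr_ge0// norm2_ge0.
move=> e e0.
exists (fun n => M * (norm2 (da n) + norm2 (db n) + e^-1 * norm2 (db n)
                      + e^-1 * norm2 (da n))).
  rewrite -(mulr0 M); apply: cvgMr.
  rewrite -[X in _ --> X](_ : 0 + 0 + e^-1 * 0 + e^-1 * 0 = 0); last by ring.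
  by apply: cvgD; [apply: cvgD; [exact: cvgD|exact: cvgMr]|exact: cvgMr].
move=> n; rewrite E.
have h1 := bnd _ _ 1 ltr01 (Lda n) (Ldb n).
have h2 := bnd _ _ e e0 La (Ldb n).
have e'0 : 0 < e^-1 by rewrite invr_gt0.
have h3 := bnd _ _ e^-1 e'0 (Lda n) Lb.
apply: le_trans (ler_normD _ _) _; apply: le_trans (lerD (ler_normD _ _) (lexx _)) _.
move: h1 h2 h3; rewrite invr1 invrK !mul1r; lra.
Qed.

(** A sequence tending to 0 in the mean has a subsequence tending to 0 almost
    everywhere: along a subsequence the integrals are summable. *)
Lemma mean_cvg_subseq_ae (f_ : nat -> T -> R) :
  (forall n, L1 (f_ n)) -> (forall n x, 0 <= f_ n x) ->
  (fun n => \int[mu]_x f_ n x) @ \oo --> (0 : R) ->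
  exists s : nat -> nat, (forall k, (k <= s k)%N) /\
    {ae mu, forall x, (fun k => f_ (s k) x) @ \oo --> (0 : R)}.
Proof.
move=> L f0 cf.
have H k : exists m, (k <= m)%N && (\int[mu]_x f_ m x <= 1 / (2 ^ k.+1)%:R).
  have /cvgrPdist_le/(_ (1 / (2 ^ k.+1)%:R)) := cf.
  rewrite divr_gt0// ?ltr0n ?expn_gt0// => /(_ isT)[m _ hm].
  exists (maxn k m); rewrite leq_maxl/=.
  have := hm (maxn k m) (leq_maxr _ _); rewrite /= sub0r normrN.
  by apply: le_trans; exact: ler_norm.
pose s k := xchoose (H k).
have sP k : (k <= s k)%N && (\int[mu]_x f_ (s k) x <= 1 / (2 ^ k.+1)%:R).
  exact: xchooseP (H k).
exists s; split; first by move=> k; have /andP[] := sP k.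
have mf n : measurable_fun setT (fun x => (f_ (s n) x)%:E).
  by apply/measurable_EFinP; exact: L1_measurable.
have f0' n x : (0 <= (f_ (s n) x)%:E)%E by rewrite lee_fin.
pose S x := (\sum_(0 <= k <oo) (f_ (s k) x)%:E)%E.
have S0 x : (0 <= S x)%E by apply: nneseries_ge0 => n _ _; exact: f0'.
have mS : measurable_fun setT S.
  by apply: ge0_emeasurable_sum => // k x _ _; exact: f0'.
have iS : mu.-integrable setT S.
  apply/integrableP; split => //.
  under eq_integral do rewrite gee0_abs//.
  rewrite integral_nneseries//.
  apply: (@le_lt_trans _ _ (\sum_(0 <= k <oo) (1 / (2 ^ k.+1)%:R : R)%:E)%E).
    apply: lee_nneseries => [k _ _|k _]; first exact: integral_ge0.
    by rewrite -EFin_Rintegral// lee_fin; have /andP[] := sP k.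
  by apply: le_lt_trans (epsilon_trick0 xpredT (@ler01 R)) _; rewrite ltry.
have := integrable_ae measurableT iS; apply: filterS => x /= /(_ I) Sfin.
have : cvgn (series (fun k => f_ (s k) x)).
  apply: nnseries_is_cvg => //.
  by rewrite ltey_eq; move: Sfin; rewrite /S => ->.
exact: cvg_series_cvg_0.
Qed.

End integrals.

Section absorption.
Context d (T : measurableType d) (R : realType) (mu : {measure set T -> \bar R}).

(** The stability inequality bounds Y by X, the equation bounds X by theta Y;
    as theta < 1, for a small parameter e everything but Z can be absorbed. *)
Lemma absorption (K L theta : R) (e : R := (1 - theta) / (2 * (1 + theta))) (Y P P' Z X B : T -> R) :
  0 <= theta < 1 -> 0 <= K -> 0 <= L ->
  L1 mu Y -> L1 mu P -> L1 mu P' -> L1 mu Z -> L1 mu X -> L1 mu B ->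
  (forall x, P' x <= P x) -> (forall x, 0 <= Z x) ->
  (forall (e : R) x, 0 < e -> `|X x| <= e * P x + L / e * Z x) ->
  (forall x, B x <= theta * Y x) ->
  (forall e : R, 0 < e -> \int[mu]_x Y x <=
     \int[mu]_x ((1 + e) * P' x + K * (1 + e^-1) * Z x)) ->
  \int[mu]_x (P x + X x) = \int[mu]_x B x ->
  \int[mu]_x Y x <= 2 / (1 - theta) *
    ((1 + e) * (L / e) + (1 - e) * (K * (1 + e^-1))) * \int[mu]_x Z x.
Proof.
move=> thb; have [th0 th1] := andP thb; move=> K0 L0 LY LP LP' LZ LX LB P'P Z0 XP BY S E.
have ee0 : e = (1 - theta) / (2 * (1 + theta)) by [].
clearbody e.
have e0 : 0 < e by rewrite ee0 divr_gt0 ?subr_gt0// mulr_gt0// ltr_pwDl.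
have ee : e * (2 * (1 + theta)) = 1 - theta by rewrite ee0 mulfVK// gt_eqF// mulr_gt0// ltr_pwDl.
have e1 : e <= 1 by nra.
have iP : \int[mu]_x P' x <= \int[mu]_x P x by apply: le_Rintegral => // x _; exact: P'P.
have iB : \int[mu]_x B x <= theta * \int[mu]_x Y x.
  by rewrite -RintegralZl//; apply: le_Rintegral => //; exact: L1Z.
have iX : - (\int[mu]_x X x) <= e * (\int[mu]_x P x) + L / e * (\int[mu]_x Z x).
  rewrite -RintegralN// -!RintegralZl// -(RintegralD measurableT (L1Z _ LP) (L1Z _ LZ)).
  apply: le_Rintegral => //; [exact: L1N|by apply: L1D; exact: L1Z|].
  by move=> x _; apply: le_trans (XP e x e0); rewrite lerNl lerNnormlW.
have := S e e0; rewrite (RintegralD measurableT (L1Z _ LP') (L1Z _ LZ)) !RintegralZl//.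
move: E; rewrite RintegralD//.
move: iP iB iX; set y := \int[mu]_x Y x; set p := \int[mu]_x P x.
set p' := \int[mu]_x P' x; set z := \int[mu]_x Z x; set b := \int[mu]_x B x.
set x := \int[mu]_x X x => iP iB iX E SS.
have z0 : 0 <= z by apply: Rintegral_ge0 => t _; exact: Z0.
set l := L / e in iX *; set k := K * (1 + e^-1) in SS *.
have h1 : (1 - e) * p <= theta * y + l * z by lra.
have h2 : y <= (1 + e) * p + k * z.
  by apply: le_trans SS _; rewrite lerD2r ler_wpM2l// addr_ge0// ltW.
have h3 : (1 - e) * y <= (1 + e) * (theta * y + l * z) + (1 - e) * (k * z).
  have e1' : 0 <= 1 - e by lra.
  apply: le_trans (ler_wpM2l e1' h2) _.
  rewrite mulrDr lerD2r mulrCA; apply: ler_wpM2l => //; lra.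
have h4 : (1 - theta) / 2 * y <= ((1 + e) * l + (1 - e) * k) * z.
  have -> : (1 - theta) / 2 = (1 - e) - (1 + e) * theta by rewrite -ee; lra.
  by move: h3; rewrite !mulrDl !mulrDr; lra.
have th' : 0 < 1 - theta by rewrite subr_gt0.
have -> : 2 / (1 - theta) * ((1 + e) * l + (1 - e) * k) * z =
   2 / (1 - theta) * (((1 + e) * l + (1 - e) * k) * z) by ring.
rewrite -ler_pdivrMl ?divr_gt0//; apply: le_trans h4.
by rewrite invf_div.
Qed.

End absorption.

Section bounded_monotone.
Context d (T : measurableType d) (R : realType) (mu : {measure set T -> \bar R}).

Lemma L1_bounded_monotone (f_ : nat -> T -> R) (f : T -> R) (B : R) :
  (forall n, L1 mu (f_ n)) -> measurable_fun setT f ->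
  (forall n x, 0 <= f_ n x) -> (forall x, {homo (f_ ^~ x) : n m / (n <= m)%N >-> n <= m}) ->
  (forall x, f_ ^~ x @ \oo --> f x) -> (forall n, \int[mu]_x f_ n x <= B) -> L1 mu f.
Proof.
move=> Lf_ mf f0 fnd fcvg fB; apply/integrableP; split; first exact/measurable_EFinP.
have lim x : limn (fun n => (f_ n x)%:E) = (f x)%:E.
  by apply/cvg_lim => //; apply: cvg_EFin; [exact: nearW|exact: fcvg].
have fge0 x : 0 <= f x by apply: (cvgr_to_ge (fcvg x)); exact: nearW.
under eq_integral => x _ do rewrite /= ger0_norm// -lim.
have mono := @cvg_monotone_convergence _ T R mu setT measurableT
  (fun n x => (f_ n x)%:E) (fun n => (measurable_EFinP _ _).2 (L1_measurable (Lf_ n)))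
  (fun n x _ => f0 n x) (fun x _ n m nm => fnd x n m nm).
apply: (@le_lt_trans _ _ B%:E); last exact: ltry.
apply: (cvge_le _ mono); apply: nearW => n.
by rewrite -(EFin_Rintegral (Lf_ n)) lee_fin.
Qed.

End bounded_monotone.

(** * The sup norm, the Borel sets and the reflections of R^n *)

Section rV_norm.
Context {R : realType} {N : nat}.
Implicit Types x y : 'rV[R]_N.

Lemma normrV_le x (r : R) : 0 <= r ->
  (`|x| <= r) <-> (forall i, `|x ord0 i| <= r).
Proof.
move=> r0; rewrite /Num.Def.normr /= mx_normrE; split.
  by move=> /bigmax_leP[_ h] i; have := h (ord0, i) isT.
move=> h; apply/bigmax_leP; split => // -[i j] _ /=.
by rewrite (ord1 i); exact: h.
Qed.

Lemma normrV_lt x (r : R) : 0 < r ->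
  (`|x| < r) <-> (forall i, `|x ord0 i| < r).
Proof.
move=> r0; rewrite /Num.Def.normr /= mx_normrE; split.
  by move=> /bigmax_ltP[_ h] i; have := h (ord0, i) isT.
move=> h; apply/bigmax_ltP; split => // -[i j] _ /=.
by rewrite (ord1 i); exact: h.
Qed.

Lemma norm_coord x i : `|x ord0 i| <= `|x|.
Proof. exact: (normrV_le x (normr_ge0 x)).1. Qed.

Definition cube (r : R) : set 'rV[R]_N := [set x | `|x| <= r].

Lemma cubeE (r : R) : 0 <= r ->
  cube r = [set x | forall i, `[- r, r]%classic (x ord0 i)].
Proof.
move=> r0; apply/seteqP; split => x /=.
  by move=> /(normrV_le _ r0) h i; rewrite in_itv/= -ler_norml.
by move=> h; apply/(normrV_le _ r0) => i; have := h i; rewrite in_itv/= -ler_norml.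
Qed.

Lemma compact_cube (r : R) : 0 <= r -> compact (cube r).
Proof.
move=> r0; rewrite cubeE//.
by apply: (@rV_compact _ _ (fun=> `[(- r), r]%classic)) => _; exact: segment_compact.
Qed.

Lemma compact_sub_cube (K : set 'rV[R]_N) : compact K ->
  exists2 r, 0 < r & K `<=` cube r.
Proof.
move=> /compact_bounded/ex_strict_bound_gt0[r r0 h].
by exists r => // x Kx; exact/ltW/h.
Qed.

Lemma measurable_fun_coord i : measurable_fun setT (fun x => x ord0 i).
Proof. exact: measurable_coord. Qed.

Lemma measurable_box (A : 'I_N -> set R) : (forall i, measurable (A i)) ->
  measurable [set x : 'rV[R]_N | forall i, A i (x ord0 i)].
Proof.
move=> mA; rewrite (_ : [set _ | _] =
    \bigcap_(i in [set: 'I_N]) (fun x : 'rV[R]_N => x ord0 i) @^-1` A i).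
  apply: fin_bigcap_measurable => // i _; rewrite -[_ @^-1` _]setTI.
  exact: measurable_fun_coord.
by apply/seteqP; split => v /= h i; [move=> _|]; exact: h.
Qed.

Lemma measurable_cube (r : R) : 0 <= r -> measurable (cube r).
Proof. by move=> r0; rewrite cubeE//; apply: (measurable_box (A := fun=> `[- r, r]%classic)). Qed.

(** An open set is the union of the rational boxes that it contains. *)
Lemma open_measurable_rV (U : set 'rV[R]_N) : open U -> measurable U.
Proof.
move=> oU.
have [c cE] : exists c : nat -> R, c = fun k => k.+1%:R^-1 by eexists.
pose B (p : 'rV[rat]_N * nat) := [set x : 'rV[R]_N |
  forall i, `](ratr (p.1 ord0 i) - c p.2), (ratr (p.1 ord0 i) + c p.2)[%classic (x ord0 i)].
pose C (p : 'rV[rat]_N * nat) := if `[< B p `<=` U >] then B p else set0.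
have mC p : measurable (C p).
  by rewrite /C; case: ifPn => // _; apply: (measurable_box (A := fun i =>
    `](ratr (p.1 ord0 i) - c p.2), (ratr (p.1 ord0 i) + c p.2)[%classic)).
suff -> : U = \bigcup_p C p.
  exact: (countable_bigcupT_measurable (countableP _)).
apply/seteqP; split => x; last first.
  by move=> [p _]; rewrite /C; case: asboolP => // + ?; exact.
move=> Ux.
have /nbhs_ballP[e /= e0 xU] : nbhs x U by exact: open_nbhs_nbhs.
have [k _ /(_ k (leqnn k)) hk] := near_infty_natSinv_lt (PosNum (divr_gt0 e0 (@ltr0n R 2))).
have k0 : 0 < c k by rewrite cE invr_gt0.
have {}hk : c k < e / 2 by rewrite cE.
have H i : exists q : rat, ratr q \in `](x ord0 i - c k), (x ord0 i + c k)[.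
  by apply: rat_in_itvoo; lra.
pose q := \row_i xchoose (H i).
have qP i : `|x ord0 i - ratr (q ord0 i)| < c k.
  have := xchooseP (H i); rewrite mxE in_itv/= => /andP[h1 h2].
  rewrite ltr_norml; apply/andP; split; lra.
exists (q, k) => //.
rewrite /C; case: asboolP => [_ i|].
  rewrite /B /= in_itv/=; have := qP i; rewrite ltr_norml => /andP[h1 h2].
  by apply/andP; split; lra.
case=> y By; apply: xU; rewrite -ball_normE /=.
apply/(normrV_lt _ e0) => i; rewrite !mxE.
have := qP i; have := By i; rewrite /= in_itv/= => /andP[h1 h2].
rewrite !ltr_norml => /andP[h3 h4]; apply/andP; split; lra.
Qed.

Lemma continuous_measurable_rV (f : 'rV[R]_N -> R) :
  continuous f -> measurable_fun setT f.
Proof.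
move=> cf mD; apply: (measurability _ (RGenOInfty.measurableE R)) => //.
move=> _ [_ [a ->] <-]; rewrite setTI.
by apply: open_measurable_rV; apply: open_comp.
Qed.

Lemma measurable_subrV d (T : measurableType d) (f g : T -> 'rV[R]_N) :
  measurable_fun setT f -> measurable_fun setT g ->
  measurable_fun setT (fun t => f t - g t).
Proof.
move=> /measurable_fun_rVP mf /measurable_fun_rVP mg.
apply/measurable_fun_rVP => i.
by under eq_fun do rewrite !mxE; exact: measurable_funB.
Qed.

End rV_norm.
Arguments cube {R N}.

Section reflection.
Context {R : realType}.
Local Open Scope ereal_scope.

Lemma lebesgue_measure_reflection (a : R) (f : R -> \bar R) :
  measurable_fun setT f -> (forall x, 0 <= f x) ->
  \int[@lebesgue_measure R]_x f (a - x)%R = \int[@lebesgue_measure R]_x f x.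
Proof.
move=> mf f0.
pose r (x : measurableTypeR R) : measurableTypeR R := (a - x)%R.
have mr : measurable_fun setT r.
  by apply: measurable_funB => //; exact: measurable_cst.
pose nu := measure_function_pushforward__canonical__measure_function_Measure
  (@lebesgue_measure R) mr.
transitivity (\int[nu]_x f x).
  by rewrite /nu /= ge0_integral_pushforward.
apply: (@eq_measure_integral _ _ _ _ (@lebesgue_measure R) nu) => A mA _.
apply/esym; apply: (@lebesgue_measure_unique _ nu) => // _ [[x y] _ <-] /=.
rewrite /pushforward (_ : r @^-1` _ = `[a - y, a - x[%classic)%R.
  rewrite !lebesgue_measure_itv /= !lte_fin.
  by rewrite ltrD2l ltrN2; case: ifP => // _; rewrite -!EFinB; congr (_%:E); ring.
apply/seteqP; split => t /=; rewrite /r !in_itv/= => /andP[h1 h2]; apply/andP; split; lra.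
Qed.

Lemma lebesgue_rV_S N (f : 'rV[R]_N.+1 -> \bar R) :
  measurable_fun setT f -> (forall x, 0 <= f x) ->
  \int[lebesgue_rV R N.+1]_x f x =
  \int[@lebesgue_measure R]_x \int[lebesgue_rV R N]_v f (cons_rV (x, v)).
Proof.
move=> mf f0; rewrite -(fubini_tonelli1 (f \o @cons_rV R N)).
- have := @ge0_integral_pushforward _ _ _ _ _ _ (@measurable_cons_rV R N)
    (@lebesgue_measure R \x lebesgue_rV R N) setT f measurableT mf.
  by apply=> x _; exact: f0.
- by apply: measurableT_comp => //; exact: measurable_cons_rV.
- by move=> ?; exact: f0.
Qed.

Lemma lebesgue_rV_reflection N (a : 'rV[R]_N) (f : 'rV[R]_N -> \bar R) :
  measurable_fun setT f -> (forall x, 0 <= f x) ->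
  \int[lebesgue_rV R N]_x f (a - x)%R = \int[lebesgue_rV R N]_x f x.
Proof.
elim: N a f => [|N IH] a f mf f0.
  apply: eq_integral => x _; congr f.
  by apply/rowP => -[].
have mc : measurable_fun setT (f \o @cons_rV R N).
  by apply: measurableT_comp => //; exact: measurable_cons_rV.
have mfa : measurable_fun setT (fun x : 'rV[R]_N.+1 => f (a - x)%R).
  apply: measurableT_comp => //; apply: measurable_subrV => //; exact: measurable_cst.
rewrite (lebesgue_rV_S mfa)// lebesgue_rV_S//.
pose a0 := a ord0 ord0; pose a' : 'rV[R]_N := \row_i a ord0 (lift ord0 i).
have aE x v : (a - cons_rV (x, v) = cons_rV (a0 - x, a' - v))%R.
  have consE y (w : 'rV[R]_N) : (cons_rV (y, w) ord0 ord0 = y) *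
      (forall i, cons_rV (y, w) ord0 (lift ord0 i) = w ord0 i).
    split=> [|i]; first by have /(congr1 fst) := cons_rVK (y, w).
    have := congr1 (fun p : measurableTypeR R * 'rV[R]_N => p.2 ord0 i)
      (cons_rVK (y, w)).
    by rewrite /= mxE => <-; congr (cons_rV _ _ _); exact/val_inj.
  apply/rowP => i; rewrite [LHS]mxE [X in (_ + X)%R]mxE.
  have [j ->|->] := unliftP ord0 i; rewrite !consE//.
  by rewrite !mxE.
under eq_integral do under eq_integral do rewrite aE.
transitivity (\int[@lebesgue_measure R]_x \int[lebesgue_rV R N]_v f (cons_rV ((a0 - x)%R, v))).
  apply: eq_integral => x _.
  apply: (IH a' (fun v => f (cons_rV ((a0 - x)%R, v)))) => //.
  exact: measurableT_comp mc (pair1_measurable _).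
apply: (lebesgue_measure_reflection a0 (f := fun x => \int[lebesgue_rV R N]_v f (cons_rV (x, v)))).
  exact: (measurable_fun_fubini_tonelli_F (f \o @cons_rV R N) mc (fun=> f0 _)).
by move=> x; apply: integral_ge0.
Qed.

End reflection.

(** * Directional derivatives and a criterion of differentiability *)

Section directional.
Context {R : realType} {V : normedModType R}.
Implicit Types (f : V -> R) (x v : V).

Lemma is_derive_line f x v (t : R) : derivable f (t *: v + x) v ->
  is_derive t (1 : R) (fun h : R => f (h *: v + x)) ('D_v f (t *: v + x)).
Proof.
have E : (fun h : R => h^-1 *: (f (h *: v + (t *: v + x)) - f (t *: v + x))) =
    (fun h : R => h^-1 *: (f ((h *: (1 : R) + t) *: v + x) - f (t *: v + x))).
  apply/funext => h; congr (_ *: (f _ - _)).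
  by rewrite scalerDl [h%:A]mulr1 addrA.
move=> df; apply: DeriveDef.
  by move: df; rewrite /derivable E.
by rewrite /derive E.
Qed.

Lemma differentiable_of_quadratic f x (L : {linear V -> R}) (C r : R) :
  0 < r -> continuous L ->
  (forall h, `|h| < r -> `|f (h + x) - f x - L h| <= C * `|h| ^+ 2) ->
  differentiable f x /\ forall v, 'D_v f x = L v.
Proof.
move=> r0 cL H.
have o : f \o shift x = cst (f x) + L +o_ 0 id.
  apply/eqaddoP => e e0; apply/nbhs_ballP.
  have C0 : 0 < `|C| + 1 by rewrite ltr_wpDl.
  exists (Num.min r (e / (`|C| + 1))); first by rewrite /= lt_min r0 divr_gt0.
  move=> h; rewrite -ball_normE /= sub0r normrN lt_min => /andP[hr he].
  rewrite fctE /= opprD addrA; apply: le_trans (H _ hr) _.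
  apply: (@le_trans _ _ ((`|C| + 1) * `|h| ^+ 2)).
    rewrite ler_wpM2r ?sqr_ge0//; have := ler_norm C; lra.
  rewrite expr2 mulrA ler_wpM2r// mulrC -ler_pdivlMr//; exact: ltW.
have d : differentiable f x.
  apply/diffP => /=.
  apply: (@getPex _ (fun (df : {linear V -> R}) => continuous df /\
    forall y, f y = f (lim (nbhs x)) + df (y - lim (nbhs x))
                  +o_(y \near x) (y - lim (nbhs x)))).
  exists L; split=> //; rewrite lim_id//; apply/(funeqP f).
  apply/eqaddoP => e e0; move/eqaddoP: o => /(_ e e0).
  rewrite [X in _ -> X](near_shift 0) subr0; apply: filterS => h /=.
  by rewrite !fctE /= !addrK opprD addrA.
split => // v; rewrite deriveE//.
by rewrite (diff_unique cL o).
Qed.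

End directional.
(** * Calculus on R^n: partial derivatives and compactly supported functions *)

Section calculus.
Context {R : realType} {N : nat}.
Local Notation rV := 'rV[R]_N.
Implicit Types (r : R) (f g : rV -> R) (x y h : rV) (i j : 'I_N).

Definition total_diff f x h := \sum_i h ord0 i * partial i f x.

Lemma derive_partial f x h : differentiable f x -> 'D_h f x = total_diff f x h.
Proof.
move=> df; rewrite deriveE// {1}(row_sum_delta h) linear_sum.
by apply: eq_bigr => i _; rewrite linearZ /partial deriveE.
Qed.

Fact total_diff_is_linear f x : linear (total_diff f x : rV -> R).
Proof.
move=> a u v; rewrite /total_diff /GRing.scale/= mulr_sumr -big_split/=.
by apply: eq_bigr => i _; rewrite !mxE; ring.
Qed.
HB.instance Definition _ f x := GRing.isLinear.Build R rV R *:%R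
  (total_diff f x) (total_diff_is_linear f x).

Lemma coordrV_continuous i : continuous (fun x : rV => x ord0 i).
Proof. exact: coord_continuous. Qed.

Lemma coordrV_differentiable i x : differentiable (fun x : rV => x ord0 i) x.
Proof. exact: differentiable_coord. Qed.

Lemma continuous_sum (T : topologicalType) (I : Type) (s : seq I) (F : I -> T -> R) :
  (forall k : I, continuous (F k)) -> continuous (fun t : T => \sum_(k <- s) F k t).
Proof.
move=> cF; elim: s => [|k s IH] t.
  by under [X in continuous_at _ X]eq_fun do rewrite big_nil; exact: cst_continuous.
under [X in continuous_at _ X]eq_fun do rewrite big_cons.
by apply: (@continuousD _ R^o) => //; [exact: cF|exact: IH].
Qed.

Lemma total_diff_continuous f x : continuous (total_diff f x).
Proof.
apply: continuous_sum => i y.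
by apply: (@continuousM R _ (fun v : rV => v ord0 i) (cst (partial i f x)));
  [exact: coordrV_continuous|exact: cst_continuous].
Qed.

Lemma le_total_diff f x h (M : R) : (forall i, `|partial i f x| <= M) ->
  `|total_diff f x h| <= N%:R * M * `|h|.
Proof.
move=> H; apply: le_trans (ler_norm_sum _ _ _) _.
apply: (@le_trans _ _ (\sum_(i < N) (M * `|h|))).
  apply: ler_sum => i _; rewrite normrM mulrC ler_pM//.
  exact: norm_coord.
by rewrite sumr_const card_ord -[leLHS]mulr_natl mulrA.
Qed.

(** Mean value theorem along a segment. *)
Lemma segment_mvt f x h : (forall y, differentiable f y) ->
  exists2 c : R, 0 <= c <= 1 & f (h + x) - f x = total_diff f (c *: h + x) h.
Proof.
move=> df.
have dg (t : R) : is_derive t (1 : R) (fun t : R => f (t *: h + x)) ('D_h f (t *: h + x)).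
  by apply: is_derive_line; exact: diff_derivable.
have [|c cin] := @MVT R (fun t : R => f (t *: h + x)) (fun t => 'D_h f (t *: h + x)) 0 1 ltr01 (fun t _ => dg t).
  apply: continuous_subspaceT => t; apply: differentiable_continuous.
  by apply/derivable1_diffP; have [] := dg t.
rewrite scale1r scale0r add0r subr0 mulr1 => ->.
exists c; last exact: derive_partial.
by move: cin; rewrite in_itv/= => /andP[/ltW -> /ltW ->].
Qed.

Lemma lipschitz_of_partial f x h (M : R) : (forall y, differentiable f y) ->
  (forall i y, `|partial i f y| <= M) -> `|f (h + x) - f x| <= N%:R * M * `|h|.
Proof.
move=> df H; have [c _ ->] := segment_mvt x h df.
exact: le_total_diff.
Qed.

Lemma taylor2 f x h (M : R) : (forall y, differentiable f y) ->
  (forall i y, differentiable (partial i f) y) ->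
  (forall i j y, `|partial j (partial i f) y| <= M) ->
  `|f (h + x) - f x - total_diff f x h| <= N%:R * N%:R * M * `|h| ^+ 2.
Proof.
move=> df d2f H; have [c /andP[c0 c1] ->] := segment_mvt x h df.
rewrite /total_diff -sumrB; apply: le_trans (ler_norm_sum _ _ _) _.
apply: (@le_trans _ _ (\sum_(i < N) (N%:R * M * `|h| ^+ 2))).
  apply: ler_sum => i _; rewrite -mulrBr normrM expr2 mulrA mulrC.
  rewrite ler_pM// ?norm_coord//.
  apply: le_trans (lipschitz_of_partial _ _ (d2f i) (H i)) _.
  have := H i i x => /(le_trans (normr_ge0 _)) M0.
  rewrite ler_wpM2l ?mulr_ge0// normrZ ger0_norm//.
  by rewrite ler_piMl.
by rewrite sumr_const card_ord -[leLHS]mulr_natl !mulrA.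
Qed.

Lemma class_C1P f : class_C 1 setT f <->
  (forall x, differentiable f x) /\ (forall i, continuous (partial i f)).
Proof.
split=> [[df cf]|[df cf]]; split => //.
- by move=> x; exact: df.
- by move=> i x; exact: cf.
- by move=> i x _; exact: cf.
Qed.

Lemma class_CW k A f : class_C k.+1 A f -> class_C k A f.
Proof.
elim: k f => [|k IH] f [df cf].
  by move=> x Ax; apply: differentiable_continuous; exact: df.
by split => // i; exact: IH.
Qed.

Lemma Cc_infty_partial f i : Cc_infty f -> (forall k, class_C k setT (partial i f)).
Proof. by move=> Cf k; have [[_ /(_ i)]] := Cf k.+1. Qed.

(** [vanish r f]: the support of f lies in the cube of radius r. *)
Definition vanish (r : R) f := forall x, r < `|x| -> f x = 0.

Lemma open_normrV_gt (r : R) : open [set x : rV | r < `|x|].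
Proof.
rewrite (_ : [set _ | _] = (fun x : rV => `|x|) @^-1` [set y | r < y])//.
by apply: open_comp; [move=> x _; exact: norm_continuous|exact: open_gt].
Qed.

Lemma vanish_partial r f i : vanish r f -> vanish r (partial i f).
Proof.
move=> vf x rx; rewrite /partial (@near_eq_derive _ _ _ f (cst 0)) ?derive_cst//.
have : nbhs x [set x : rV | r < `|x|].
  by apply: open_nbhs_nbhs; split => //; exact: open_normrV_gt.
by apply: filterS => y /vf.
Qed.

Lemma vanish_compact r f : 0 <= r -> vanish r f -> compactly_supported f.
Proof.
move=> r0 vf; apply: (@subclosed_compact _ _ (cube r)).
- exact: closed_closure.
- exact: compact_cube.
- have /closure_id -> : closed (cube r : set rV).
    by apply: compact_closed; [exact: norm_hausdorff|exact: compact_cube].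
  apply: closure_subset => x /= fx0; rewrite /cube/= leNgt.
  by apply/negP => /vf /eqP; apply/negP.
Qed.

Lemma compact_vanish f : compactly_supported f -> exists2 r, 0 < r & vanish r f.
Proof.
move=> /compact_sub_cube[r r0 H]; exists r => // x rx; apply/eqP/negP => /negP fx.
have /H : closure [set x | f x != 0] x by exact: subset_closure.
by rewrite /cube /= leNgt rx.
Qed.

Lemma vanish_bounded r f : 0 <= r -> vanish r f -> continuous f ->
  exists M, forall x, `|f x| <= M.
Proof.
move=> r0 vf cf.
have ne : (cube r : set rV) !=set0 by exists 0; rewrite /cube/= normr0.
have cn : {within (cube r : set rV), continuous (fun x : rV => `|f x|)}.
  apply: continuous_subspaceT => x.
  by apply: (@continuous_comp _ _ _ f Num.norm); [exact: cf|exact: norm_continuous].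
have [c _ H] := compact_EVT_max ne (compact_cube r0) cn.
exists `|f c| => x; have [xr|/vf ->] := leP `|x| r; last by rewrite normr0.
by apply: H; rewrite inE.
Qed.

Lemma class_C_continuous k f : class_C k setT f -> continuous f.
Proof.
elim: k f => [|k IH] f.
  by move=> cf x; exact: cf.
by move=> /class_CW; exact: IH.
Qed.

Lemma partialM f g x i : differentiable f x -> differentiable g x ->
  partial i (fun x => f x * g x) x = f x * partial i g x + g x * partial i f x.
Proof. by move=> df dg; rewrite /partial deriveM//; exact: diff_derivable. Qed.

Lemma chain_rule f (G : R -> R) (dG : R) x : differentiable f x ->
  is_derive (f x) (1 : R) G dG ->
  differentiable (G \o f) x /\ forall i, partial i (G \o f) x = dG * partial i f x.
Proof.
move=> df [dGx <-].
have dG' : differentiable G (f x) by exact/derivable1_diffP.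
have d : differentiable (G \o f) x by exact: differentiable_comp.
split => // i; rewrite /partial !deriveE// diff_comp//=.
by rewrite -[X in 'd G _ X]mulr1 -[_ * 1]/(_ *: (1 : R)) linearZ /= mulrC.
Qed.

End calculus.

(** * A smooth bump function *)

Section derivative_rules.
Context {R : realType}.
Implicit Types (f g : R -> R) (x a b : R).

Lemma is_derive_eq1 f x a b : is_derive x (1 : R) f a -> a = b ->
  is_derive x (1 : R) f b.
Proof. by move=> + <-. Qed.

Lemma dfunM f g x a b : is_derive x (1 : R) f a -> is_derive x (1 : R) g b ->
  is_derive x (1 : R) (fun y => f y * g y) (f x * b + g x * a).
Proof. exact: is_deriveM. Qed.

Lemma dfunD f g x a b : is_derive x (1 : R) f a -> is_derive x (1 : R) g b ->
  is_derive x (1 : R) (fun y => f y + g y) (a + b).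
Proof. exact: is_deriveD. Qed.

Lemma dfunB f g x a b : is_derive x (1 : R) f a -> is_derive x (1 : R) g b ->
  is_derive x (1 : R) (fun y => f y - g y) (a - b).
Proof. exact: is_deriveB. Qed.

Lemma dfunN f x a : is_derive x (1 : R) f a ->
  is_derive x (1 : R) (fun y => - f y) (- a).
Proof. exact: is_deriveN. Qed.

Lemma dfunZ (c : R) f x a : is_derive x (1 : R) f a ->
  is_derive x (1 : R) (fun y => c * f y) (c * a).
Proof. exact: is_deriveZ. Qed.

Lemma dfunX n f x a : is_derive x (1 : R) f a ->
  is_derive x (1 : R) (fun y => f y ^+ n) (n%:R * f x ^+ n.-1 * a).
Proof. by move=> /(@is_deriveX _ _ f n); rewrite exprfctE. Qed.

Lemma dfunV f x a : f x != 0 -> is_derive x (1 : R) f a ->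
  is_derive x (1 : R) (fun y => (f y)^-1) (- (a / f x ^+ 2)).
Proof.
move=> fx0 /(is_deriveV fx0) h; apply: (is_derive_eq1 h).
by rewrite /GRing.scale/= mulrC mulrN.
Qed.

Lemma dfun_id x : is_derive x (1 : R) (fun y : R => y) 1.
Proof. exact: is_derive_id. Qed.

Lemma dfun_cst (c : R) x : is_derive x (1 : R) (fun _ : R => c) 0.
Proof. exact: is_derive_cst. Qed.

Lemma dfun_comp f g x a b : is_derive (g x) (1 : R) f a -> is_derive x (1 : R) g b ->
  is_derive x (1 : R) (fun y => f (g y)) (a * b).
Proof. exact: is_derive1_comp. Qed.

Lemma dfun_expR f x a : is_derive x (1 : R) f a ->
  is_derive x (1 : R) (fun y => expR (f y)) (expR (f x) * a).
Proof. by apply: dfun_comp; exact: is_derive_expR. Qed.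

Lemma dfun_powR f x a (r : R) : 0 < f x -> is_derive x (1 : R) f a ->
  is_derive x (1 : R) (fun y => f y `^ r) (r * f x `^ (r - 1) * a).
Proof. by move=> fx0; apply: (dfun_comp (f := fun y => y `^ r)); exact: is_derive1_powR. Qed.

Lemma dfun_continuous f x a : is_derive x (1 : R) f a -> {for x, continuous f}.
Proof.
by move=> [df _]; apply: differentiable_continuous; exact/derivable1_diffP.
Qed.

End derivative_rules.

Section bump1.
Context {R : realType}.
Implicit Types (P : {poly R}) (k : nat) (x : R).

Lemma expR_ge_pow (n : nat) (y : R) : 0 <= y -> (y / n.+1%:R) ^+ n.+1 <= expR y.
Proof.
move=> y0; have E : y = n.+1%:R * (y / n.+1%:R) by field; rewrite addrC natr1 pnatr_eq0.
rewrite [in leRHS]E expRM_natl.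
rewrite lerXn2r ?nnegrE ?divr_ge0 ?expR_ge0//.
by apply: le_trans (expR_ge1Dx _); rewrite lerDr.
Qed.

Lemma invX_expRN_le k (w : R) : 0 < w ->
  w^-1 ^+ k * expR (- w^-1) <= k.+2%:R ^+ k.+2 * w ^+ 2.
Proof.
move=> w0; rewrite expRN.
have w'0 : 0 < w^-1 by rewrite invr_gt0.
have h := @expR_ge_pow k.+1 w^-1 (ltW w'0).
rewrite ler_pdivrMr ?expR_gt0//.
have e1 : k.+2%:R ^+ k.+2 * (w^-1 / k.+2%:R) ^+ k.+2 = w^-1 ^+ k.+2.
  by rewrite -exprMn mulrCA divff ?mulr1// pnatr_eq0.
have -> : w^-1 ^+ k = k.+2%:R ^+ k.+2 * w ^+ 2 * (w^-1 / k.+2%:R) ^+ k.+2.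
  by rewrite mulrAC e1 -[k.+2]addn2 exprD -mulrA -exprMn mulVf ?gt_eqF// expr1n mulr1.
by rewrite ler_wpM2l// mulr_ge0 ?exprn_ge0 ?ltW.
Qed.

(** The class of these functions is closed under derivation: this is what makes
    them smooth at the end points of [-1, 1]. *)
Definition bumpf P k x : R :=
  if 0 < 1 - x ^+ 2 then P.[x] * ((1 - x ^+ 2)^-1 ^+ k * expR (- (1 - x ^+ 2)^-1))
  else 0.

Definition bumpf_deriv P k : {poly R} :=
  P^`() * (1 - 'X ^+ 2) ^+ 2 + (2 * k%:R)%:P * 'X * P * (1 - 'X ^+ 2) - 2%:P * 'X * P.

Lemma is_derive_bumpf P k x :
  is_derive x (1 : R) (bumpf P k) (bumpf (bumpf_deriv P k) k.+2 x).
Proof.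
pose w (y : R) := 1 - y ^+ 2.
have [wx|wx] := ltP 0 (w x).
  have nw : \forall y \near x, 0 < w y.
    have cw : {for x, continuous w}.
      by apply: dfun_continuous (dfunB (dfun_cst 1 x) (dfunX 2 (dfun_id x))).
    exact: (cvgr_gt (w x) cw _ wx).
  apply: (@near_eq_is_derive _ _ _ (fun y => P.[y] * ((w y)^-1 ^+ k * expR (- (w y)^-1)))).
    by apply: filterS nw => y; rewrite /bumpf /w => ->.
  have dP : is_derive x (1 : R) (horner P) (P^`().[x]).
    rewrite derivE derive1E; apply: derivableP; exact: derivable_horner.
  have dw : is_derive x (1 : R) w (0 - 2%:R * x ^+ 1 * 1).
    exact: dfunB (dfun_cst 1 x) (dfunX 2 (dfun_id x)).
  have w0 : w x != 0 by rewrite gt_eqF.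
  have dV := dfunV w0 dw.
  apply: is_derive_eq1 (dfunM dP (dfunM (dfunX k dV) (dfun_expR (dfunN dV)))) _.
  rewrite /bumpf -/(w x) wx -[k.+2]addn2 exprD.
  have -> : (bumpf_deriv P k).[x] =
      P^`().[x] * w x ^+ 2 + 2 * k%:R * x * P.[x] * w x - 2 * x * P.[x].
    by rewrite /bumpf_deriv /w !hornerE.
  have -> : k%:R * (w x)^-1 ^+ k.-1 = k%:R * w x * (w x)^-1 ^+ k.
    case: (k) => [|m] /=; first by rewrite !mul0r.
    by rewrite exprS mulrA mulfK.
  rewrite expr1 mulr1 sub0r exprVn.
  move: (expR _) P^`().[x] P.[x] => e Q' Q; move: (w x) w0 => W W0.
  by field; rewrite ?W0 ?expf_neq0.
have bx0 : bumpf P k x = 0 by rewrite /bumpf ltNge wx.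
have b'x0 : bumpf (bumpf_deriv P k) k.+2 x = 0 by rewrite /bumpf ltNge wx.
have c_ge0 : 0 <= (k.+2%:R : R) ^+ k.+2 by rewrite exprn_ge0.
pose c : R := k.+2%:R ^+ k.+2; pose M := \sum_(i < size P) `|P`_i|.
have M0 : 0 <= M by apply: sumr_ge0.
have [|||d dv] := @differentiable_of_quadratic R R^o (bumpf P k) x
    (\0 : {linear R^o -> R}) (M * c * (4 * `|x| ^+ 2)) 1.
- by [].
- exact: cst_continuous.
- move=> h _; rewrite bx0 subr0 /= subr0.
  have h0 : 0 <= M * c * (4 * `|x| ^+ 2) * `|h| ^+ 2.
    by repeat (apply: mulr_ge0 => //).
  rewrite {1}/bumpf; case: ifP => wh; last by rewrite normr0.
  rewrite normrM (ger0_norm (x := _ * expR _)); last first.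
    by rewrite mulr_ge0 ?expR_ge0// exprn_ge0// invr_ge0 ltW.
  have -> : M * c * (4 * `|x| ^+ 2) * `|h| ^+ 2 = M * (c * (2 * (`|x| * `|h|)) ^+ 2) by ring.
  apply: ler_pM => //.
  + by rewrite mulr_ge0 ?expR_ge0// exprn_ge0// invr_ge0 ltW.
  + rewrite horner_coef; apply: le_trans (ler_norm_sum _ _ _) _.
    apply: ler_sum => i _; rewrite normrM ler_piMr// normrX exprn_ile1//.
    by rewrite -(@ler_pXn2r _ 2)// ?nnegrE// expr1n real_normK ?num_real//; lra.
  + apply: le_trans (invX_expRN_le _ wh) _; rewrite -/c ler_wpM2l//.
    rewrite lerXn2r ?nnegrE ?(ltW wh)// ?mulr_ge0//.
    have := lerNnormlW (lexx `|x * h|); rewrite normrM; move: wx; rewrite /w.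
    have := sqr_ge0 h; move: (`|x| * `|h|) => t; nra.
apply: DeriveDef; first exact: diff_derivable.
by rewrite dv b'x0.
Qed.

Definition smooth1 (f : R -> R) := exists D : nat -> R -> R,
  D 0%N = f /\ forall k x, is_derive x (1 : R) (D k) (D k.+1 x).

Lemma smooth1_affine (f : R -> R) (t s : R) :
  smooth1 f -> smooth1 (fun x => f (t * x + s)).
Proof.
move=> [D [D0 DS]]; exists (fun k x => t ^+ k * D k (t * x + s)).
split; first by apply/funext => x; rewrite expr0 mul1r D0.
move=> k x.
have da : is_derive x (1 : R) (fun x => t * x + s) (t * 1 + 0).
  exact: dfunD (dfunZ t (dfun_id x)) (dfun_cst s x).
have := dfunZ (t ^+ k) (dfun_comp (f := D k) (g := fun x => t * x + s) (DS k _) da).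
by move=> h; apply: (is_derive_eq1 h); rewrite exprSr; ring.
Qed.

Definition bump (x : R) : R := bumpf 1 0 x.

Lemma bumpE x : bump x = if 0 < 1 - x ^+ 2 then expR (- (1 - x ^+ 2)^-1) else 0.
Proof. by rewrite /bump /bumpf; case: ifP => // _; rewrite (hornerC 1) expr0 !mul1r. Qed.

Lemma smooth1_bump : smooth1 bump.
Proof.
exists (fun n => let: (P, k) := iter n (fun p => (bumpf_deriv p.1 p.2, p.2.+2)) (1, 0%N) in
  bumpf P k).
split => // n x; rewrite iterS; case: (iter _ _ _) => P k /=.
exact: is_derive_bumpf.
Qed.

Lemma bump_ge0 x : 0 <= bump x.
Proof. by rewrite bumpE; case: ifP => // _; exact: expR_ge0. Qed.

Lemma bump_le1 x : bump x <= 1.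
Proof.
rewrite bumpE; case: ifP => // h.
by rewrite -[leRHS]expR0 ler_expR oppr_le0 invr_ge0 ltW.
Qed.

Lemma sqr_lt1 x : (0 < 1 - x ^+ 2) = (`|x| < 1).
Proof. by rewrite subr_gt0 -[X in _ < X]/(1 : R) -(@ltr_pXn2r _ 2 isT `|x|) ?nnegrE// expr1n real_normK ?num_real. Qed.

Lemma bump_gt0 x : `|x| < 1 -> 0 < bump x.
Proof. by rewrite bumpE -sqr_lt1 => ->; exact: expR_gt0. Qed.

Lemma bump_out x : 1 <= `|x| -> bump x = 0.
Proof. by rewrite bumpE sqr_lt1 ltNge => ->. Qed.

(** The bump decays so fast that its derivative is controlled by any of its
    powers of exponent less than 1. *)
Lemma bump_deriv_le (s : R) : 0 < s < 1 -> exists2 C, 0 <= C & forall x d,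
  is_derive x (1 : R) bump d -> `|d| <= C * bump x `^ (1 - s).
Proof.
move=> /andP[s0 s1]; exists (2 * (2 / s) ^+ 2); first by rewrite mulr_ge0// sqr_ge0.
move=> x d dx; have -> : d = bumpf (bumpf_deriv 1 0) 2 x.
  have [_ <-] := dx; have [_ <-] // := is_derive_bumpf 1 0 x.
rewrite bumpE /bumpf; case: ifP => [w0|_]; last first.
  by rewrite normr0 powR0 ?mulr0// subr_eq0 eq_sym lt_eqF.
have -> : (bumpf_deriv 1 0).[x] = - (2 * x).
  by rewrite /bumpf_deriv (derivC 1) mul0r add0r mulr0 !mul0r add0r !mulr1 !hornerE.
set w := 1 - x ^+ 2.
rewrite /powR gt_eqF ?expR_gt0// expRK.
have w'0 : 0 < w^-1 by rewrite invr_gt0.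
have x1 : `|- (2 * x)| <= 2.
  by rewrite normrN normrM ger0_norm// ler_piMr// ltW// -sqr_lt1.
have e0 : 0 <= w^-1 ^+ 2 * expR (- w^-1) by rewrite mulr_ge0 ?expR_ge0// sqr_ge0.
rewrite normrM (ger0_norm e0); apply: le_trans (ler_wpM2r e0 x1) _.
have -> : (1 - s) * - w^-1 = s * w^-1 + - w^-1 by ring.
rewrite expRD.
have -> : 2 * (2 / s) ^+ 2 * (expR (s * w^-1) * expR (- w^-1)) =
  2 * (((2 / s) ^+ 2 * expR (s * w^-1)) * expR (- w^-1)) by ring.
rewrite ler_pM2l// ler_wpM2r ?expR_ge0//.
have := expR_ge_pow 1 (y := s * w^-1); rewrite mulr_ge0 ?(ltW s0) ?(ltW w'0)// => /(_ isT) h.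
apply: le_trans (ler_wpM2l (sqr_ge0 (2 / s)) h).
rewrite -exprMn (_ : 2 / s * _ = w^-1)//.
by field; rewrite !gt_eqF.
Qed.

End bump1.

Section tensor.
Context {R : realType} {N : nat}.
Implicit Types (b : 'I_N -> R -> R) (i j : 'I_N) (x : 'rV[R]_N).

Definition tensor b x : R := \prod_i b i (x ord0 i).

Definition upd b j (f : R -> R) : 'I_N -> R -> R := fun i => if i == j then f else b i.

Lemma tensor_differentiable b x : (forall i y, exists d, is_derive y (1 : R) (b i) d) ->
  differentiable (tensor b) x.
Proof.
move=> db; rewrite /tensor; elim: (index_enum _) => [|i s IH].
  by under eq_fun do rewrite big_nil; exact: differentiable_cst.
under eq_fun do rewrite big_cons.
apply: differentiableM => //.
have [d dd] := db i (x ord0 i).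
by have [] := chain_rule (coordrV_differentiable i x) dd.
Qed.

Lemma partial_tensor b j (f : R -> R) x :
  (forall i y, exists d, is_derive y (1 : R) (b i) d) ->
  (forall y, is_derive y (1 : R) (b j) (f y)) ->
  partial j (tensor b) x = tensor (upd b j f) x.
Proof.
move=> db df.
have dt := diff_derivable (v := delta_mx ord0 j) (tensor_differentiable x db).
have lineE (h : R) : tensor b (h *: delta_mx ord0 j + x) =
    (\prod_(i | i != j) b i (x ord0 i)) * b j (h + x ord0 j).
  rewrite /tensor (bigD1 j)//= mulrC !mxE !eqxx mulr1; congr (_ * _).
  by apply: eq_bigr => i ij; rewrite !mxE eqxx (negbTE ij) mulr0 add0r.
have := @is_derive_line _ _ (tensor b) x (delta_mx ord0 j) 0.
rewrite !scale0r !add0r => /(_ dt).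
under [X in is_derive _ _ X _ -> _]eq_fun do rewrite lineE.
move=> [_ dE]; rewrite /partial -dE.
have d0 : is_derive (0 : R) (1 : R) (fun h : R => h + x ord0 j) (1 + 0).
  exact: dfunD (dfun_id 0) (dfun_cst _ _).
have [_ ->] := dfunZ (\prod_(i | i != j) b i (x ord0 i))
  (dfun_comp (f := b j) (g := fun h => h + x ord0 j) (df _) d0).
rewrite /tensor [RHS](bigD1 j)//= /upd eqxx !add0r addr0 mulr1 mulrC; congr (_ * _).
by apply: eq_bigr => i /negbTE ->.
Qed.

Lemma tensor_class_C b : (forall i, smooth1 (b i)) ->
  forall k, class_C k setT (tensor b).
Proof.
move=> sb k; elim: k b sb => [|k IH] b sb.
  move=> x _; apply: differentiable_continuous; apply: tensor_differentiable => i y.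
  by have [D [<- DS]] := sb i; exists (D 1%N y).
have db i y : exists d, is_derive y (1 : R) (b i) d.
  by have [D [<- DS]] := sb i; exists (D 1%N y).
split => [x _|j]; first exact: tensor_differentiable.
have [D [D0 DS]] := sb j.
rewrite (_ : partial j (tensor b) = tensor (upd b j (D 1%N))).
  apply: IH => i; rewrite /upd; case: ifP => // _.
  by exists (fun k => D k.+1).
apply/funext => x; apply: partial_tensor => // y.
by rewrite -D0; exact: DS.
Qed.

Lemma tensor_vanish b (r : R) : (forall i y, r < `|y| -> b i y = 0) -> 0 <= r ->
  vanish r (tensor b).
Proof.
move=> vb r0 x; rewrite ltNge => /negP xr.
have /existsP[i xi] : [exists i, r < `|x ord0 i|].
  case: (boolP [exists i, r < `|x ord0 i|]) => // /existsPn H; case: xr.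
  by apply/(normrV_le _ r0) => i; have := H i; rewrite -leNgt.
by apply/eqP; apply/prodf_eq0; exists i => //; rewrite vb.
Qed.

End tensor.

(** * Convolution with smooth kernels *)

Section local_integrability.
Context {R : realType} {N : nat}.
Local Notation rV := 'rV[R]_N.
Local Notation mu := (lebesgue_rV R N).
Implicit Types (f g v w : rV -> R) (r M : R).

Lemma mu_cube r : 0 <= r -> mu (cube r) = ((2 * r) ^+ N)%:E.
Proof.
move=> r0; rewrite cubeE// (lebesgue_rV_box (A := fun=> `[- r, r]%classic))//.
under eq_bigr do rewrite lebesgue_measure_itv/= lte_fin.
have -> : (if - r < r then (r%:E - (- r)%:E)%E else 0%E) = (2 * r)%:E.
  case: ifP => [_|]; first by rewrite -EFinB; congr (_%:E); ring.
  by move=> /negbT; rewrite -leNgt => h; congr (_%:E); lra.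
by rewrite prodEFin prodr_const card_ord.
Qed.

Definition ind (A : set rV) : rV -> R := \1_A.

Lemma measurable_ind A : measurable A -> measurable_fun setT (ind A).
Proof. by move=> mA; exact: measurable_indic. Qed.

Lemma indE A x : ind A x = (x \in A)%:R.
Proof. by rewrite /ind indicE. Qed.

Lemma ind_cube r x : ind (cube r) x = (`|x| <= r)%R%:R.
Proof. by rewrite indE; congr (nat_of_bool _)%:R; apply/idP/idP; rewrite inE. Qed.

Lemma ind_ge0 A x : 0 <= ind A x. Proof. by rewrite indE ler0n. Qed.

Lemma ind_le1 A x : ind A x <= 1. Proof. by rewrite indE; case: (_ \in _). Qed.

Lemma ind_norm A x : `|ind A x| <= 1.
Proof. by rewrite ger0_norm ?ind_le1// ind_ge0. Qed.

Lemma ind_sqr A x : ind A x ^+ 2 = ind A x.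
Proof. by rewrite indE; case: (_ \in _); rewrite /= ?expr1n ?expr0n. Qed.

Lemma L1_ind_cube r : 0 <= r -> L1 mu (ind (cube r)).
Proof.
move=> r0; have mc := @measurable_cube R N r r0.
apply/integrableP; split; first by apply/measurable_EFinP; exact: measurable_ind.
rewrite (eq_integral (fun x => (\1_(cube r) x)%:E)); last first.
  by move=> t _; rewrite gee0_abs// lee_fin.
have h : (mu (cube r) < +oo)%E by rewrite mu_cube// ltry.
by rewrite integral_indic// setIT.
Qed.

Lemma L2_ind_cube r : 0 <= r -> L2 mu (ind (cube r)).
Proof.
move=> r0; split; first by apply: measurable_ind; exact: measurable_cube.
by apply: L1_eq (L1_ind_cube r0) => x; rewrite ind_sqr.
Qed.

Definition loc1 v := measurable_fun setT v /\
  forall r, 0 <= r -> L1 mu (fun x => ind (cube r) x * v x).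

Definition loc2 v := measurable_fun setT v /\
  forall r, 0 <= r -> L2 mu (fun x => ind (cube r) x * v x).

Lemma Lloc1P v : Lloc 1 v -> loc1 v.
Proof.
move=> [mv H]; split => // r r0.
have mc := @measurable_cube R N r r0.
apply/integrableP; split.
  by apply/measurable_EFinP; apply: measurable_funM => //; exact: measurable_ind.
have {H} := H (cube r) (compact_cube r0).
rewrite [X in (X < _)%E -> _]integral_mkcond; apply: le_lt_trans.
apply: ge0_le_integral => //.
- apply/measurable_EFinP; apply: measurableT_comp => //.
  by apply: measurable_funM => //; exact: measurable_ind.
- apply/(measurable_restrictT _ _).1 => //; apply/measurable_EFinP.
  by apply: measurable_funX; apply: measurableT_comp => //; exact: measurable_funTS.
- move=> x _ /=; rewrite patchE ind_cube; case: ifPn => [|].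
    by rewrite inE => /= ->; rewrite mul1r expr1.
  by rewrite notin_setE /cube/= => /negP/negbTE ->; rewrite mul0r normr0.
Qed.

Lemma Lloc2P v : Lloc 2 v -> loc2 v.
Proof.
move=> [mv H]; split => // r r0.
have mi : measurable_fun setT (fun x => ind (cube r) x * v x).
  by apply: measurable_funM => //; apply: measurable_ind; exact: measurable_cube.
split => //.
suff /Lloc1P[_ /(_ r r0)] : Lloc 1 (fun x => v x ^+ 2).
  by apply: L1_eq => x; rewrite exprMn ind_sqr.
split; first exact: measurable_funX.
move=> K cK; have := H K cK; apply: le_lt_trans.
by under eq_integral do rewrite expr1 normrX.
Qed.

Lemma vanish_ind r f x : vanish r f -> f x = f x * ind (cube r) x.
Proof.
move=> vf; rewrite ind_cube; have [_|/vf ->] := leP `|x| r; first by rewrite mulr1.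
by rewrite mul0r.
Qed.

Lemma loc1M v f M r : loc1 v -> measurable_fun setT f -> (forall x, `|f x| <= M) ->
  0 <= r -> vanish r f -> L1 mu (fun x => v x * f x).
Proof.
move=> [mv lv] mf fM r0 vf.
apply: (@L1_le _ _ _ mu _ (fun x => M * `|ind (cube r) x * v x|)).
- exact: measurable_funM.
- move=> x; rewrite (vanish_ind x vf) mulrCA normrM [v x * _]mulrC.
  by rewrite ler_wpM2r.
- by apply: L1Z; apply: L1_norm; exact: lv.
Qed.

Lemma L2_of_vanish f M r : measurable_fun setT f -> (forall x, `|f x| <= M) ->
  0 <= r -> vanish r f -> L2 mu f.
Proof.
move=> mf fM r0 vf; have := L2Mb mf fM (L2_ind_cube r0).
by congr L2; apply/funext => x; rewrite -vanish_ind.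
Qed.

Lemma L1_of_vanish f M r : measurable_fun setT f -> (forall x, `|f x| <= M) ->
  0 <= r -> vanish r f -> L1 mu f.
Proof.
move=> mf fM r0 vf.
have : L1 mu (fun x => 1 * f x).
  apply: (@loc1M (cst 1) f M r) => //; split; first exact: measurable_cst.
  by move=> r' r'0; apply: L1_eq (L1_ind_cube r'0) => x; rewrite mulr1.
by apply: L1_eq => x; rewrite mul1r.
Qed.

Lemma loc2_loc1 v : loc2 v -> loc1 v.
Proof.
move=> [mv lv]; split => // r r0.
apply: L1_eq (L2M (L2_ind_cube r0) (lv r r0)) => x.
by rewrite mulrA -expr2 ind_sqr.
Qed.

Lemma L2_loc2 v : L2 mu v -> loc2 v.
Proof.
move=> Lv; split; first exact: Lv.1.
move=> r r0; apply: (L2Mb (M := 1)) => //; last exact: ind_norm.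
apply: measurable_ind; exact: measurable_cube.
Qed.

(** Invariance under the reflections y |-> x - y, for integrable functions. *)
Lemma L1_reflection (a : rV) f : L1 mu f -> L1 mu (fun x => f (a - x)).
Proof.
move=> Lf; have mf := L1_measurable Lf.
have ma : measurable_fun setT (fun x : rV => a - x).
  by apply: measurable_subrV => //; exact: measurable_cst.
apply/integrableP; split; first by apply/measurable_EFinP; exact: measurableT_comp.
move/integrableP: Lf => [mf' ]; apply: le_lt_trans.
have h := lebesgue_rV_reflection a (f := fun x => `|(f x)%:E|%E).
by rewrite -h//; exact: measurableT_comp.
Qed.

Lemma Rintegral_reflection (a : rV) f : L1 mu f ->
  \int[mu]_x f (a - x) = \int[mu]_x f x.
Proof.
move=> Lf; have mf := L1_measurable Lf; congr fine.
have mf' : measurable_fun setT (EFin \o f) by exact/measurable_EFinP.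
rewrite [LHS]integralE [RHS]integralE.
have hp := lebesgue_rV_reflection a (measurable_funepos mf').
have hn := lebesgue_rV_reflection a (measurable_funeneg mf').
by rewrite -hp// -hn//; congr (_ - _)%E; apply: eq_integral => x _; rewrite ?funeposE ?funenegE.
Qed.

Lemma Rintegral_shift (a : rV) f : L1 mu f ->
  \int[mu]_x f (x - a) = \int[mu]_x f x.
Proof.
move=> Lf; have L0 := L1_reflection 0 Lf.
rewrite -[RHS](Rintegral_reflection 0 Lf) -[RHS](Rintegral_reflection a L0).
by apply: eq_Rintegral => x _; congr f; rewrite sub0r opprB.
Qed.

End local_integrability.

Lemma finite_bound (R : realType) (I : finType) (T : Type) (F : I -> T -> R) :
  (forall i, exists M, forall x, `|F i x| <= M) ->
  exists M, forall i x, `|F i x| <= M.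
Proof.
move=> /choice[M HM]; exists (\sum_i `|M i|) => i x.
apply: le_trans (HM i x) _; rewrite (bigD1 i)//=.
apply: (le_trans (ler_norm _)); rewrite lerDl.
by apply: sumr_ge0.
Qed.

Section convolution.
Context {R : realType} {N : nat}.
Local Notation rV := 'rV[R]_N.
Local Notation mu := (lebesgue_rV R N).
Implicit Types (f g v w k : rV -> R) (r M : R) (i j : 'I_N).

Lemma Cc_infty_bounds k : Cc_infty k -> exists r M, [/\ 0 < r, vanish r k,
  forall x, `|k x| <= M, forall i x, `|partial i k x| <= M &
  forall i j x, `|partial j (partial i k) x| <= M].
Proof.
move=> Ck; have [r r0 vk] := compact_vanish (Ck 0%N).2.
have r0' := ltW r0; exists r.
have [M1 h1] := vanish_bounded r0' vk (class_C_continuous (Ck 0%N).1).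
have C1 i := Cc_infty_partial i Ck.
have [M2 h2] : exists M, forall i x, `|partial i k x| <= M.
  apply: finite_bound => i.
  exact: vanish_bounded r0' (vanish_partial _ vk) (class_C_continuous (C1 i 0%N)).
have [M3 h3] : exists M, forall (p : 'I_N * 'I_N) x, `|partial p.2 (partial p.1 k) x| <= M.
  apply: finite_bound => -[i j] /=.
  apply: vanish_bounded r0' (vanish_partial _ (vanish_partial _ vk)) _.
  by have [_ /(_ j)] := C1 i 1%N; exact: (@class_C_continuous _ _ 0).
exists (Num.max M1 (Num.max M2 M3)); split => //.
- by move=> x; rewrite le_max h1.
- by move=> i x; rewrite !le_max h2 orbT.
- by move=> i j x; rewrite !le_max (h3 (i, j)) !orbT.
Qed.

Definition conv v k x := \int[mu]_y (v y * k (x - y)).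

Lemma measurable_reflection k (x : rV) : measurable_fun setT k ->
  measurable_fun setT (fun y : rV => k (x - y)).
Proof.
move=> mk; apply: measurableT_comp => //.
by apply: measurable_subrV => //; exact: measurable_cst.
Qed.

Lemma vanish_reflection r k (x : rV) : vanish r k ->
  vanish (`|x| + r) (fun y => k (x - y)).
Proof.
move=> vk y xy; apply: vk; rewrite distrC.
by have := lerB_dist y x; lra.
Qed.

Lemma L1_conv v k M r (x : rV) : loc1 v -> measurable_fun setT k ->
  (forall z, `|k z| <= M) -> 0 <= r -> vanish r k ->
  L1 mu (fun y => v y * k (x - y)).
Proof.
move=> lv mk kM r0 vk.
apply: (loc1M (M := M) (r := `|x| + r)) => //; first exact: measurable_reflection.
  by rewrite addr_ge0.
exact: vanish_reflection.
Qed.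

Lemma Cc_infty_measurable k : Cc_infty k -> measurable_fun setT k.
Proof. by move=> /(_ 0%N)[/class_C_continuous/continuous_measurable_rV]. Qed.

Lemma Cc_inftyP k r : 0 <= r -> vanish r k -> (forall m, class_C m setT k) -> Cc_infty k.
Proof. by move=> r0 vk Ck m; split => //; exact: vanish_compact vk. Qed.

Lemma Cc_inftyS k i : Cc_infty k -> Cc_infty (partial i k).
Proof.
move=> Ck; have [r r0 vk] := compact_vanish (Ck 0%N).2.
apply: (Cc_inftyP (ltW r0)) => //; first exact: vanish_partial.
exact: Cc_infty_partial.
Qed.

Lemma L1_conv_smooth v k (x : rV) : loc1 v -> Cc_infty k ->
  L1 mu (fun y => v y * k (x - y)).
Proof.
move=> lv Ck; have [r [M [r0 vk kM _ _]]] := Cc_infty_bounds Ck.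
exact: L1_conv (Cc_infty_measurable Ck) kM (ltW r0) vk.
Qed.

(** The second-order Taylor remainder of the kernel is quadratic uniformly, so
    the convolution inherits a quadratic remainder. *)
Lemma conv_differentiable v k (x : rV) : loc1 v -> Cc_infty k ->
  differentiable (conv v k) x /\ forall i, partial i (conv v k) x = conv v (partial i k) x.
Proof.
move=> lv Ck; have [r [M [r0 vk kM k1M k2M]]] := Cc_infty_bounds Ck.
have dk y : differentiable k y by have [[+ _] _] := Ck 1%N; apply.
have d2k i y : differentiable (partial i k) y.
  by have [[_ /(_ i)[+ _]] _] := Ck 2%N; apply.
pose rr := `|x| + 1 + r.
have rr0 : 0 <= rr by rewrite /rr !addr_ge0// ltW.
pose L (h : rV) := \sum_i h ord0 i * conv v (partial i k) x.
have Llin : linear (L : rV -> R).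
  move=> a h h'; rewrite /L /GRing.scale/= mulr_sumr -big_split/=.
  by apply: eq_bigr => i _; rewrite !mxE; ring.
pose Lm := GRing.isLinear.Build R rV R *:%R L Llin.
pose LL : {linear rV -> R} := HB.pack L Lm.
pose C := N%:R * N%:R * M * \int[mu]_y `|ind (cube rr) y * v y|.
have LvI := L1_norm (lv.2 _ rr0).
have [||h h1|d dL] := @differentiable_of_quadratic R rV (conv v k) x LL C 1.
- by [].
- apply: continuous_sum => i y.
  by apply: (@continuousM R _ (fun u : rV => u ord0 i) (cst _));
    [exact: coordrV_continuous|exact: cst_continuous].
- rewrite /= /L /conv.
  have I1 := L1_conv_smooth (h + x) lv Ck; have I0 := L1_conv_smooth x lv Ck.
  have I2 i := L1_conv_smooth x lv (Cc_inftyS i Ck).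
  have -> : \sum_i h ord0 i * \int[mu]_y (v y * partial i k (x - y)) =
      \int[mu]_y (\sum_i h ord0 i * (v y * partial i k (x - y))).
    rewrite Rintegral_sum; last by move=> i; exact: (L1Z (h ord0 i) (I2 i)).
    by apply: eq_bigr => i _; rewrite (RintegralZl (h ord0 i) measurableT (I2 i)).
  have IS : L1 mu (fun y => \sum_i h ord0 i * (v y * partial i k (x - y))).
    by apply: L1_sum => i; exact: (L1Z (h ord0 i) (I2 i)).
  rewrite -RintegralB// -RintegralB//; last exact: L1B.
  apply: le_trans (le_normr_Rintegral measurableT (L1B (L1B I1 I0) IS)) _.
  rewrite /C mulrAC -RintegralZl//.
  apply: le_Rintegral => //; [exact: L1_norm (L1B (L1B I1 I0) IS)|exact: L1Z|].
  move=> y _.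
  have -> : v y * k (h + x - y) - v y * k (x - y) - \sum_i h ord0 i * (v y * partial i k (x - y))
      = v y * (k (h + (x - y)) - k (x - y) - total_diff k (x - y) h).
    rewrite /total_diff !mulrBr addrA mulr_sumr; congr (_ - _).
    by apply: eq_bigr => i _; ring.
  have [yr|yr] := leP `|y| rr.
    rewrite ind_cube yr mul1r normrM mulrC ler_wpM2r//.
    exact: taylor2.
  rewrite vk ?vk; last 2 first.
  + by have := lerB_dist y x; rewrite distrC; move: yr; rewrite /rr; lra.
  + have := lerB_dist y (h + x); rewrite addrA distrC.
    by have := ler_normD h x; move: yr; rewrite /rr; lra.
  have -> : total_diff k (x - y) h = 0.
    rewrite /total_diff big1// => i _; rewrite (vanish_partial _ vk) ?mulr0//.
    by have := lerB_dist y x; rewrite distrC; move: yr; rewrite /rr; lra.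
  by rewrite !subr0 mulr0 normr0 ind_cube [`|y| <= rr]leNgt yr mul0r normr0 mulr0.
split => // i; rewrite /partial dL /= /L (bigD1 i)//= mxE !eqxx mul1r big1 ?addr0//.
by move=> j ji; rewrite mxE eqxx (negbTE ji) mul0r.
Qed.

Lemma conv_class_C v k : loc1 v -> Cc_infty k -> forall m, class_C m setT (conv v k).
Proof.
move=> lv + m; elim: m k => [|m IH] k Ck.
  by move=> x _; apply: differentiable_continuous; have [] := conv_differentiable x lv Ck.
split => [x _|i]; first by have [] := conv_differentiable x lv Ck.
rewrite (_ : partial i _ = conv v (partial i k)); first exact: IH (Cc_inftyS i Ck).
by apply/funext => x; have [_ ->] := conv_differentiable x lv Ck.
Qed.

Lemma conv_vanish v k r r' : vanish r' v -> vanish r k -> vanish (r' + r) (conv v k).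
Proof.
move=> vv vk x xr; rewrite /conv; under eq_Rintegral => y _.
  rewrite (_ : v y * k (x - y) = 0); last first.
    have [yr|/vv ->] := leP `|y| r'; last by rewrite mul0r.
    by rewrite vk ?mulr0//; have := lerB_dist x y; lra.
  over.
by rewrite Rintegral_cst// mul0r.
Qed.

End convolution.

(** * Mollification converges in the local L^2 sense *)

Section mollifier.
Context {R : realType} {N : nat}.
Local Notation rV := 'rV[R]_N.
Local Notation mu := (lebesgue_rV R N).
Implicit Types (f g v w k : rV -> R) (r M : R) (i j : 'I_N).

Lemma class_C_scale m (c : R) f : class_C m setT f -> class_C m setT (fun x => c * f x).
Proof.
elim: m f => [|m IH] f.
  move=> cf x _.
  by apply: (@continuousM R _ (cst c) f); [exact: cst_continuous|exact: (cf x I)].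
move=> [df cf]; split => [x _|i].
  by apply: differentiableM => //; exact: df.
rewrite (_ : partial i _ = fun x => c * partial i f x); first exact: IH (cf i).
apply/funext => x; rewrite partialM//; last exact: df.
by rewrite /partial derive_cst mulr0 addr0.
Qed.

Definition bumpN (t : R) : rV -> R := tensor (fun _ y => bump (t * y)).

Lemma bumpN_class_C (t : R) m : class_C m setT (bumpN t).
Proof.
apply: tensor_class_C => _; have := smooth1_affine t 0 (@smooth1_bump R).
by congr smooth1; apply/funext => x; rewrite addr0.
Qed.

Lemma bumpN_ge0 (t : R) x : 0 <= bumpN t x.
Proof. by apply: prodr_ge0 => i _; exact: bump_ge0. Qed.

Lemma bumpN_le1 (t : R) x : bumpN t x <= 1.
Proof. by apply: prodr_ile1 => i _; rewrite bump_ge0 bump_le1. Qed.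

Lemma bumpN_vanish (t : R) : 0 < t -> vanish t^-1 (bumpN t).
Proof.
move=> t0; apply: tensor_vanish; last by rewrite invr_ge0 ltW.
move=> _ y ty; apply: bump_out; rewrite normrM gtr0_norm//.
by rewrite mulrC -ler_pdivrMr// mul1r ltW.
Qed.

Lemma bumpN_Cc_infty (t : R) : 0 < t -> Cc_infty (bumpN t).
Proof.
move=> t0; apply: (@Cc_inftyP _ _ _ t^-1); first by rewrite invr_ge0 ltW.
  exact: bumpN_vanish.
by move=> m; exact: bumpN_class_C.
Qed.

Lemma bumpN_gt0 (t : R) x : 0 < t -> `|x| < t^-1 -> 0 < bumpN t x.
Proof.
move=> t0 xt; apply: prodr_gt0 => i _; apply: bump_gt0.
rewrite normrM gtr0_norm// mulrC -ltr_pdivlMr// mul1r.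
exact: le_lt_trans (norm_coord x i) xt.
Qed.

Lemma Cc_infty_L1 k : Cc_infty k -> L1 mu k.
Proof.
move=> Ck; have [r [M [r0 vk kM _ _]]] := Cc_infty_bounds Ck.
exact: L1_of_vanish (Cc_infty_measurable Ck) kM (ltW r0) vk.
Qed.

(** A nonnegative function that is positive on a cube has a positive integral. *)
Lemma Rintegral_gt0 f r : L1 mu f -> (forall x, 0 <= f x) -> 0 < r ->
  {ae mu, forall x, `|x| <= r -> 0 < f x} -> 0 < \int[mu]_x f x.
Proof.
move=> Lf f0 r0 fr; rewrite lt_def Rintegral_ge0// andbT; apply/eqP => I0.
have mf : measurable_fun setT (EFin \o f) by apply/measurable_EFinP; exact: L1_measurable Lf.
have : (\int[mu]_x `|(EFin \o f) x| = 0)%E.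
  under eq_integral do rewrite gee0_abs ?lee_fin//.
  by rewrite -EFin_Rintegral// I0.
move=> /(ae_eq_integral_abs mu measurableT mf) H.
have mc : measurable (cube r : set rV) by apply: measurable_cube; exact: ltW.
have : mu (cube r) = 0%E.
  apply/(negligibleP mu mc); rewrite -[cube r]setCK.
  apply: (filterS2 _ _ H fr) => x /= /(_ I)[fx0] fx; rewrite /cube/= => xr.
  by have := fx xr; rewrite fx0 ltxx.
rewrite mu_cube ?(ltW r0)// => -[] /eqP; apply/negP.
by rewrite expf_neq0// mulf_neq0 ?gt_eqF.
Qed.

Lemma mollifier_exists n : exists k, [/\ Cc_infty k, forall z, 0 <= k z,
  vanish n.+1%:R^-1 k & \int[mu]_x k x = 1].
Proof.
have n0 : 0 < n.+1%:R :> R by [].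
have C1 := bumpN_Cc_infty n0; have L := Cc_infty_L1 C1.
pose c := \int[mu]_x bumpN n.+1%:R x.
have c0 : 0 < c.
  apply: (@Rintegral_gt0 _ (n.+1%:R^-1 / 2)) => //.
  - exact: bumpN_ge0.
  - apply: nearW => x xr; apply: bumpN_gt0 => //; apply: le_lt_trans xr _.
    by rewrite ltr_pdivrMr// ltr_pMr ?invr_gt0// ltr1n.
exists (fun x => c^-1 * bumpN n.+1%:R x); split.
- apply: (@Cc_inftyP _ _ _ n.+1%:R^-1); first by rewrite invr_ge0.
    by move=> x xr; rewrite bumpN_vanish ?mulr0.
  by move=> m; apply: class_C_scale; exact: bumpN_class_C.
- by move=> z; rewrite mulr_ge0 ?bumpN_ge0// invr_ge0 ltW.
- by move=> x xr; rewrite bumpN_vanish ?mulr0.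
- by rewrite RintegralZl// mulVf// gt_eqF.
Qed.

Definition rho n := sval (cid (mollifier_exists n)).

Lemma rhoP n : [/\ Cc_infty (rho n), forall z, 0 <= rho n z,
  vanish n.+1%:R^-1 (rho n) & \int[mu]_x rho n x = 1].
Proof. exact: svalP (cid (mollifier_exists n)). Qed.

Lemma L1_shift (a : rV) f : L1 mu f -> L1 mu (fun x => f (x - a)).
Proof.
move=> /(L1_reflection 0)/(L1_reflection a).
by apply: L1_eq => x; rewrite sub0r opprB.
Qed.

Section contraction.
Variable k : rV -> R.
Hypotheses (Ck : Cc_infty k) (k0 : forall z, 0 <= k z) (k1 : \int[mu]_x k x = 1).

Lemma L1_conv_sqr w x : L2 mu w -> L1 mu (fun y => w y ^+ 2 * k (x - y)).
Proof.
move=> [mw Lw]; apply: L1_conv_smooth => //.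
split; first exact: measurable_funX.
move=> r r0; apply: (L1_le _ _ Lw).
  apply: measurable_funM; last exact: measurable_funX.
  by apply: measurable_ind; exact: measurable_cube.
move=> y; rewrite normrM normrX -[leRHS]mul1r -[w y ^+ 2 in leRHS]real_normK ?num_real//.
by rewrite ler_wpM2r ?sqr_ge0 ?ind_norm.
Qed.

(** Jensen's inequality for the probability density k (x - .): expand the
    integral of the nonnegative function (w - conv w k x)^2. *)
Lemma conv_sqr_le w x : L2 mu w ->
  conv w k x ^+ 2 <= \int[mu]_y (w y ^+ 2 * k (x - y)).
Proof.
move=> Lw; have I2 := L1_conv_sqr x Lw.
have I1 := L1_conv_smooth x (loc2_loc1 (L2_loc2 Lw)) Ck.
have I0 : L1 mu (fun y => k (x - y)) by apply: L1_reflection; exact: Cc_infty_L1.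
pose a := conv w k x.
have : 0 <= \int[mu]_y (w y ^+ 2 * k (x - y) - (2 * a) * (w y * k (x - y)) + a ^+ 2 * k (x - y)).
  apply: Rintegral_ge0 => y _.
  rewrite (_ : _ + _ = (w y - a) ^+ 2 * k (x - y)); last by ring.
  by rewrite mulr_ge0 ?sqr_ge0.
rewrite (RintegralD measurableT (L1B I2 (L1Z _ I1)) (L1Z _ I0)).
rewrite (RintegralB measurableT I2 (L1Z _ I1)) !RintegralZl//.
rewrite -/(conv w k x) -/a Rintegral_reflection; last exact: Cc_infty_L1.
rewrite k1; nra.
Qed.

Lemma conv_L2 w : L2 mu w -> L2 mu (conv w k) /\ norm2 mu (conv w k) <= norm2 mu w.
Proof.
move=> Lw; have [mw w2] := Lw.
have mc : measurable_fun setT (conv w k).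
  apply: continuous_measurable_rV; apply: (@class_C_continuous _ _ 0).
  exact: conv_class_C (loc2_loc1 (L2_loc2 Lw)) Ck _.
have mk := Cc_infty_measurable Ck.
pose f (p : rV * rV) : \bar R := (w p.2 ^+ 2 * k (p.1 - p.2))%:E.
have mf : measurable_fun setT f.
  apply/measurable_EFinP; apply: measurable_funM.
    by apply: measurable_funX; apply: measurableT_comp.
  by apply: measurableT_comp => //; exact: measurable_subrV.
have f0 p : (0 <= f p)%E by rewrite lee_fin mulr_ge0 ?sqr_ge0.
have E : (\int[mu]_x \int[mu]_y f (x, y) = \int[mu]_y (w y ^+ 2)%:E)%E.
  rewrite fubini_tonelli//; apply: eq_integral => y _.
  have Ls := L1_shift y (Cc_infty_L1 Ck).
  rewrite /f /= -EFin_Rintegral; last exact: L1Z.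
  rewrite RintegralZl// Rintegral_shift ?k1 ?mulr1//.
  exact: Cc_infty_L1.
have le : (\int[mu]_x (conv w k x ^+ 2)%:E <= \int[mu]_y (w y ^+ 2)%:E)%E.
  rewrite -E; apply: ge0_le_integral => //.
  - by move=> x _; rewrite lee_fin sqr_ge0.
  - by apply/measurable_EFinP; exact: measurable_funX.
  - exact: (measurable_fun_fubini_tonelli_F f mf f0).
  - move=> x _; rewrite /f /= -EFin_Rintegral ?lee_fin; last exact: L1_conv_sqr.
    exact: conv_sqr_le.
have LL : L2 mu (conv w k).
  split => //; apply/integrableP; split.
    by apply/measurable_EFinP; exact: measurable_funX.
  under eq_integral do rewrite gee0_abs ?lee_fin ?sqr_ge0//.
  by apply: le_lt_trans le _; rewrite -(EFin_Rintegral w2) ltry.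
split => //; rewrite -lee_fin.
by rewrite /norm2 (EFin_Rintegral LL.2) (EFin_Rintegral w2).
Qed.

Lemma convB w w' x : loc1 w -> loc1 w' ->
  conv (fun y => w y - w' y) k x = conv w k x - conv w' k x.
Proof.
move=> Lw Lw'; rewrite /conv -(RintegralB measurableT (L1_conv_smooth x Lw Ck) (L1_conv_smooth x Lw' Ck)).
by apply: eq_Rintegral => y _; ring.
Qed.

Lemma convZ (c : R) w x : loc1 w -> conv (fun y => c * w y) k x = c * conv w k x.
Proof.
move=> Lw; rewrite /conv -(RintegralZl c measurableT (L1_conv_smooth x Lw Ck)).
by apply: eq_Rintegral => y _; ring.
Qed.

End contraction.

Lemma loc1B w w' : loc1 w -> loc1 w' -> loc1 (fun y => w y - w' y).
Proof.
move=> [mw lw] [mw' lw']; split; first exact: measurable_funB.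
by move=> r r0; apply: L1_eq (L1B (lw r r0) (lw' r r0)) => x; ring.
Qed.

Lemma loc1Z (c : R) w : loc1 w -> loc1 (fun y => c * w y).
Proof.
move=> [mw lw]; split; first by apply: measurable_funM => //; exact: measurable_cst.
by move=> r r0; apply: L1_eq (L1Z c (lw r r0)) => x; ring.
Qed.

(** The class of square-integrable functions for which mollification converges:
    it contains the continuous compactly supported functions, and it is closed
    under linear combinations and dominated pointwise limits. *)
Definition approx2 w := L2 mu w /\ cvg2 mu (fun n => conv w (rho n)) w.

Lemma L2loc1 w : L2 mu w -> loc1 w.
Proof. by move=> /L2_loc2/loc2_loc1. Qed.

Lemma conv_rho_L2 n w : L2 mu w -> L2 mu (conv w (rho n)).
Proof. by have [C k0 _ k1] := rhoP n; move=> /(conv_L2 C k0 k1)[]. Qed.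

Lemma norm2_conv_rho n w : L2 mu w -> norm2 mu (conv w (rho n)) <= norm2 mu w.
Proof. by have [C k0 _ k1] := rhoP n; move=> /(conv_L2 C k0 k1)[]. Qed.

Lemma approx2Z (c : R) w : approx2 w -> approx2 (fun x => c * w x).
Proof.
move=> [Lw cw]; split; first exact: L2Z.
rewrite /cvg2 (_ : (fun n => _) = fun n => c ^+ 2 * norm2 mu (fun x => conv w (rho n) x - w x)).
  by rewrite -(mulr0 (c ^+ 2)); apply: cvgMr.
apply/funext => n; rewrite /norm2 -RintegralZl//; last first.
  by apply: (L2B _ Lw).2; exact: conv_rho_L2.
apply: eq_Rintegral => x _; have [C _ _ _] := rhoP n.
by rewrite (convZ C)//; [ring|exact: L2loc1].
Qed.

Lemma approx2B w w' : approx2 w -> approx2 w' -> approx2 (fun x => w x - w' x).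
Proof.
move=> [Lw cw] [Lw' cw']; split; first exact: L2B.
apply: (@squeeze_cvgr _ _ _ _ (cst 0)
  (fun n => 2 * norm2 mu (fun x => conv w (rho n) x - w x) +
            2 * norm2 mu (fun x => conv w' (rho n) x - w' x))).
- apply: nearW => n; rewrite norm2_ge0/=.
  have La := L2B (conv_rho_L2 n Lw) Lw; have Lb := L2B (conv_rho_L2 n Lw') Lw'.
  have := norm2D La (L2Z (-1) Lb).
  rewrite (_ : norm2 mu (fun x => -1 * _) = norm2 mu (fun x => conv w' (rho n) x - w' x)); last first.
    by apply: eq_Rintegral => x _; ring.
  apply: le_trans; rewrite le_eqVlt; apply/orP; left; apply/eqP.
  apply: eq_Rintegral => x _; have [C _ _ _] := rhoP n.
  by rewrite (convB C); [ring|exact: L2loc1|exact: L2loc1].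
- exact: cvg_cst.
- rewrite -[X in _ --> X](_ : 2 * 0 + 2 * 0 = 0); last by ring.
  by apply: cvgD; apply: cvgMr.
Qed.

Lemma approx2_dominated (w_ : nat -> rV -> R) w W :
  (forall m, approx2 (w_ m)) -> measurable_fun setT w ->
  (forall x, w_ ^~ x @ \oo --> w x) ->
  L2 mu W -> (forall m x, `|w_ m x| <= W x) -> approx2 w.
Proof.
move=> aw mw cw LW wW.
have wWx x : `|w x| <= W x.
  have h : (fun m => `|w_ m x|) @ \oo --> `|w x| by apply: cvg_norm; exact: cw.
  rewrite -(cvg_lim _ h)//; apply: limr_le; first exact: cvgP h.
  by apply: nearW => m; exact: wW.
have Lw : L2 mu w by exact: L2_le wWx LW.
split => //.
have d0 : (fun m => norm2 mu (fun x => w_ m x - w x)) @ \oo --> (0 : R).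
  have m1 m : measurable_fun setT (fun x => (w_ m x - w x) ^+ 2).
    by apply: measurable_funX; apply: measurable_funB => //; have [[]] := aw m.
  have m2 : measurable_fun setT (cst 0 : rV -> R) by exact: measurable_cst.
  have m3 : {ae mu, forall x, (fun m => (w_ m x - w x) ^+ 2) @ \oo --> cst 0 x}.
    apply: nearW => x.
    rewrite -[X in _ --> X](_ : (w x - w x) ^+ 2 = 0); last by rewrite subrr expr0n.
    have h : (fun m => w_ m x - w x) @ \oo --> w x - w x.
      by apply: cvgB; [exact: cw|exact: cvg_cst].
    by apply: cvgM; exact: h.
  have m4 m x : `|(w_ m x - w x) ^+ 2| <= 4 * W x ^+ 2.
    rewrite ger0_norm ?sqr_ge0//.
    have := wW m x; have := wWx x; rewrite !ler_norml => /andP[? ?] /andP[? ?]; nra.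
  have [_] := Rdominated_cvg m1 m2 m3 (L1Z 4 LW.2) m4.
  by rewrite Rintegral_cst// mul0r.
apply: (cvg0_eps (c := 1)) => //; first by move=> n; exact: norm2_ge0.
move=> e e0.
have /cvgrPdist_le/(_ (e / 6)) := d0; rewrite divr_gt0// => /(_ isT)[m _ /(_ m (leqnn m))].
rewrite /= sub0r normrN ger0_norm ?norm2_ge0// => hm.
have [Lm cm] := aw m.
exists (fun n => 4 * norm2 mu (fun x => conv (w_ m) (rho n) x - w_ m x)).
  by rewrite -(mulr0 4); apply: cvgMr.
move=> n; have [C _ _ _] := rhoP n.
have L1' := conv_rho_L2 n (L2B Lw Lm).
have L2' := L2B (conv_rho_L2 n Lm) Lm.
have L3' := L2B Lm Lw.
have := norm2D L1' (L2D L2' L3'); have := norm2D L2' L3'.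
have := norm2_conv_rho n (L2B Lw Lm).
have -> : norm2 mu (fun x => w x - w_ m x) = norm2 mu (fun x => w_ m x - w x).
  by apply: eq_Rintegral => x _; ring.
have -> : norm2 mu (fun x => conv (fun x0 => w x0 - w_ m x0) (rho n) x +
    (conv (w_ m) (rho n) x - w_ m x + (w_ m x - w x))) =
    norm2 mu (fun x => conv w (rho n) x - w x).
  by apply: eq_Rintegral => x _; rewrite (convB C); [ring|exact: L2loc1|exact: L2loc1].
lra.
Qed.

Lemma L1_rho n x : L1 mu (fun y => rho n (x - y)).
Proof. by apply: L1_reflection; have [C _ _ _] := rhoP n; exact: Cc_infty_L1. Qed.

Lemma Rintegral_rho n x : \int[mu]_y rho n (x - y) = 1.
Proof.
have [C _ _ I1] := rhoP n; rewrite Rintegral_reflection//; exact: Cc_infty_L1.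
Qed.

Lemma conv_rho_bounded w M n x : loc1 w -> (forall y, `|w y| <= M) ->
  `|conv w (rho n) x| <= M.
Proof.
move=> lw wM; have [C r0 _ _] := rhoP n.
have L := L1_conv_smooth x lw C.
apply: le_trans (le_normr_Rintegral measurableT L) _.
rewrite -[leRHS]mulr1 -(Rintegral_rho n x) -RintegralZl//; last exact: L1_rho.
apply: le_Rintegral => //; [exact: L1_norm|by apply: L1Z; exact: L1_rho|].
by move=> y _; rewrite normrM (ger0_norm (r0 _)) ler_wpM2r.
Qed.

Lemma conv_rho_cvg w x : loc1 w -> {for x, continuous w} ->
  (fun n => conv w (rho n) x) @ \oo --> w x.
Proof.
move=> lw cw; apply/cvgrPdist_le => e e0.
have : \forall y \near x, `|w x - w y| <= e by move/cvgrPdist_le : cw; exact.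
move=> /nbhs_ballP[d /= d0 hd].
have [m _ hm] := near_infty_natSinv_lt (PosNum d0).
exists m => // n /hm /= nd; have [C r0 vn _] := rhoP n.
have L := L1_conv_smooth x lw C; have L' := L1Z (w x) (L1_rho n x).
rewrite -[w x]mulr1 -(Rintegral_rho n x) -RintegralZl//; last exact: L1_rho.
rewrite -(RintegralB measurableT L' L).
apply: le_trans (le_normr_Rintegral measurableT (L1B L' L)) _.
rewrite -[leRHS]mulr1 -(Rintegral_rho n x) -RintegralZl//; last exact: L1_rho.
apply: le_Rintegral => //; [exact: L1_norm (L1B L' L)|by apply: L1Z; exact: L1_rho|].
move=> y _; rewrite -mulrBl normrM (ger0_norm (r0 _)).
have [xy|xy] := leP `|x - y| n.+1%:R^-1; last by rewrite vn// !mulr0.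
by rewrite ler_wpM2r// hd// -ball_normE /=; exact: le_lt_trans xy nd.
Qed.

Lemma loc1_vanish w r M : 0 <= r -> measurable_fun setT w -> vanish r w ->
  (forall x, `|w x| <= M) -> loc1 w.
Proof. by move=> r0 mw vw wM; apply: L2loc1; exact: L2_of_vanish wM r0 vw. Qed.

Lemma approx2_continuous w r : 0 <= r -> continuous w -> vanish r w -> approx2 w.
Proof.
move=> r0 cw vw; have [M wM] := vanish_bounded r0 vw cw.
have mw := continuous_measurable_rV cw.
have Lw := L2_of_vanish mw wM r0 vw; split => //.
have lw := L2loc1 Lw.
have r10 : 0 <= r + 1 by rewrite addr_ge0.
have m1 m : measurable_fun setT (fun x => (conv w (rho m) x - w x) ^+ 2).
  by apply: measurable_funX; apply: measurable_funB => //; have [] := conv_rho_L2 m Lw.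
have m2 : measurable_fun setT (cst 0 : rV -> R) by exact: measurable_cst.
have m3 : {ae mu, forall x, (fun m => (conv w (rho m) x - w x) ^+ 2) @ \oo --> cst 0 x}.
  apply: nearW => x.
  rewrite -[X in _ --> X](_ : (w x - w x) ^+ 2 = 0); last by rewrite subrr expr0n.
  have h : (fun m => conv w (rho m) x - w x) @ \oo --> w x - w x.
    by apply: cvgB; [exact: conv_rho_cvg lw (cw x)|exact: cvg_cst].
  by apply: cvgM; exact: h.
have m4 m x : `|(conv w (rho m) x - w x) ^+ 2| <= 4 * M ^+ 2 * ind (cube (r + 1)) x.
  rewrite ger0_norm ?sqr_ge0// ind_cube; have [xr|xr] := leP `|x| (r + 1).
    rewrite mulr1; have := wM x; have := conv_rho_bounded m x lw wM.
    rewrite !ler_norml => /andP[? ?] /andP[? ?]; nra.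
  have [C _ vm _] := rhoP m.
  have m11 : m.+1%:R^-1 <= 1 :> R by rewrite invf_le1// ler1n.
  rewrite vw; last by move: xr; lra.
  by rewrite (conv_vanish vw vm) ?subrr ?expr0n ?mulr0//; apply: le_lt_trans xr; rewrite lerD2l.
have [_] := Rdominated_cvg m1 m2 m3 (L1Z (4 * M ^+ 2) (L1_ind_cube r10)) m4.
by rewrite Rintegral_cst// mul0r.
Qed.

(** Truncated multiples of a nonnegative number increase to the indicator of
    its positivity. *)
Lemma cvg_min1 (t : R) : 0 <= t ->
  (fun m => Num.min 1 (m%:R * t)) @ \oo --> ((0 < t)%R%:R : R).
Proof.
move=> t0; have [t1|/eqP t1] := ltP 0 t; last first.
  have -> : t = 0 by apply/eqP; rewrite eq_le t0 andbT; move/eqP: t1 => ->.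
  by under eq_fun do rewrite mulr0 min_r//; exact: cvg_cst.
apply: cvg_near_cst; exists (Num.truncn t^-1).+1 => // m /= hm.
rewrite min_l//; rewrite -ler_pdivrMr// mul1r.
by apply: ltW; apply: lt_le_trans (Num.Theory.truncnS_gt _) _; rewrite ler_nat.
Qed.

Lemma open_fun_gt0 (f : rV -> R) : continuous f -> open [set x | 0 < f x].
Proof.
move=> cf; rewrite (_ : [set _ | _] = f @^-1` [set y | 0 < y])//.
by apply: open_comp; [move=> x _; exact: cf|exact: open_gt].
Qed.

Lemma open_normrV_lt (r : R) : open [set x : rV | `|x| < r].
Proof.
rewrite (_ : [set _ | _] = (fun x : rV => `|x|) @^-1` [set y | y < r])//.
by apply: open_comp; [move=> x _; exact: norm_continuous|exact: open_lt].
Qed.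

Definition opos : set (set rV) :=
  [set A | exists2 f : rV -> R, continuous f & A = [set x | 0 < f x]].

Lemma opos_setI : setI_closed opos.
Proof.
move=> _ _ [f cf ->] [g cg ->]; exists (fun x => Num.min (f x) (g x)).
  by move=> x; apply: (@continuous_min _ _ f g x); [exact: cf|exact: cg].
by apply/seteqP; split => x /=; rewrite lt_min => /andP.
Qed.

Lemma measurable_opos A : measurable A -> <<s opos >> A.
Proof.
move=> mA.
have : measurable_fun [set: g_sigma_algebraType opos]
    (id : g_sigma_algebraType opos -> 'rV[R]_N).
  apply/measurable_fun_rVP => i mT.
  apply: (measurability _ (RGenOInfty.measurableE R)) => //.
  move=> _ [_ [a ->] <-]; rewrite setTI; apply: sub_sigma_algebra.
  exists (fun x : rV => x ord0 i - a).
    by move=> x; apply: continuousB; [exact: coordrV_continuous|exact: cst_continuous].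
  by apply/seteqP; split => x /=; rewrite in_itv/= andbT subr_gt0.
by move=> /(_ measurableT _ mA); rewrite setTI.
Qed.

Section indicators.
Variable r : R.
Hypothesis r0 : 0 < r.

Let Q : set rV := [set x | `|x| < r].

Lemma approx2_opos A : opos A -> approx2 (ind (A `&` Q)).
Proof.
move=> [f cf ->].
pose g x := Num.max 0 (Num.min (f x) (r - `|x|)).
have cmin (h h' : rV -> R) : continuous h -> continuous h' ->
    continuous (fun x => Num.min (h x) (h' x)).
  by move=> ch ch' x; apply: (@continuous_min _ _ h h' x); [exact: ch|exact: ch'].
have cg : continuous g.
  move=> x; apply: (@continuous_max _ _ (cst 0) _ x); first exact: cst_continuous.
  apply: cmin => // y; apply: continuousB; first exact: cst_continuous.
  exact: norm_continuous.
have g0 x : 0 <= g x by rewrite /g le_max lexx.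
have vg : vanish r g.
  by move=> x xr; apply/eqP; rewrite /g eq_le le_max lexx andbT ge_max lexx ge_min subr_le0 (ltW xr) orbT.
have gE x : (0 < g x)%R%:R = ind ([set x | 0 < f x] `&` Q) x.
  rewrite indE; congr (nat_of_bool _)%:R; rewrite /g lt_max ltxx/= lt_min subr_gt0.
  by apply/andP/idP; rewrite inE//=.
apply: (@approx2_dominated (fun m x => Num.min 1 (m%:R * g x)) _ (ind (cube r))).
- move=> m; apply: (@approx2_continuous _ r (ltW r0)).
    apply: (cmin (cst 1)); first exact: cst_continuous.
    by move=> x; apply: (@continuousM R _ (cst m%:R) g); [exact: cst_continuous|exact: cg].
  by move=> x /vg ->; rewrite mulr0 min_r.
- apply: measurable_ind; apply: measurableI; apply: open_measurable_rV.
    exact: open_fun_gt0.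
  exact: open_normrV_lt.
- by move=> x; rewrite -gE; exact: cvg_min1.
- exact: L2_ind_cube (ltW r0).
- move=> m x; rewrite ger0_norm ?le_min ?ler01 ?mulr_ge0//.
  rewrite ind_cube; have [xr|/vg ->] := leP `|x| r; first by rewrite ge_min lexx.
  by rewrite mulr0 min_r.
Qed.

Lemma approx2_ind A : measurable A -> approx2 (ind (A `&` Q)).
Proof.
move=> /measurable_opos.
have : <<s opos >> `<=` [set A | measurable A /\ approx2 (ind (A `&` Q))].
  apply: lambda_system_subset => //; first exact: opos_setI.
    split => //=.
    - split; first exact: measurableT.
      apply: approx2_opos; exists (cst 1); first exact: cst_continuous.
      by apply/seteqP; split => x //= _; exact: ltr01.
    - move=> A0 B BA [mA aA] [mB aB]; split; first exact: measurableD.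
      rewrite (_ : ind _ = fun x => ind (A0 `&` Q) x - ind (B `&` Q) x).
        exact: approx2B.
      apply/funext => x; rewrite !indE.
      have -> : (x \in (A0 `\` B) `&` Q) = [&& x \in A0, x \notin B & x \in Q].
        by rewrite in_setI in_setD andbA.
      rewrite (in_setI x A0 Q) (in_setI x B Q).
      have BAx : (x \in B) ==> (x \in A0) by apply/implyP; rewrite !inE; exact: BA.
      case: (x \in A0) BAx; case: (x \in B) => //= _; rewrite ?subr0 ?subrr//.
    - move=> F ndF HF; split; first by apply: bigcupT_measurable => n; exact: (HF n).1.
      apply: (@approx2_dominated (fun m => ind (F m `&` Q)) _ (ind (cube r))).
      + by move=> m; exact: (HF m).2.
      + apply: measurable_ind; apply: measurableI.
          by apply: bigcupT_measurable => n; exact: (HF n).1.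
        by apply: open_measurable_rV; exact: open_normrV_lt.
      + move=> x; apply: cvg_near_cst.
        have [[m _ Fmx]|nF] := pselect ((\bigcup_n F n) x).
          exists m => // n /= mn; rewrite !indE !in_setI.
          have h : F n x by have /subsetPset := ndF _ _ mn; exact.
          by rewrite (mem_set h) (mem_set (A := \bigcup_n F n))//; exists m.
        apply: nearW => n; rewrite !indE !in_setI.
        have h : ~ F n x by move=> Fnx; apply: nF; exists n.
        by rewrite (memNset h) (memNset nF).
      + exact: L2_ind_cube (ltW r0).
      + move=> m x; rewrite ger0_norm ?ind_ge0// ind_cube indE in_setI.
        have [xr|xr] := leP `|x| r; first by case: (_ && _).
        by rewrite [x \in Q]memNset ?andbF// /Q/=; apply/negP; rewrite -leNgt ltW.
  move=> A0 oA; split; last exact: approx2_opos.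
  by have [f cf ->] := oA; apply: open_measurable_rV; exact: open_fun_gt0.
by move=> h /h [].
Qed.


Lemma approx2D w w' : approx2 w -> approx2 w' -> approx2 (fun x => w x + w' x).
Proof.
move=> aw aw'; have := approx2B aw (approx2Z (-1) aw').
by congr approx2; apply/funext => x; ring.
Qed.

Lemma approx2_cst0 : approx2 (fun _ => 0).
Proof.
by apply: (@approx2_continuous _ 0) => //; exact: cst_continuous.
Qed.

Lemma approx2_sum (I : Type) (s : seq I) (w_ : I -> rV -> R) :
  (forall e, approx2 (w_ e)) -> approx2 (fun x => \sum_(e <- s) w_ e x).
Proof.
move=> aw; elim: s => [|e s IH].
  by under eq_fun do rewrite big_nil; exact: approx2_cst0.
by under eq_fun do rewrite big_cons; exact: approx2D.
Qed.

Import HBNNSimple.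

Lemma approx2_nnsfun (g : {nnsfun rV >-> R}) :
  approx2 (fun x => g x * ind Q x).
Proof.
rewrite (_ : (fun x => _) = fun x => \sum_(y <- finmap.enum_fset (fset_set (range g)))
    (y * ind (g @^-1` [set y] `&` Q) x)).
  apply: approx2_sum => y; apply: approx2Z; apply: approx2_ind.
  exact: measurable_sfunP.
apply/funext => x; rewrite fimfunE fsbig_finite//= mulr_suml.
apply: eq_bigr => y _; rewrite -mulrA; congr (_ * _).
by rewrite /ind indicI.
Qed.

Lemma approx2_ge0 w : L2 mu w -> (forall x, 0 <= w x) ->
  (forall x, r <= `|x| -> w x = 0) -> approx2 w.
Proof.
move=> Lw w0 wr.
have mw : measurable_fun setT (EFin \o w) by apply/measurable_EFinP; exact: Lw.1.
pose g := nnsfun_approx measurableT mw.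
have gc x : (fun m => g m x) @ \oo --> w x.
  have wE (t : rV) : setT t -> (0 <= (EFin \o w) t)%E by move=> _; rewrite lee_fin.
  by have /fine_cvgP[] := cvg_nnsfun_approx measurableT mw wE (I : setT x).
have gle m x : g m x <= w x.
  have h := cvgP _ (gc x); rewrite -(cvg_lim _ (gc x))//.
  apply: (@nondecreasing_cvgn_le _ (fun m => g m x)) => // a b ab.
  exact/lefP/nd_nnsfun_approx.
apply: (@approx2_dominated (fun m x => g m x * ind Q x) _ w) => //.
- by move=> m; exact: approx2_nnsfun.
- exact: Lw.1.
- move=> x; have -> : w x = w x * ind Q x.
    rewrite indE; have [xr|xr] := ltP `|x| r; first by rewrite mem_set// mulr1.
    by rewrite wr// mul0r.
  by apply: cvgM => //; exact: cvg_cst.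
- move=> m x; rewrite ger0_norm ?mulr_ge0 ?ind_ge0//.
  by apply: le_trans (gle m x); rewrite ler_piMr ?ind_le1.
Qed.

Lemma approx2_L2 w : L2 mu w -> (forall x, r <= `|x| -> w x = 0) -> approx2 w.
Proof.
move=> Lw wr.
have -> : w = fun x => Num.max (w x) 0 - Num.max (- w x) 0.
  apply/funext => x; have [h|h] := leP 0 (w x).
    by rewrite max_r ?oppr_le0// subr0.
  by rewrite max_l ?oppr_ge0 ?ltW// sub0r opprK.
have mw := Lw.1.
have LN : L2 mu (fun x => - w x).
  by have := L2Z (-1) Lw; congr L2; apply/funext => x; rewrite mulN1r.
have Lmax v : L2 mu v -> L2 mu (fun x => Num.max (v x) 0).
  move=> Lv; have Lvn : L2 mu (fun x => `|v x|).
    split; first by apply: measurableT_comp => //; exact: Lv.1.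
    by apply: L1_eq Lv.2 => x; rewrite real_normK ?num_real.
  apply: L2_le Lvn; first exact: (measurable_maxr Lv.1 (measurable_cst _)).
  by move=> x; rewrite ger0_norm ?le_max ?lexx ?orbT// ge_max ler_norm normr_ge0.
apply: approx2B; apply: approx2_ge0; try exact: Lmax.
- by move=> x; rewrite le_max lexx orbT.
- by move=> x /wr ->; rewrite max_l.
- by move=> x; rewrite le_max lexx orbT.
- by move=> x /wr ->; rewrite oppr0 max_l.
Qed.

End indicators.

(** On a cube the mollification only sees the values on a slightly larger cube. *)
Lemma mollification_cvg v r : loc2 v -> 0 <= r ->
  (fun n => norm2 mu (fun x => ind (cube r) x * (conv v (rho n) x - v x))) @ \oo --> (0 : R).
Proof.
move=> lv r0; have r1 : 0 <= r + 1 by rewrite addr_ge0.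
pose w x := ind (cube (r + 1)) x * v x.
have Lw : L2 mu w by exact: (lv.2 _ r1).
have r2 : 0 < r + 2 by rewrite ltr_wpDl.
have wr x : r + 2 <= `|x| -> w x = 0.
  move=> xr; rewrite /w ind_cube leNgt (_ : r + 1 < `|x|) ?mul0r//.
  by apply: lt_le_trans xr; rewrite ltrD2l ltr1n.
have [_ aw] := approx2_L2 r2 Lw wr.
apply: (@squeeze_cvgr _ _ _ _ (cst 0) _ _ _ _ _ aw); last exact: cvg_cst.
apply: nearW => n; rewrite norm2_ge0/=.
have [C r0' vn _] := rhoP n.
have mi := measurable_ind (measurable_cube (N := N) r0).
have Ld := L2B (conv_rho_L2 n Lw) Lw.
have E x : ind (cube r) x * (conv v (rho n) x - v x) = ind (cube r) x * (conv w (rho n) x - w x).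
  rewrite ind_cube; have [xr|xr] := leP `|x| r; last by rewrite !mul0r.
  congr (_ * (_ - _)).
    apply: eq_Rintegral => y _; have [xy|xy] := leP `|x - y| n.+1%:R^-1; last first.
      by rewrite vn// !mulr0.
    congr (_ * _); rewrite /w ind_cube (_ : `|y| <= r + 1) ?mul1r//.
    have := ler_normD (y - x) x; rewrite subrK => /le_trans; apply.
    by rewrite addrC lerD// distrC (le_trans xy)// invf_le1 ?ltr0n// ler1n.
  by rewrite /w ind_cube (_ : `|x| <= r + 1) ?mul1r// (le_trans xr)// lerDl.
rewrite /norm2; under eq_Rintegral do rewrite E exprMn ind_sqr.
apply: le_Rintegral => //.
- apply: L1_eq (L2Mb mi (ind_norm _) Ld).2 => x /=.
  by rewrite exprMn ind_sqr.
- exact: Ld.2.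
- by move=> x _; rewrite ler_piMl ?sqr_ge0 ?ind_le1.
Qed.

End mollifier.

(** * Nonlinear test functions *)

Section reflection_smooth.
Context {R : realType} {N : nat}.
Local Notation rV := 'rV[R]_N.
Local Notation mu := (lebesgue_rV R N).
Implicit Types (f g v w k phi : rV -> R) (r M : R) (i j : 'I_N).

Lemma partial_reflection k (x y : rV) i : differentiable k (x - y) ->
  differentiable (fun y => k (x - y)) y /\
  partial i (fun y => k (x - y)) y = - partial i k (x - y).
Proof.
move=> dk.
have dr : differentiable (fun y : rV => x - y) y.
  by apply: differentiableB => //; exact: differentiable_cst.
have d : differentiable (fun y => k (x - y)) y by exact: (differentiable_comp dr dk).
split => //; rewrite /partial.
have E h : h^-1 *: (k (x - (h *: delta_mx ord0 i + y)) - k (x - y)) =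
    h^-1 *: (k (h *: (- delta_mx ord0 i) + (x - y)) - k (x - y)).
  by congr (_ *: (k _ - _)); rewrite scalerN opprD addrCA.
rewrite {1}/derive; under eq_fun do rewrite E.
rewrite -/(derive k (x - y) (- delta_mx ord0 i)) !deriveE//.
by rewrite linearN.
Qed.

Lemma reflection_class_C m k (x : rV) : class_C m setT k ->
  class_C m setT (fun y => k (x - y)).
Proof.
elim: m k => [|m IH] k.
  move=> ck y _.
  have cr : {for y, continuous (fun y : rV => x - y)}.
    by apply: differentiable_continuous; apply: differentiableB => //;
      exact: differentiable_cst.
  exact: (continuous_comp cr (ck _ I)).
move=> [dk ck]; split => [y _|i].
  have dky := dk (x - y) I.
  have dr : differentiable (fun y : rV => x - y) y.
    by apply: differentiableB => //; exact: differentiable_cst.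
  exact: (differentiable_comp dr dky).
rewrite (_ : partial i _ = fun y => -1 * partial i k (x - y)).
  by apply: class_C_scale; exact: IH (ck i).
by apply/funext => y; rewrite mulN1r; have [_ ->] := partial_reflection i (dk (x - y) I).
Qed.

Lemma reflection_Cc_infty k (x : rV) : Cc_infty k -> Cc_infty (fun y => k (x - y)).
Proof.
move=> Ck; have [r r0 vk] := compact_vanish (Ck 0%N).2.
apply: (Cc_inftyP (r := `|x| + r)).
- by rewrite addr_ge0// ltW.
- exact: vanish_reflection.
- by move=> m; apply: reflection_class_C; exact: (Ck m).1.
Qed.

Lemma convC v k (x : rV) : L1 mu (fun y => v y * k (x - y)) ->
  conv v k x = \int[mu]_z (v (x - z) * k z).
Proof.
move=> L; rewrite /conv -(Rintegral_reflection x L).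
by apply: eq_Rintegral => z _; rewrite subKr.
Qed.

(** C^1 compactly supported functions, with the bounds used below. *)
Lemma Cc1_bounds phi : Cc 1 phi -> exists r M, [/\ 0 < r, vanish r phi, 0 <= M,
  forall x, `|phi x| <= M & forall i x, `|partial i phi x| <= M].
Proof.
move=> [/class_C1P[dphi cphi] sphi]; have [r r0 vphi] := compact_vanish sphi.
have cp : continuous phi by move=> x; exact: differentiable_continuous.
have [M1 h1] := vanish_bounded (ltW r0) vphi cp.
have [M2 h2] : exists M, forall i x, `|partial i phi x| <= M.
  by apply: finite_bound => i; apply: vanish_bounded (ltW r0) (vanish_partial _ vphi) _.
exists r, (Num.max M1 M2); split => //.
- by rewrite le_max (le_trans (normr_ge0 _) (h1 0)).
- by move=> x; rewrite le_max h1.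
- by move=> i x; rewrite le_max h2 orbT.
Qed.

Lemma Cc1_loc1 phi : Cc 1 phi -> loc1 phi.
Proof.
move=> Cphi; have [r [M [r0 vp M0 pM _]]] := Cc1_bounds Cphi.
apply: (loc1_vanish (ltW r0) _ vp pM).
by apply: continuous_measurable_rV; exact: class_C_continuous Cphi.1.
Qed.

Lemma Cc1_partial_loc1 phi i : Cc 1 phi -> loc1 (partial i phi).
Proof.
move=> Cphi; have [r [M [r0 vp M0 _ pM]]] := Cc1_bounds Cphi.
apply: (loc1_vanish (ltW r0) _ (vanish_partial _ vp) (pM i)).
by apply: continuous_measurable_rV; have /class_C1P[_] := Cphi.1; exact.
Qed.

(** Integration by parts against a smooth kernel, by differentiating the
    convolution under the integral sign in its other argument. *)
Lemma conv_partial phi k (x : rV) i : Cc 1 phi -> Cc_infty k ->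
  conv phi (partial i k) x = conv (partial i phi) k x.
Proof.
move=> Cphi Ck; have [r [M [r0 vp M0 pM dpM]]] := Cc1_bounds Cphi.
have /class_C1P[dphi cphi] := Cphi.1.
have lphi := Cc1_loc1 Cphi; have ldphi := Cc1_partial_loc1 i Cphi.
have [dc <-] := conv_differentiable x lphi Ck.
rewrite (convC (L1_conv_smooth x ldphi Ck)).
pose e : rV := delta_mx ord0 i.
have der (f : rV -> R) (y : rV) : differentiable f y ->
    (fun n : nat => n.+1%:R * (f (n.+1%:R^-1 *: e + y) - f y)) @ \oo --> partial i f y.
  move=> df; have h := diff_derivable (v := e) df.
  have h' : (fun t : R => t^-1 *: (f (t *: e + y) - f y)) @ 0^'+ --> partial i f y.
    exact: (cvg_dnbhs_at_right h).
  have pos (n : nat) : 0 < n.+1%:R^-1 :> R by rewrite invr_gt0.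
  have := (cvg_at_rightP _ _ _).1 h' (fun n => n.+1%:R^-1) (conj pos (@cvg_harmonic R)).
  by under eq_fun do rewrite invrK.
have c1 := der _ _ dc.
have tr z (n : nat) : n.+1%:R^-1 *: e + x - z = n.+1%:R^-1 *: e + (x - z) by rewrite addrA.
have I0 y : L1 mu (fun z => phi (y - z) * k z).
  have := L1_reflection y (L1_conv_smooth y lphi Ck).
  by apply: L1_eq => z; rewrite subKr.
pose q n z := n.+1%:R * (phi (n.+1%:R^-1 *: e + (x - z)) - phi (x - z)).
have qM n z : `|q n z| <= N%:R * M.
  rewrite /q normrM ger0_norm//.
  apply: le_trans (ler_wpM2l (ler0n _ _) (lipschitz_of_partial (M := M) _ _ dphi dpM)) _.
  have e1 : `|e| <= 1.
    apply/(normrV_le _ ler01) => j.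
    by rewrite mxE eqxx/=; case: (j == i); rewrite ?normr1 ?normr0.
  rewrite normrZ ger0_norm ?invr_ge0//.
  have -> : n.+1%:R * (N%:R * M * (n.+1%:R^-1 * `|e|)) = N%:R * M * `|e|.
    by field; rewrite ?nat1r ?natr1 pnatr_eq0.
  by rewrite ler_piMr ?mulr_ge0.
have qI n : n.+1%:R * (conv phi k (n.+1%:R^-1 *: e + x) - conv phi k x) =
    \int[mu]_z (q n z * k z).
  rewrite (convC (L1_conv_smooth _ lphi Ck)) (convC (L1_conv_smooth _ lphi Ck)).
  rewrite -(RintegralB measurableT (I0 _) (I0 _)) -RintegralZl//; last exact: L1B.
  by apply: eq_Rintegral => z _; rewrite /q tr; ring.
have c2 : (fun n => \int[mu]_z (q n z * k z)) @ \oo --> \int[mu]_z (partial i phi (x - z) * k z).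
  have mphi : measurable_fun setT phi := lphi.1.
  have mk := Cc_infty_measurable Ck.
  have mq n : measurable_fun setT (fun z => q n z * k z).
    apply: measurable_funM => //; apply: measurable_funM; first exact: measurable_cst.
    apply: measurable_funB; last exact: measurable_reflection.
    have := measurable_reflection (n.+1%:R^-1 *: e + x) mphi.
    by congr measurable_fun; apply/funext => z; rewrite tr.
  have mp : measurable_fun setT (fun z : rV => partial i phi (x - z) * k z).
    by apply: measurable_funM => //; apply: measurable_reflection; exact: ldphi.1.
  have cq : {ae mu, forall z, (fun n => q n z * k z) @ \oo --> partial i phi (x - z) * k z}.
    by apply: nearW => z; apply: cvgM; [exact: der|exact: cvg_cst].
  have bq n z : `|q n z * k z| <= N%:R * M * `|k z| by rewrite normrM ler_wpM2r.
  by have [] := Rdominated_cvg mq mp cq (L1Z (N%:R * M) (L1_norm (Cc_infty_L1 Ck))) bq.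
move: c1; under eq_fun do rewrite qI; move=> c1.
exact: (cvg_unique _ c1 c2).
Qed.

End reflection_smooth.

Lemma cvg_sumr (R : realType) (I : Type) (s : seq I) (u_ : I -> nat -> R) (l : I -> R) :
  (forall i, u_ i @ \oo --> l i) ->
  (fun n => \sum_(i <- s) u_ i n) @ \oo --> \sum_(i <- s) l i.
Proof.
move=> H; elim: s => [|i s IH].
  by under eq_fun do rewrite big_nil; rewrite big_nil; exact: cvg_cst.
by under eq_fun do rewrite big_cons; rewrite big_cons; exact: cvgD.
Qed.

Section test_functions.
Context {R : realType} {N : nat}.
Local Notation rV := 'rV[R]_N.
Local Notation mu := (lebesgue_rV R N).
Implicit Types (f g v w k phi psi : rV -> R) (r M : R) (i j : 'I_N).

Lemma bounded_loc1M v f M r : loc1 v -> measurable_fun setT f ->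
  (forall x, `|f x| <= M) -> 0 <= r -> vanish r f ->
  L1 mu (fun x => v x * f x) /\ (forall x, `|v x * f x| <= M * `|ind (cube r) x * v x|).
Proof.
move=> lv mf fM r0 vf; split; first exact: (loc1M lv mf fM r0 vf).
move=> x; rewrite (vanish_ind x vf) mulrCA normrM [v x * _]mulrC.
by rewrite ler_wpM2r.
Qed.

Lemma moll_Cc_infty phi n : Cc 1 phi -> Cc_infty (conv phi (rho n)).
Proof.
move=> Cphi; have [C _ vn _] := @rhoP R N n.
have [r [M [r0 vp _ _ _]]] := Cc1_bounds Cphi.
apply: (@Cc_inftyP _ _ _ (r + n.+1%:R^-1)).
- by rewrite addr_ge0 ?(ltW r0)// invr_ge0.
- exact: (conv_vanish vp vn).
- exact: (conv_class_C (Cc1_loc1 Cphi) C).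
Qed.

Lemma rho_radius n : n.+1%:R^-1 <= 1 :> R.
Proof. by rewrite invf_le1 ?ltr0n// ler1n. Qed.

Lemma vanishW r r' f : r <= r' -> vanish r f -> vanish r' f.
Proof. by move=> rr' vf x xr; apply: vf; exact: le_lt_trans xr. Qed.

(** An identity against smooth test functions extends to C^1 ones. *)
Lemma weak_identity_C1 (a : 'I_N -> rV -> R) (b : rV -> R) :
  (forall i, loc1 (a i)) -> loc1 b ->
  (forall phi, Cc_infty phi ->
    \int[mu]_x (\sum_i a i x * partial i phi x) = \int[mu]_x (b x * phi x)) ->
  forall phi, Cc 1 phi ->
    \int[mu]_x (\sum_i a i x * partial i phi x) = \int[mu]_x (b x * phi x).
Proof.
move=> la lb H phi Cphi.
have [r [M [r0 vp M0 pM dpM]]] := Cc1_bounds Cphi.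
have lphi := Cc1_loc1 Cphi; have ldphi i := Cc1_partial_loc1 i Cphi.
have /class_C1P[dphi cphi] := Cphi.1.
have cp : continuous phi by move=> x; exact: differentiable_continuous.
have r1 : 0 <= r + 1 by rewrite addr_ge0// ltW.
pose ph n := conv phi (rho n).
have Cn n : Cc_infty (ph n) by exact: moll_Cc_infty.
have dn n i x : partial i (ph n) x = conv (partial i phi) (rho n) x.
  have [C _ _ _] := @rhoP R N n; rewrite -conv_partial//.
  by have [_ ->] := conv_differentiable x lphi C.
have limit (c w : rV -> R) (w_ : nat -> rV -> R) : loc1 c -> measurable_fun setT w ->
    (forall n, measurable_fun setT (w_ n)) -> (forall n x, `|w_ n x| <= M) ->
    (forall n, vanish (r + 1) (w_ n)) -> (forall x, w_ ^~ x @ \oo --> w x) ->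
    (fun n => \int[mu]_x (c x * w_ n x)) @ \oo --> \int[mu]_x (c x * w x).
  move=> lc mw mw_ wM vw cw.
  have bd n := bounded_loc1M lc (mw_ n) (wM n) r1 (vw n).
  have m1 n : measurable_fun setT (fun x => c x * w_ n x).
    exact: L1_measurable (bd n).1.
  have m2 : measurable_fun setT (fun x => c x * w x).
    by apply: measurable_funM => //; exact: lc.1.
  have m3 : {ae mu, forall x, (fun n => c x * w_ n x) @ \oo --> c x * w x}.
    by apply: nearW => x; apply: cvgM; [exact: cvg_cst|exact: cw].
  have m4 n x := (bd n).2 x.
  by have [] := Rdominated_cvg m1 m2 m3 (L1Z M (L1_norm (lc.2 _ r1))) m4.
have vnish n v : vanish r v -> vanish (r + 1) (conv v (rho n)).
  move=> vv; have [_ _ vn _] := @rhoP R N n; apply: vanishW (conv_vanish vv vn).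
  by rewrite lerD2l; exact: rho_radius.
have mconv n v : loc1 v -> measurable_fun setT (conv v (rho n)).
  move=> lv; have [C _ _ _] := @rhoP R N n.
  exact: continuous_measurable_rV (class_C_continuous (conv_class_C lv C 0)).
have cb : (fun n => \int[mu]_x (b x * ph n x)) @ \oo --> \int[mu]_x (b x * phi x).
  apply: limit => //.
  - exact: lphi.1.
  - by move=> n; exact: mconv.
  - by move=> n x; exact: conv_rho_bounded.
  - by move=> n; exact: vnish.
  - by move=> x; exact: conv_rho_cvg lphi (cp x).
have ca i : (fun n => \int[mu]_x (a i x * partial i (ph n) x)) @ \oo -->
    \int[mu]_x (a i x * partial i phi x).
  apply: limit => //.
  - exact: (ldphi i).1.
  - by move=> n; rewrite (funext (dn n i)); apply: mconv; exact: ldphi.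
  - by move=> n x; rewrite dn; exact: conv_rho_bounded.
  - by move=> n; rewrite (funext (dn n i)); apply: vnish; exact: vanish_partial.
  - move=> x; under eq_fun do rewrite dn.
    exact: conv_rho_cvg (ldphi i) (cphi i x).
have La n i : L1 mu (fun x => a i x * partial i (ph n) x).
  have [r' [M' [r'0 vp' p'M dp'M _]]] := Cc_infty_bounds (Cn n).
  apply: (loc1M (la i) _ (dp'M i) (ltW r'0) (vanish_partial _ vp')).
  exact: Cc_infty_measurable (Cc_inftyS i (Cn n)).
have La' i : L1 mu (fun x => a i x * partial i phi x).
  exact: (loc1M (la i) (ldphi i).1 (dpM i) (ltW r0) (vanish_partial _ vp)).
have cs : (fun n => \sum_i \int[mu]_x (a i x * partial i (ph n) x)) @ \oo -->
    \sum_i \int[mu]_x (a i x * partial i phi x).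
  exact: cvg_sumr.
have E : (fun n => \sum_i \int[mu]_x (a i x * partial i (ph n) x)) =
    (fun n => \int[mu]_x (b x * ph n x)).
  by apply/funext => n; rewrite -H// Rintegral_sum.
rewrite Rintegral_sum//; rewrite E in cs.
exact: (cvg_unique _ cs cb).
Qed.

(** Mollification commutes with weak differentiation: the kernel itself is the
    test function. *)
Lemma weak_grad_conv u (du : rV -> rV) n (x : rV) i :
  loc1 u -> (forall i, loc1 (fun x => du x ord0 i)) -> weak_grad u du ->
  partial i (conv u (rho n)) x = conv (fun x => du x ord0 i) (rho n) x.
Proof.
move=> lu ldu wg; have [C _ vn _] := @rhoP R N n.
have [_ ->] := conv_differentiable x lu C.
have := wg _ (reflection_Cc_infty x C) i.
have dr y : partial i (fun y => rho n (x - y)) y = - partial i (rho n) (x - y).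
  by have [_ ->] := partial_reflection i ((C 1%N).1.1 (x - y) I).
under eq_integral do rewrite dr mulrN.
have L1' := L1_conv_smooth x lu (Cc_inftyS i C).
have L2' := L1_conv_smooth x (ldu i) C.
rewrite -(EFin_Rintegral (L1N L1')) -(EFin_Rintegral L2') RintegralN// -EFinN.
by move=> [/oppr_inj].
Qed.

End test_functions.

Section nonlinear.
Context {R : realType} {N : nat}.
Local Notation rV := 'rV[R]_N.
Local Notation mu := (lebesgue_rV R N).

Lemma measurable_comp_gt0 (G : R -> R) (u : rV -> R) :
  (forall t : R, 0 < t -> {for t, continuous G}) -> measurable_fun setT u ->
  (forall x, 0 < u x) -> measurable_fun setT (fun x => G (u x)).
Proof.
move=> cG mu_ u0.
apply: (@measurable_comp _ _ _ _ _ _ [set t : R | 0 < t] G setT u) => //.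
- by apply: open_measurable; exact: open_gt.
- by move=> _ [x _ <-]; exact: u0.
- apply: subspace_continuous_measurable_fun.
    by apply: open_measurable; exact: open_gt.
  by apply: continuous_in_subspaceT => t; rewrite inE; exact: cG.
Qed.

Lemma continuous_bounded_cube (f : rV -> R) (r : R) : 0 <= r -> continuous f ->
  exists b, forall x, `|x| <= r -> `|f x| <= b.
Proof.
move=> r0 cf.
have ne : (cube r : set rV) !=set0 by exists 0; rewrite /cube/= normr0.
have cn : {within (cube r : set rV), continuous (fun x : rV => `|f x|)}.
  apply: continuous_subspaceT => x.
  by apply: (@continuous_comp _ _ _ f Num.norm); [exact: cf|exact: norm_continuous].
have [c _ H] := compact_EVT_max ne (compact_cube r0) cn.
by exists `|f c| => x xr; apply: H; rewrite inE.
Qed.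

Lemma continuous_mul (f g : rV -> R) : continuous f -> continuous g ->
  continuous (fun x => f x * g x).
Proof. by move=> cf cg x; apply: (@continuousM R _ f g); [exact: cf|exact: cg]. Qed.

Lemma continuous_add (f g : rV -> R) : continuous f -> continuous g ->
  continuous (fun x => f x + g x).
Proof. by move=> cf cg x; apply: (@continuousD R _ _ f g); [exact: cf|exact: cg]. Qed.

Lemma partialDc (f : rV -> R) (c : R) x i : differentiable f x ->
  partial i (fun x => f x + c) x = partial i f x.
Proof.
move=> df; rewrite /partial deriveD//; last exact: diff_derivable.
by rewrite derive_cst addr0.
Qed.

Variables (u : rV -> R) (du : rV -> rV).
Hypotheses (lu : loc2 u) (ldu : forall i, loc2 (fun x => du x ord0 i))
  (wu : weak_grad u du) (u0 : forall x, 0 < u x).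
Variables (G dG : R -> R) (M : R).
Hypotheses (GP : forall t : R, 0 < t -> is_derive t (1 : R) G (dG t))
  (cdG : forall t : R, 0 < t -> {for t, continuous dG})
  (GM : forall t : R, 0 < t -> `|G t| <= M) (dGM : forall t : R, 0 < t -> `|dG t| <= M).

Variable psi : rV -> R.
Hypothesis Cpsi : Cc 1 psi.

(** The gradient of G(u) psi. *)
Definition test_grad i (x : rV) : R :=
  dG (u x) * psi x * du x ord0 i + G (u x) * partial i psi x.

Let cG (t : R) : 0 < t -> {for t, continuous G}.
Proof. by move=> /GP /dfun_continuous. Qed.

Let M0 : 0 <= M.
Proof. by apply: le_trans (GM (@ltr01 R)). Qed.

Let Mpsi : exists r m : R, [/\ 0 < r, vanish r psi, 0 <= m,
  forall x, `|psi x| <= m & forall i x, `|partial i psi x| <= m].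
Proof. exact: Cc1_bounds. Qed.

Let mpsi : measurable_fun setT psi := (Cc1_loc1 Cpsi).1.
Let mdpsi i : measurable_fun setT (partial i psi) := (Cc1_partial_loc1 i Cpsi).1.

Let mGu : measurable_fun setT (fun x => G (u x)).
Proof. by apply: measurable_comp_gt0 => //; exact: lu.1. Qed.

Let mdGu : measurable_fun setT (fun x => dG (u x)).
Proof. by apply: measurable_comp_gt0 => //; exact: lu.1. Qed.

Lemma test_grad_L2 i : L2 mu (test_grad i).
Proof.
have [r [m [r0 vp m0 pm dpm]]] := Mpsi.
apply: L2D.
  have := @L2Mb _ _ _ mu (M * m) (fun x => dG (u x) * psi x)
    (fun x => ind (cube r) x * du x ord0 i).
  move=> /(_ _ _ ((ldu i).2 r (ltW r0))) H.
  have {}H := H (measurable_funM mdGu mpsi) _.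
  have : forall x, `|dG (u x) * psi x| <= M * m.
    by move=> x; rewrite normrM ler_pM// dGM.
  move=> /H; congr L2; apply/funext => x.
  by rewrite [in RHS](vanish_ind x vp); ring.
apply: (L2_of_vanish (M := M * m) (r := r)); first exact: measurable_funM.
- by move=> x; rewrite normrM ler_pM// GM.
- exact: ltW.
- by move=> x /(vanish_partial i vp) ->; rewrite mulr0.
Qed.

(** Mollified functions, shifted to stay positive; along a subsequence they
    converge almost everywhere on a given cube. *)
Lemma approx_seq r : 0 <= r -> exists v : nat -> rV -> R,
  [/\ forall n x, differentiable (v n) x /\ 0 < v n x,
      forall n i, continuous (partial i (v n)),
      {ae mu, forall x, `|x| <= r -> (fun n => v n x) @ \oo --> u x} &
      forall i, (fun n => norm2 mu (fun x => ind (cube r) x *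
        (partial i (v n) x - du x ord0 i))) @ \oo --> (0 : R)].
Proof.
move=> r0; have lu1 := loc2_loc1 lu.
have ldu1 i := loc2_loc1 (ldu i).
pose J n := conv u (@rho R N n).
have CJ n : forall m, class_C m setT (J n).
  by have [C _ _ _] := @rhoP R N n; exact: conv_class_C lu1 C.
have mi := measurable_ind (measurable_cube (N := N) r0).
have LJ n : L2 mu (fun x => ind (cube r) x * (J n x - u x)).
  have mJ := continuous_measurable_rV (class_C_continuous (CJ n 0%N)).
  have [b Jb] := continuous_bounded_cube r0 (class_C_continuous (CJ n 0%N)).
  have b0 : 0 <= b by apply: le_trans (Jb 0 _); rewrite ?normr0.
  have LJn : L2 mu (fun x => ind (cube r) x * J n x).
    apply: (@L2_of_vanish _ _ _ b r) => //; first exact: measurable_funM.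
      move=> x; rewrite ind_cube; have [/Jb|_] := leP `|x| r; first by rewrite mul1r.
      by rewrite mul0r normr0.
    by move=> x xr; rewrite ind_cube leNgt xr mul0r.
  have := L2B LJn (lu.2 r r0); congr L2; apply/funext => x; ring.
have cJ := mollification_cvg lu r0.
have [s [ks sae]] := mean_cvg_subseq_ae (fun n => (LJ n).2) (fun n x => sqr_ge0 _) cJ.
have soo : s @ \oo --> \oo.
  apply/cvgnyPge => A; exists A => // n /= An; exact: leq_trans An (ks n).
have dJ n x : differentiable (J n) x by exact: (CJ n 1%N).1.
have dJE n x i : partial i (J n) x = conv (fun x => du x ord0 i) (@rho R N n) x.
  exact: weak_grad_conv.
exists (fun n x => J (s n) x + n.+1%:R^-1); split.
- move=> n x; split.
    by apply: differentiableD => //; exact: differentiable_cst.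
  rewrite ltr_wpDl ?invr_gt0// /J /conv.
  have [_ k0 _ _] := @rhoP R N (s n).
  by apply: Rintegral_ge0 => y _; rewrite mulr_ge0// ltW.
- move=> n i.
  rewrite (_ : partial i _ = partial i (J (s n))).
    by have /class_C1P[_] := CJ (s n) 1%N; exact.
  by apply/funext => x; rewrite partialDc.
- apply: filterS sae => x h xr.
  have h1 : (fun n => J (s n) x - u x) @ \oo --> (0 : R).
    apply/norm_cvg0P; apply/cvgrPdist_lt => e e0.
    have /cvgrPdist_lt/(_ (e ^+ 2)) := h; rewrite exprn_gt0// => /(_ isT).
    apply: filterS => n; rewrite !sub0r !normrN normr_id ind_cube xr mul1r normrX.
    by rewrite ltr_pXn2r// nnegrE// ltW.
  have : (fun n => (J (s n) x - u x) + n.+1%:R^-1 + u x) @ \oo --> 0 + 0 + u x.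
    by apply: cvgD; [apply: cvgD => //; exact: cvg_harmonic|exact: cvg_cst].
  rewrite addr0 add0r.
  rewrite (_ : (fun n => J (s n) x - u x + n.+1%:R^-1 + u x) = (fun n => J (s n) x + n.+1%:R^-1))//.
  by apply/funext => n; ring.
- move=> i; have := mollification_cvg (ldu i) r0.
  move=> /(cvg_comp _ _ soo).
  rewrite (_ : _ \o s = fun n => norm2 mu (fun x => ind (cube r) x *
      (partial i (fun x => J (s n) x + n.+1%:R^-1) x - du x ord0 i)))//.
  apply/funext => n /=.
  by apply: eq_Rintegral => x _; rewrite partialDc// dJE.
Qed.


(** G(u) psi is a limit of C^1 test functions, together with its gradient. *)
Lemma nonlinear_test : exists (r m : R) (phi : nat -> rV -> R),
  [/\ 0 < r /\ vanish r psi, forall n, Cc 1 (phi n) /\ vanish r (phi n),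
      forall n x, `|phi n x| <= m,
      {ae mu, forall x, (fun n => phi n x) @ \oo --> G (u x) * psi x} &
      forall i, (forall n, L2 mu (partial i (phi n))) /\
        cvg2 mu (fun n => partial i (phi n)) (test_grad i)].
Proof.
have [r [m [r0 vp m0 pm dpm]]] := Mpsi.
have [v [dv cv vu gv]] := approx_seq (ltW r0).
have v0 n x : 0 < v n x by have [] := dv n x.
have cvn n : continuous (v n).
  by move=> x; apply: differentiable_continuous; have [] := dv n x.
have /class_C1P[dpsi cdpsi] := Cpsi.1.
have cpsi : continuous psi by move=> x; exact: differentiable_continuous.
pose phi n x := G (v n x) * psi x.
have dphi n x : differentiable (phi n) x /\ forall i, partial i (phi n) x =
    G (v n x) * partial i psi x + psi x * (dG (v n x) * partial i (v n) x).
  have [dvx _] := dv n x.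
  have [dGv pGv] := chain_rule dvx (GP (v0 n x)).
  split; first by apply: differentiableM => //; exact: dpsi.
  by move=> i; rewrite (partialM i dGv (dpsi x)) pGv.
have cGv n : continuous (fun x => G (v n x)).
  by move=> x; apply: (@continuous_comp _ _ _ (v n) G); [exact: cvn|exact: cG].
have cdGv n : continuous (fun x => dG (v n x)).
  by move=> x; apply: (@continuous_comp _ _ _ (v n) dG); [exact: cvn|exact: cdG].
have Cphi n : class_C 1 setT (phi n).
  apply/class_C1P; split => [x|i]; first by have [] := dphi n x.
  rewrite (_ : partial i (phi n) = fun x =>
    G (v n x) * partial i psi x + psi x * (dG (v n x) * partial i (v n) x)); last first.
    by apply/funext => x; have [_ ->] := dphi n x.
  apply: continuous_add; apply: continuous_mul => //.
  exact: continuous_mul.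
have vphi n : vanish r (phi n) by move=> x /vp h; rewrite /phi h mulr0.
exists r, (M * m), phi; split => //.
- by move=> n; split => //; split; [exact: Cphi|exact: vanish_compact (ltW r0) (vphi n)].
- by move=> n x; rewrite normrM ler_pM// GM.
- apply: filterS vu => x vux; have [/vux h|/vp h] := leP `|x| r.
    by apply: cvgM; [exact: (cvg_comp _ _ h (cG (u0 x)))|exact: cvg_cst].
  by rewrite /phi; under eq_fun do rewrite h mulr0; rewrite h mulr0; exact: cvg_cst.
move=> i.
have mdphi n : measurable_fun setT (partial i (phi n)).
  by apply: continuous_measurable_rV; have /class_C1P[_] := Cphi n; exact.
have Ldphi n : L2 mu (partial i (phi n)).
  have [b bP] := vanish_bounded (ltW r0) (vanish_partial i (vphi n)) (((class_C1P _).1 (Cphi n)).2 i).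
  exact: (L2_of_vanish (mdphi n) bP (ltW r0) (vanish_partial i (vphi n))).
split => //.
have LV n : L2 mu (fun x => ind (cube r) x * (partial i (v n) x - du x ord0 i)).
  have [b bP] := continuous_bounded_cube (ltW r0) (cv n i).
  have mind : measurable_fun setT (ind (cube r : set rV)).
    by apply: measurable_ind; apply: measurable_cube; exact: ltW.
  have mV := continuous_measurable_rV (cv n i).
  have b0 : 0 <= b by apply: (le_trans (normr_ge0 _) (bP 0 _)); rewrite normr0 ltW.
  have h : L2 mu (fun x => ind (cube r) x * partial i (v n) x).
    apply: (@L2_of_vanish _ _ _ b r) => //; first exact: measurable_funM.
    - move=> x; rewrite ind_cube; have [/bP|_] := leP `|x| r; first by rewrite mul1r.
      by rewrite mul0r normr0.
    - exact: ltW.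
    - by move=> x xr; rewrite ind_cube leNgt xr mul0r.
  have := L2B h ((ldu i).2 r (ltW r0)); congr L2; apply/funext => x; ring.
have mGv n : measurable_fun setT (fun x => G (v n x)) by exact: continuous_measurable_rV.
have mdGv n : measurable_fun setT (fun x => dG (v n x)) by exact: continuous_measurable_rV.
pose A n x := (dG (v n x) * psi x) * (ind (cube r) x * (partial i (v n) x - du x ord0 i)).
pose B n x := (dG (v n x) - dG (u x)) * psi x * (ind (cube r) x * du x ord0 i).
pose C n x := (G (v n x) - G (u x)) * partial i psi x.
have mA n : measurable_fun setT (fun x => dG (v n x) * psi x) by exact: measurable_funM.
have bA n x : `|dG (v n x) * psi x| <= M * m by rewrite normrM ler_pM// dGM.
have LA n : L2 mu (A n) by exact: (L2Mb (mA n) (bA n) (LV n)).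
have mB n : measurable_fun setT (fun x => (dG (v n x) - dG (u x)) * psi x).
  by apply: measurable_funM => //; exact: measurable_funB.
have bB n x : `|(dG (v n x) - dG (u x)) * psi x| <= 2 * M * m.
  rewrite normrM ler_pM//; apply: le_trans (ler_normB _ _) _.
  by rewrite mulrDl mul1r lerD// dGM.
have LB n : L2 mu (B n) by exact: (L2Mb (mB n) (bB n) ((ldu i).2 r (ltW r0))).
have mC n : measurable_fun setT (C n).
  by apply: measurable_funM => //; exact: measurable_funB.
have bC n x : `|C n x| <= 2 * M * m.
  rewrite normrM ler_pM//; apply: le_trans (ler_normB _ _) _.
  by rewrite mulrDl mul1r lerD// GM.
have vC n : vanish r (C n).
  by move=> x /(vanish_partial i vp) h; rewrite /C h mulr0.
have LC n : L2 mu (C n) by exact: (L2_of_vanish (mC n) (bC n) (ltW r0) (vC n)).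
have E n : norm2 mu (fun x => partial i (phi n) x - test_grad i x) =
    norm2 mu (fun x => A n x + (B n x + C n x)).
  apply: eq_Rintegral => x _; have [_ ->] := dphi n x; congr (_ ^+ 2).
  rewrite /test_grad /A /B /C.
  have := vanish_ind x vp; move: (ind _ _) => I0 pI.
  rewrite {1 2}pI; ring.
have cA : (fun n => norm2 mu (A n)) @ \oo --> (0 : R).
  apply: (@squeeze_cvgr _ _ _ _ (cst 0) (fun n => (M * m) ^+ 2 *
    norm2 mu (fun x => ind (cube r) x * (partial i (v n) x - du x ord0 i)))).
  - apply: nearW => n; rewrite norm2_ge0/=.
    exact: norm2_bounded.
  - exact: cvg_cst.
  - by rewrite -(mulr0 ((M * m) ^+ 2)); apply: cvgMr; exact: gv.
have cB : (fun n => norm2 mu (B n)) @ \oo --> (0 : R).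
  apply: (@norm2_dominated_cvg _ _ _ _ _
    (fun x => 2 * M * m * `|ind (cube r) x * du x ord0 i|)).
  - by move=> n; exact: (LB n).1.
  - apply: filterS vu => x vux; have [/vux h|xr] := leP `|x| r.
      rewrite /B.
      have h' : (fun n => dG (v n x) - dG (u x)) @ \oo --> (0 : R).
        by apply/subr_cvg0; exact: (cvg_comp _ _ h (cdG (u0 x))).
      rewrite -[X in _ --> X](_ : 0 * psi x * (ind (cube r) x * du x ord0 i) = 0); last by ring.
      by apply: cvgM; [apply: cvgM => //; exact: cvg_cst|exact: cvg_cst].
    by rewrite /B; under eq_fun do rewrite (vp _ xr) mulr0 mul0r; exact: cvg_cst.
  - apply: L2Z; have [mi Li] := (ldu i).2 r (ltW r0); split.
      exact: measurableT_comp.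
    by apply: L1_eq Li => x; rewrite real_normK ?num_real.
  - by move=> n x; rewrite normrM ler_wpM2r.
have cC : (fun n => norm2 mu (C n)) @ \oo --> (0 : R).
  apply: (@norm2_dominated_cvg _ _ _ _ _ (fun x => 2 * M * m * ind (cube r) x)) => //.
  - apply: filterS vu => x vux; have [/vux h|xr] := leP `|x| r.
      rewrite /C.
      have h' : (fun n => G (v n x) - G (u x)) @ \oo --> (0 : R).
        by apply/subr_cvg0; exact: (cvg_comp _ _ h (cG (u0 x))).
      rewrite -[X in _ --> X](_ : 0 * partial i psi x = 0); last by ring.
      by apply: cvgM => //; exact: cvg_cst.
    by rewrite /C; under eq_fun do rewrite (vanish_partial i vp xr) mulr0; exact: cvg_cst.
  - by apply: L2Z; exact: L2_ind_cube (ltW r0).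
  - by move=> n x; rewrite (vanish_ind x (vC n)) normrM (ger0_norm (ind_ge0 _ _)) ler_wpM2r ?ind_ge0.
rewrite /cvg2; under eq_fun do rewrite E.
apply: (@squeeze_cvgr _ _ _ _ (cst 0) (fun n => 2 * norm2 mu (A n) +
  2 * (2 * norm2 mu (B n) + 2 * norm2 mu (C n)))).
- apply: nearW => n; rewrite norm2_ge0/=.
  have := norm2D (LA n) (L2D (LB n) (LC n)); have := norm2D (LB n) (LC n); lra.
- exact: cvg_cst.
- rewrite -[X in _ --> X](_ : 2 * 0 + 2 * (2 * 0 + 2 * 0) = 0); last by ring.
  by apply: cvgD; apply: cvgMr => //; apply: cvgD; apply: cvgMr.
Qed.


Lemma test_grad_vanish r i : vanish r psi -> vanish r (test_grad i).
Proof.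
move=> vp x xr; rewrite /test_grad (vp _ xr) (vanish_partial i vp xr).
by rewrite !mulr0 mul0r addr0.
Qed.

Lemma L1_loc2_test_grad (a : rV -> R) i : loc2 a -> L1 mu (fun x => a x * test_grad i x).
Proof.
move=> la; have [r [m [r0 vp _ _ _]]] := Mpsi.
apply: L1_eq (L2M (la.2 r (ltW r0)) (test_grad_L2 i)) => x /=.
by rewrite [in RHS](vanish_ind x (test_grad_vanish i vp)); ring.
Qed.

Lemma cvg2_cst (f : rV -> R) : cvg2 mu (fun _ => f) f.
Proof.
rewrite /cvg2 (_ : (fun _ => _) = cst 0); first exact: cvg_cst.
apply/funext => n; rewrite /norm2; under eq_Rintegral do rewrite subrr expr0n.
by rewrite Rintegral_cst// mul0r.
Qed.

Lemma Gpsi_bounds : exists r m : R, [/\ 0 < r, vanish r psi,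
  measurable_fun setT (fun x => G (u x) * psi x),
  vanish r (fun x => G (u x) * psi x) & forall x, `|G (u x) * psi x| <= m].
Proof.
have [r [m [r0 vp m0 pm dpm]]] := Mpsi; exists r, (M * m); split => //.
- exact: measurable_funM.
- by move=> x /vp ->; rewrite mulr0.
- by move=> x; rewrite normrM ler_pM// GM.
Qed.

(** An identity against C^1 test functions can be tested with G(u) psi. *)
Lemma weak_identity_nonlinear (a : 'I_N -> rV -> R) (b : rV -> R) :
  (forall i, loc2 (a i)) -> loc1 b ->
  (forall phi, Cc 1 phi ->
    \int[mu]_x (\sum_i a i x * partial i phi x) = \int[mu]_x (b x * phi x)) ->
  \int[mu]_x (\sum_i a i x * test_grad i x) = \int[mu]_x (b x * (G (u x) * psi x)).
Proof.
move=> la lb H.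
have [r [m [phi [[r0 vp] Cphi pm cphi cdphi]]]] := nonlinear_test.
have vphi n := (Cphi n).2.
have La i n : L1 mu (fun x => a i x * partial i (phi n) x).
  apply: L1_eq (L2M ((la i).2 r (ltW r0)) ((cdphi i).1 n)) => x /=.
  by rewrite [in RHS](vanish_ind x (vanish_partial i (vphi n))); ring.
have ca i : (fun n => \int[mu]_x (a i x * partial i (phi n) x)) @ \oo -->
    \int[mu]_x (a i x * test_grad i x).
  have m1 : measurable_fun setT (cst 1 : rV -> R) by exact: measurable_cst.
  have b1 (x : rV) : `|cst 1 x : R| <= 1 by rewrite normr1.
  have := @cvg2_prod _ _ _ mu 1 (cst 1) (fun _ x => ind (cube r) x * a i x) _ _ _
    m1 b1 (fun=> (la i).2 r (ltW r0)) (cdphi i).1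
    ((la i).2 r (ltW r0)) (test_grad_L2 i) (cvg2_cst _) (cdphi i).2.
  have E w : vanish r w -> \int[mu]_x (cst 1 x * (ind (cube r) x * a i x * w x)) =
      \int[mu]_x (a i x * w x).
    by move=> vw; apply: eq_Rintegral => x _; rewrite [in RHS](vanish_ind x vw) /=; ring.
  rewrite (E _ (test_grad_vanish i vp)).
  by under eq_fun do rewrite (E _ (vanish_partial i (vphi _))).
have cb : (fun n => \int[mu]_x (b x * phi n x)) @ \oo --> \int[mu]_x (b x * (G (u x) * psi x)).
  have mph n : measurable_fun setT (phi n).
    exact: continuous_measurable_rV (class_C_continuous (Cphi n).1.1).
  have bd n := bounded_loc1M lb (mph n) (pm n) (ltW r0) (vphi n).
  have [_ [_ [_ _ mGp _ _]]] := Gpsi_bounds.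
  have m1 n : measurable_fun setT (fun x => b x * phi n x) := L1_measurable (bd n).1.
  have m2 : measurable_fun setT (fun x => b x * (G (u x) * psi x)).
    by apply: measurable_funM => //; exact: lb.1.
  have m3 : {ae mu, forall x, (fun n => b x * phi n x) @ \oo --> b x * (G (u x) * psi x)}.
    by apply: filterS cphi => x h; apply: cvgM; [exact: cvg_cst|exact: h].
  by have [] := Rdominated_cvg m1 m2 m3 (L1Z m (L1_norm (lb.2 _ (ltW r0)))) (fun n => (bd n).2).
have cs : (fun n => \sum_i \int[mu]_x (a i x * partial i (phi n) x)) @ \oo -->
    \sum_i \int[mu]_x (a i x * test_grad i x) by exact: cvg_sumr.
rewrite Rintegral_sum; last by move=> i; exact: L1_loc2_test_grad.
have E : (fun n => \sum_i \int[mu]_x (a i x * partial i (phi n) x)) =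
    (fun n => \int[mu]_x (b x * phi n x)).
  by apply/funext => n; rewrite -Rintegral_sum// (H _ (Cphi n).1).
rewrite E in cs; exact: (cvg_unique _ cs cb).
Qed.

Lemma L1_quadratic_test_grad (K : R) (q : rV -> R) i j :
  measurable_fun setT q -> (forall x, `|q x| <= K) ->
  L1 mu (fun x => q x * (test_grad i x * test_grad j x)).
Proof.
move=> mq qK; apply: L1_eq (L2M (L2Mb mq qK (test_grad_L2 i)) (test_grad_L2 j)) => x.
by rewrite mulrA.
Qed.

Lemma L1_loc1_Gpsi (b : rV -> R) : loc1 b -> L1 mu (fun x => b x * (G (u x) * psi x)).
Proof.
move=> lb; have [r [m [r0 _ mGp vGp Gpm]]] := Gpsi_bounds.
exact: (loc1M lb mGp Gpm (ltW r0) vGp).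
Qed.

Lemma L1_loc1_Gpsi2 (b : rV -> R) : loc1 b -> L1 mu (fun x => b x * (G (u x) * psi x) ^+ 2).
Proof.
move=> lb; have [r [m [r0 _ mGp vGp Gpm]]] := Gpsi_bounds.
apply: (loc1M (M := m ^+ 2) (r := r) lb).
- exact: measurable_funX.
- move=> x; rewrite normrX lerXn2r ?nnegrE//.
  exact: le_trans (normr_ge0 _) (Gpm x).
- exact: ltW.
- by move=> x /vGp ->; rewrite expr0n.
Qed.

(** A quadratic inequality for C^1 functions holds for G(u) psi. *)
Lemma quadratic_nonlinear (K : R) (q : 'I_N -> 'I_N -> rV -> R) (c : rV -> R) :
  (forall i j, measurable_fun setT (q i j)) -> (forall i j x, `|q i j x| <= K) ->
  loc1 c ->
  (forall phi, Cc 1 phi -> \int[mu]_x (c x * phi x ^+ 2) <=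
    \int[mu]_x (\sum_i \sum_j q i j x * (partial i phi x * partial j phi x))) ->
  \int[mu]_x (c x * (G (u x) * psi x) ^+ 2) <=
    \int[mu]_x (\sum_i \sum_j q i j x * (test_grad i x * test_grad j x)).
Proof.
move=> mq qK lc H.
have [r [m [phi [[r0 vp] Cphi pm cphi cdphi]]]] := nonlinear_test.
have vphi n := (Cphi n).2.
have Lq i j n : L1 mu (fun x => q i j x * (partial i (phi n) x * partial j (phi n) x)).
  apply: L1_eq (L2M (L2Mb (mq i j) (qK i j) ((cdphi i).1 n)) ((cdphi j).1 n)) => x.
  by rewrite mulrA.
have cq i j : (fun n => \int[mu]_x (q i j x * (partial i (phi n) x * partial j (phi n) x)))
    @ \oo --> \int[mu]_x (q i j x * (test_grad i x * test_grad j x)).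
  exact: (cvg2_prod (mq i j) (qK i j) (cdphi i).1 (cdphi j).1 (test_grad_L2 i)
    (test_grad_L2 j) (cdphi i).2 (cdphi j).2).
have cb : (fun n => \int[mu]_x (c x * phi n x ^+ 2)) @ \oo -->
    \int[mu]_x (c x * (G (u x) * psi x) ^+ 2).
  have mph n : measurable_fun setT (fun x => phi n x ^+ 2).
    apply: measurable_funX.
    exact: continuous_measurable_rV (class_C_continuous (Cphi n).1.1).
  have m0 : 0 <= m by exact: le_trans (normr_ge0 _) (pm 0%N 0).
  have pm2 n x : `|phi n x ^+ 2| <= m ^+ 2 by rewrite normrX lerXn2r ?nnegrE.
  have vphi2 n : vanish r (fun x => phi n x ^+ 2).
    by move=> x /(vphi n) ->; rewrite expr0n.
  have bd n := bounded_loc1M lc (mph n) (pm2 n) (ltW r0) (vphi2 n).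
  have m1 n : measurable_fun setT (fun x => c x * phi n x ^+ 2) := L1_measurable (bd n).1.
  have m2 := L1_measurable (L1_loc1_Gpsi2 lc).
  have m3 : {ae mu, forall x, (fun n => c x * phi n x ^+ 2) @ \oo --> c x * (G (u x) * psi x) ^+ 2}.
    by apply: filterS cphi => x h; apply: cvgM; [exact: cvg_cst|apply: cvgM; exact: h].
  by have [] := Rdominated_cvg m1 m2 m3 (L1Z (m ^+ 2) (L1_norm (lc.2 _ (ltW r0)))) (fun n => (bd n).2).
have Rsum2 (F : 'I_N -> 'I_N -> rV -> R) : (forall i j, L1 mu (F i j)) ->
    \int[mu]_x (\sum_i \sum_j F i j x) = \sum_i \sum_j \int[mu]_x F i j x.
  move=> LF; rewrite Rintegral_sum; last by move=> i; exact: L1_sum.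
  by apply: eq_bigr => i _; rewrite Rintegral_sum.
rewrite Rsum2; last by move=> i j; exact: L1_quadratic_test_grad.
have cs : (fun n => \sum_i \sum_j
    \int[mu]_x (q i j x * (partial i (phi n) x * partial j (phi n) x))) @ \oo -->
    \sum_i \sum_j \int[mu]_x (q i j x * (test_grad i x * test_grad j x)).
  by apply: cvg_sumr => i; exact: cvg_sumr.
apply: (ler_cvg_to cb cs); apply: nearW => n.
by rewrite -Rsum2//; exact: H (Cphi n).1.
Qed.

End nonlinear.

(** * Homogeneity identities for a Finsler norm *)

Section finsler_algebra.
Context {R : realType} {N : nat}.
Local Notation rV := 'rV[R]_N.
Implicit Types (x xi eta : rV) (i j : 'I_N).

Lemma partial_homogeneous (k : rV -> R) (t s : R) xi i : 0 < t ->
  (forall x, k (t *: x) = s * k x) ->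
  differentiable k xi -> differentiable k (t *: xi) ->
  partial i k (t *: xi) = s / t * partial i k xi.
Proof.
move=> t0 kt dk dkt; pose e : rV := delta_mx ord0 i.
have t_neq0 : t != 0 by rewrite gt_eqF.
have := @is_derive_line _ _ k (t *: xi) e 0.
rewrite scale0r add0r => /(_ (diff_derivable dkt)) h1.
have := @is_derive_line _ _ k xi e 0.
rewrite scale0r add0r => /(_ (diff_derivable dk)) h2.
have h3 : is_derive (0 : R) (1 : R) (fun h : R => t^-1 * h) (t^-1 * 1).
  exact: dfunZ (dfun_id 0).
have h2' : is_derive (t^-1 * 0) (1 : R) (fun h : R => k (h *: e + xi)) ('D_e k xi).
  by rewrite mulr0.
have h4 := dfunZ s (dfun_comp h2' h3).
have E : (fun h : R => k (h *: e + t *: xi)) = fun h => s * k ((t^-1 * h) *: e + xi).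
  apply/funext => h; rewrite -kt scalerDr scalerA mulrA divff// mul1r.
  by [].
rewrite /partial -/e; move: h1 h4; rewrite E => -[_ <-] [_ ->].
by rewrite mulr1; ring.
Qed.

(** The radial derivative of a homogeneous function. *)
Lemma radial_derivative (k : rV -> R) xi (c : R) : differentiable k xi ->
  (forall h : R, -1 < h -> k ((1 + h) *: xi) = k xi + h * c) ->
  total_diff k xi xi = c.
Proof.
move=> dk kh; rewrite -derive_partial//.
have := @is_derive_line _ _ k xi xi 0.
rewrite scale0r add0r => /(_ (diff_derivable dk)) [_ <-].
have h : is_derive (0 : R) (1 : R) (fun h : R => k xi + h * c) (0 + (0 * 0 + c * 1)).
  by apply: dfunD (dfun_cst _ _) (dfunM (dfun_id 0) (dfun_cst c 0)).
have [] : is_derive (0 : R) (1 : R) (fun h : R => k (h *: xi + xi)) (0 + (0 * 0 + c * 1)).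
  apply: near_eq_is_derive h.
  have : \forall h \near (0 : R), -1 < h by apply: lt_nbhsr; rewrite ltrN10.
  apply: filterS => h h1; rewrite -kh//.
  by rewrite scalerDl scale1r addrC.
by move=> _ ->; ring.
Qed.

Variable F : rV -> R.
Hypothesis hF : finsler_norm F.
Local Notation F_ i := (partial i F).
Local Notation F2 i j := (partial j (partial i F)).

Lemma finsler0 : F 0 = 0.
Proof. by have := finsler_homogeneous hF 0 0; rewrite scale0r normr0 mul0r. Qed.

Lemma finsler_diff xi : xi != 0 -> differentiable F xi.
Proof. by have [H _] := finsler_C2 hF; exact: H. Qed.

Lemma finsler_diff1 i xi : xi != 0 -> differentiable (F_ i) xi.
Proof. by have [_ /(_ i)[H _]] := finsler_C2 hF; exact: H. Qed.

Lemma finsler_cont2 i j xi : xi != 0 -> {for xi, continuous (F2 i j)}.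
Proof. by have [_ /(_ i)[_ /(_ j)H]] := finsler_C2 hF; exact: H. Qed.

Lemma finsler_pos_homogeneous (t : R) xi : 0 < t -> F (t *: xi) = t * F xi.
Proof. by move=> t0; rewrite (finsler_homogeneous hF) gtr0_norm. Qed.

Lemma scaler_neq0 (t : R) xi : 0 < t -> xi != 0 -> t *: xi != 0.
Proof. by move=> t0 x0; rewrite scaler_eq0 negb_or gt_eqF. Qed.

Lemma finsler_partial_homogeneous (t : R) xi i : 0 < t -> F_ i (t *: xi) = F_ i xi.
Proof.
move=> t0; have [->|xi0] := eqVneq xi 0; first by rewrite scaler0.
rewrite (partial_homogeneous i t0 (fun x => finsler_pos_homogeneous x t0)).
- by rewrite divff ?mul1r// gt_eqF.
- exact: finsler_diff.
- by apply: finsler_diff; exact: scaler_neq0.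
Qed.

Lemma finsler_partial2_homogeneous (t : R) xi i j : 0 < t -> xi != 0 ->
  F2 i j (t *: xi) = t^-1 * F2 i j xi.
Proof.
move=> t0 xi0; rewrite (@partial_homogeneous (F_ i) t 1)// ?div1r//.
- by move=> x; rewrite mul1r finsler_partial_homogeneous.
- exact: finsler_diff1.
- by apply: finsler_diff1; exact: scaler_neq0.
Qed.

Lemma euler1 xi : \sum_i xi ord0 i * F_ i xi = F xi.
Proof.
have [->|xi0] := eqVneq xi 0.
  by rewrite finsler0 big1// => i _; rewrite mxE mul0r.
apply: (radial_derivative (finsler_diff xi0)) => h h1.
rewrite finsler_pos_homogeneous; first by ring.
by move: h1; lra.
Qed.

Lemma euler2 xi i : xi != 0 -> \sum_j xi ord0 j * F2 i j xi = 0.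
Proof.
move=> xi0; apply: (radial_derivative (finsler_diff1 i xi0)) => h h1.
rewrite finsler_partial_homogeneous; first by ring.
by move: h1; lra.
Qed.

Lemma partial_coord i j x : partial j (fun v : rV => v ord0 i) x = (i == j)%:R.
Proof.
have d := coordrV_differentiable i x.
have := @is_derive_line _ _ (fun v : rV => v ord0 i) x (delta_mx ord0 j) 0.
rewrite scale0r add0r => /(_ (diff_derivable d)).
have E : (fun h : R => (h *: delta_mx ord0 j + x) ord0 i) =
    fun h => (i == j)%:R * h + x ord0 i.
  by apply/funext => h; rewrite !mxE eqxx/= mulrC.
rewrite /partial E => -[_ <-].
by have [_ ->] := dfunD (dfunZ ((i == j)%:R : R) (dfun_id 0)) (dfun_cst (x ord0 i) 0);
  rewrite addr0 mulr1.
Qed.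

(** Differentiating the first Euler identity gives the second one on the other
    index, so the symmetry of the Hessian is not used. *)
Lemma euler2' xi j : xi != 0 -> \sum_i xi ord0 i * F2 i j xi = 0.
Proof.
move=> xi0.
pose f i : rV -> R := fun x => x ord0 i * F_ i x.
have df i : differentiable (f i) xi.
  by apply: differentiableM; [exact: coordrV_differentiable|exact: finsler_diff1].
have pf i : partial j (f i) xi = xi ord0 i * F2 i j xi + F_ i xi * (i == j)%:R.
  rewrite /f partialM ?partial_coord//; first exact: coordrV_differentiable.
  exact: finsler_diff1.
have : partial j (fun x => \sum_i f i x) xi = partial j F xi.
  by congr (partial j _ xi); apply/funext => x; exact: euler1.
rewrite {1}/partial (_ : (fun x => _) = \sum_i f i); last first.
  by apply/funext => x; rewrite fct_sumE.
rewrite derive_sum; last by move=> i; exact: diff_derivable.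
under eq_bigr do rewrite -/(partial j _ xi) pf.
have -> : \sum_i (xi ord0 i * F2 i j xi + F_ i xi * (i == j)%:R) =
    \sum_i xi ord0 i * F2 i j xi + F_ j xi.
  rewrite big_split/=; congr (_ + _).
  rewrite (bigD1 j)//= eqxx mulr1 big1 ?addr0// => i /negbTE ->.
  by rewrite mulr0.
by move=> h; apply: (addIr (partial j F xi)); rewrite add0r.
Qed.

Lemma homogeneous0_bounded (k : rV -> R) :
  (forall (t : R) xi, 0 < t -> xi != 0 -> k (t *: xi) = k xi) ->
  (forall xi, xi != 0 -> {for xi, continuous k}) ->
  exists2 C, 0 <= C & forall xi, xi != 0 -> `|k xi| <= C.
Proof.
move=> kh kc; pose S : set rV := [set x | `|x| = 1].
have cS : compact S.
  apply: (@subclosed_compact _ _ (cube 1)) => //.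
  - rewrite (_ : S = (fun x : rV => `|x|) @^-1` [set 1])//.
    apply: closed_comp; first by move=> x _; exact: norm_continuous.
    exact: closed_eq.
  - exact: compact_cube.
  - by move=> x; rewrite /S/cube/= => ->.
have S0 x : S x -> x != 0.
  by rewrite /S/= => x1; rewrite -normr_eq0 x1 oner_eq0.
have nS x : x != 0 -> S (`|x|^-1 *: x).
  move=> x0; rewrite /S/= normrZ ger0_norm ?invr_ge0// mulVf//.
  by rewrite normr_eq0.
have [Sne|Se] := pselect (S !=set0); last first.
  by exists 0 => // xi /nS h; case: Se; eexists; exact: h.
have cn : {within S, continuous (fun x : rV => `|k x|)}.
  apply: continuous_in_subspaceT => x; rewrite inE => /S0 x0.
  by apply: (@continuous_comp _ _ _ k Num.norm); [exact: kc|exact: norm_continuous].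
have [c _ H] := compact_EVT_max Sne cS cn.
exists `|k c| => // xi xi0.
rewrite -(kh `|xi|^-1 xi)//; last by rewrite invr_gt0 normr_gt0.
by apply: H; rewrite inE; exact: nS.
Qed.

Lemma finsler_bounded : exists2 C, 0 <= C &
  (forall i xi, `|F_ i xi| <= C) /\ (forall i j xi, `|F xi * F2 i j xi| <= C).
Proof.
have h1 i : exists C, forall xi, `|F_ i xi| <= C.
  have [||C C0 H] := @homogeneous0_bounded (F_ i).
  - by move=> t xi t0 _; exact: finsler_partial_homogeneous.
  - by move=> xi xi0; apply: differentiable_continuous; exact: finsler_diff1.
  exists C => xi; have [->|/H//] := eqVneq xi 0.
  by rewrite partial_finsler0// normr0.
have h2 (p : 'I_N * 'I_N) : exists C, forall xi, `|F xi * F2 p.1 p.2 xi| <= C.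
  have [||C C0 H] := @homogeneous0_bounded (fun xi => F xi * F2 p.1 p.2 xi).
  - move=> t xi t0 xi0; rewrite finsler_partial2_homogeneous//.
    by rewrite finsler_pos_homogeneous//; field; rewrite gt_eqF.
  - move=> xi xi0; apply: (@continuousM R _ F (F2 p.1 p.2)).
      by apply: differentiable_continuous; exact: finsler_diff.
    exact: finsler_cont2.
  exists C => xi; have [->|/H//] := eqVneq xi 0.
  by rewrite finsler0 mul0r normr0.
have [C1 H1] := finite_bound h1; have [C2 H2] := finite_bound h2.
exists (Num.max 0 (Num.max C1 C2)); first by rewrite le_max lexx.
split=> [i xi|i j xi]; first by rewrite !le_max H1 orbT.
by rewrite !le_max (H2 (i, j)) !orbT.
Qed.

Lemma measurable_punctured (k : rV -> R) :
  (forall xi, xi != 0 -> {for xi, continuous k}) -> measurable_fun setT k.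
Proof.
move=> kc mT; apply: (measurability _ (RGenOInfty.measurableE R)) => //.
move=> _ [_ [a ->] <-]; rewrite setTI.
pose U : set rV := [set x | x != 0].
have oU : open U.
  rewrite (_ : U = [set x | 0 < `|x|]); first exact: open_normrV_gt.
  by apply/seteqP; split => x; rewrite /U/= normr_gt0.
have oA : open (U `&` k @^-1` `]a, +oo[).
  rewrite openE => x [Ux /=]; rewrite in_itv/= andbT => kx.
  have h1 : nbhs x U by exact: open_nbhs_nbhs.
  have h2 : \forall y \near x, a < k y by exact: (cvgr_gt (k x) (kc x Ux) _ kx).
  by apply: filterS2 h1 h2 => y ? ?; split => //=; rewrite in_itv/= andbT.
have m0 : measurable [set (0 : rV)].
  rewrite (_ : [set _] = ~` U); first by apply: measurableC; exact: open_measurable_rV.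
  apply/seteqP; split => x; rewrite /U/=; first by move=> ->; rewrite eqxx.
  by move=> /negP/negPn/eqP.
have -> : k @^-1` `]a, +oo[ = (U `&` k @^-1` `]a, +oo[) `|` ([set 0] `&` [set x | a < k 0]).
  apply/seteqP; split => x /=; rewrite in_itv/= andbT.
    by move=> kx; have [x0|x0] := eqVneq x 0; [right|left]; rewrite -?x0.
  by move=> [[]//|[-> ]].
apply: measurableU; first exact: open_measurable_rV.
have [h|h] := boolP (a < k 0).
  by rewrite (_ : [set x | _] = setT) ?setIT//; apply/seteqP.
rewrite (_ : [set x | _] = set0) ?setI0//.
by apply/seteqP; split => x //=; rewrite (negbTE h).
Qed.

End finsler_algebra.

(** * Damping functions of linear growth *)

Section damping.
Context {R : realType}.
Implicit Types (n : nat) (t : R) (G dG : R -> R).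

Definition damp n t : R := (1 + harmonic n * t)^-1.
Definition damp_loss n t : R := harmonic n * damp n t ^+ 2.

Lemma harmonic_gt0' n : 0 < harmonic n :> R.
Proof. by rewrite /harmonic invr_gt0. Qed.

Lemma harmonic_le1 n : harmonic n <= 1 :> R.
Proof. by rewrite /harmonic invf_le1 ?ler1n. Qed.

Let den_gt0 n t : 0 < t -> 0 < 1 + harmonic n * t.
Proof. by move=> t0; rewrite addr_gt0// mulr_gt0// harmonic_gt0'. Qed.

Lemma damp_gt0 n t : 0 < t -> 0 < damp n t.
Proof. by move=> t0; rewrite invr_gt0 den_gt0. Qed.

Lemma damp_le1 n t : 0 < t -> damp n t <= 1.
Proof.
by move=> t0; rewrite invf_le1 ?den_gt0// lerDl mulr_ge0// ltW// harmonic_gt0'.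
Qed.

Lemma damp_homo t n m : 0 < t -> (n <= m)%N -> damp n t <= damp m t.
Proof.
move=> t0 nm; rewrite lef_pV2 ?posrE ?den_gt0// lerD2l ler_wpM2r ?(ltW t0)//.
by rewrite /harmonic lef_pV2 ?posrE ?ltr0n// ler_nat ltnS.
Qed.

Lemma damp_growth n t : 0 < t -> harmonic n * (1 + t) * damp n t <= 1.
Proof.
move=> t0; rewrite ler_pdivrMr ?den_gt0// mul1r mulrDr mulr1 lerD2r.
exact: harmonic_le1.
Qed.

Lemma damp_cvg t : damp ^~ t @ \oo --> (1 : R).
Proof.
have : damp ^~ t @ \oo --> ((1 + 0 * t)^-1 : R).
  apply: cvgV; first by rewrite mul0r addr0.
  apply: cvgD; first exact: cvg_cst.
  by apply: cvgM; [exact: cvg_harmonic|exact: cvg_cst].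
by rewrite mul0r addr0 invr1.
Qed.

Lemma cvg_sqr (a : nat -> R) (l : R) : a @ \oo --> l -> (fun n => a n ^+ 2) @ \oo --> l ^+ 2.
Proof. by move=> al; rewrite expr2; apply: cvgM. Qed.

Lemma damp_loss_cvg t : damp_loss ^~ t @ \oo --> (0 : R).
Proof.
have : damp_loss ^~ t @ \oo --> (0 * 1 ^+ 2 : R).
  by apply: cvgM; [exact: cvg_harmonic|exact: cvg_sqr (damp_cvg t)].
by rewrite mul0r.
Qed.

Lemma is_derive_damp n t : 0 < t -> is_derive t (1 : R) (damp n) (- damp_loss n t).
Proof.
move=> t0; have d0 : 1 + harmonic n * t != 0 by rewrite gt_eqF// den_gt0.
have := dfunV (f := fun t => 1 + harmonic n * t) d0
  (dfunD (dfun_cst 1 t) (dfunZ (harmonic n) (dfun_id t))).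
move=> h; apply: (is_derive_eq1 h).
by rewrite /damp_loss /damp add0r mulr1 exprVn.
Qed.

Definition damped n G t := G t * damp n t.
Definition damped' n G dG t := dG t * damp n t - G t * damp_loss n t.

Lemma is_derive_damped n G dG t : 0 < t -> is_derive t (1 : R) G (dG t) ->
  is_derive t (1 : R) (damped n G) (damped' n G dG t).
Proof.
move=> t0 Gd; apply: (is_derive_eq1 (dfunM Gd (is_derive_damp n t0))).
by rewrite /damped'; ring.
Qed.

Lemma damped'_continuous n G dG t : 0 < t -> {for t, continuous G} ->
  {for t, continuous dG} -> {for t, continuous (damped' n G dG)}.
Proof.
move=> t0 cG cdG; have cd : {for t, continuous (damp n)}.
  exact: dfun_continuous (is_derive_damp n t0).
apply: cvgB; first exact: cvgM.
apply: cvgM => //; apply: cvgM; first exact: cvg_cst.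
by rewrite expr2; apply: cvgM.
Qed.

Lemma damped_le n G t : 0 < t -> `|damped n G t| <= `|G t|.
Proof.
move=> t0; rewrite normrM (gtr0_norm (damp_gt0 n t0)) -[leRHS]mulr1.
by rewrite ler_wpM2l// damp_le1.
Qed.

Lemma damped_bounded n G t (M : R) : 0 < t -> 0 <= M -> `|G t| <= M * (1 + t) ->
  `|damped n G t| <= M * n.+1%:R.
Proof.
move=> t0 M0 GM; rewrite normrM (gtr0_norm (damp_gt0 n t0)).
apply: (@le_trans _ _ (M * (1 + t) * damp n t)).
  by rewrite ler_wpM2r// ltW// damp_gt0.
rewrite -mulrA ler_wpM2l//.
have := ler_wpM2l (ler0n R n.+1) (damp_growth n t0).
by rewrite mulr1 !mulrA /harmonic mulfV ?pnatr_eq0// mul1r.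
Qed.

Lemma damped'_le n G dG t (M : R) : 0 < t -> 0 <= M -> `|G t| <= M * (1 + t) ->
  `|dG t| <= M -> `|damped' n G dG t| <= 2 * M.
Proof.
move=> t0 M0 GM dGM; have d0 := damp_gt0 n t0; have h0 := harmonic_gt0' n.
apply: le_trans (ler_normB _ _) _; rewrite mulr2n mulrDl mul1r; apply: lerD.
  rewrite normrM (gtr0_norm d0) -[leRHS]mulr1.
  by apply: ler_pM => //; [exact: ltW|exact: damp_le1].
have l0 : 0 < damp_loss n t by rewrite mulr_gt0// exprn_gt0.
rewrite normrM (gtr0_norm l0); apply: (@le_trans _ _ (M * (1 + t) * damp_loss n t)).
  by rewrite ler_wpM2r// ltW.
rewrite -mulrA -[leRHS]mulr1; apply: ler_wpM2l => //.
have -> : (1 + t) * damp_loss n t = harmonic n * (1 + t) * damp n t * damp n t.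
  by rewrite /damp_loss; ring.
rewrite -[leRHS]mulr1; apply: ler_pM; rewrite ?damp_growth ?damp_le1 ?(ltW d0)//.
by rewrite !mulr_ge0 ?(ltW d0) ?(ltW h0)// addr_ge0// ltW.
Qed.

Lemma damped_cvg G t : (fun n => damped n G t) @ \oo --> G t.
Proof.
have : (fun n => damped n G t) @ \oo --> (G t * 1 : R).
  by apply: cvgM; [exact: cvg_cst|exact: damp_cvg].
by rewrite mulr1.
Qed.

Lemma damped'_cvg G dG t : (fun n => damped' n G dG t) @ \oo --> dG t.
Proof.
have : (fun n => damped' n G dG t) @ \oo --> (dG t * 1 - G t * 0 : R).
  apply: cvgB; (apply: cvgM; first exact: cvg_cst); first exact: damp_cvg.
  exact: damp_loss_cvg.
by rewrite mulr1 mulr0 subr0.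
Qed.

End damping.

Section bump_bounds.
Context {R : realType} {N : nat}.
Local Notation rV := 'rV[R]_N.

Lemma bumpN_partial_le (s : R) : 0 < s < 1 -> exists2 C : R, 0 <= C &
  forall (t : R) i (x : rV), 0 < t -> `|partial i (bumpN t) x| <= t * C * bumpN t x `^ (1 - s).
Proof.
move=> s01; have [C C0 HC] := @bump_deriv_le R s s01; exists C => // t i x t0.
have [D [D0 DS]] := @smooth1_bump R.
have db (y : R) : is_derive y (1 : R) (fun y => bump (t * y)) (D 1%N (t * y) * (t * 1)).
  have db0 (z : R) : is_derive z (1 : R) bump (D 1%N z) by rewrite -D0; exact: DS.
  exact: (dfun_comp (g := fun y => t * y) (db0 (t * y)) (dfunZ t (dfun_id y))).
rewrite /bumpN (@partial_tensor _ _ _ i (fun y => D 1%N (t * y) * (t * 1))).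
- rewrite /tensor [in leLHS](bigD1 i)//= [in leRHS](bigD1 i)//= /upd eqxx mulr1.
  under eq_bigr => j /negbTE ji do rewrite ji.
  set Q := \prod_(j < N | j != i) _.
  have Q0 : 0 <= Q by apply: prodr_ge0 => j _; exact: bump_ge0.
  have Q1 : Q <= 1 by apply: prodr_ile1 => j _; rewrite bump_ge0 bump_le1.
  have QQ : Q <= Q `^ (1 - s).
    have [->|Qn0] := eqVneq Q 0; first exact: powR_ge0.
    have Qp : 0 < Q by rewrite lt_def Qn0.
    by apply: ger1_powR; rewrite ?Qp// gerBl ltW// (andP s01).1.
  rewrite powRM ?bump_ge0// 2!normrM (ger0_norm Q0) (gtr0_norm t0).
  have hd : `|D 1%N (t * x ord0 i)| <= C * bump (t * x ord0 i) `^ (1 - s).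
    by apply: HC; rewrite -D0; exact: DS.
  rewrite [leRHS]mulrA; apply: ler_pM => //; first by rewrite mulr_ge0// ltW.
  by rewrite mulrC -mulrA ler_pM2l.
- by move=> j y; eexists; exact: db.
Qed.

Lemma bumpN_ge (t : R) (x : rV) : 0 < t -> t * `|x| <= 2^-1 ->
  bump (2^-1 : R) ^+ N <= bumpN t x.
Proof.
move=> t0 tx; rewrite /bumpN /tensor -[N in leLHS]card_ord -prodr_const.
apply: ler_prod => i _; rewrite bump_ge0/= !bumpE.
have y2 : `|t * x ord0 i| <= 2^-1.
  rewrite normrM gtr0_norm//; apply: le_trans tx.
  by rewrite ler_pM2l// norm_coord.
have {}y2 : (t * x ord0 i) ^+ 2 <= 2^-1 ^+ 2.
  by rewrite -[leLHS]real_normK ?num_real// lerXn2r ?nnegrE.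
have h2 : 0 < 1 - (2^-1 : R) ^+ 2 by lra.
have hy : 0 < 1 - (t * x ord0 i) ^+ 2 by apply: lt_le_trans h2 _; rewrite lerD2l lerN2.
by rewrite h2 hy ler_expR lerN2 lef_pV2 ?posrE// lerD2l lerN2.
Qed.

End bump_bounds.

(** * Local integrability *)

Section local_closure.
Context {R : realType} {N : nat}.
Local Notation rV := 'rV[R]_N.
Local Notation mu := (lebesgue_rV R N).
Implicit Types (v w : rV -> R).

Lemma loc2_le v w : measurable_fun setT v -> (forall x, `|v x| <= w x) -> loc2 w -> loc2 v.
Proof.
move=> mv vw [mw lw]; split => // r r0.
apply: L2_le (lw r r0).
  by apply: measurable_funM => //; apply: measurable_ind; exact: measurable_cube.
by move=> x; rewrite normrM (ger0_norm (ind_ge0 _ _)) ler_wpM2l ?ind_ge0.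
Qed.

Lemma loc2_cst (c : R) : loc2 (fun _ : rV => c).
Proof.
split; first exact: measurable_cst.
move=> r r0; have := L2Z c (@L2_ind_cube R N r r0).
by congr L2; apply/funext => x; rewrite mulrC.
Qed.

Lemma loc2D v w : loc2 v -> loc2 w -> loc2 (fun x => v x + w x).
Proof.
move=> [mv lv] [mw lw]; split; first exact: measurable_funD.
move=> r r0; have := L2D (lv r r0) (lw r r0); congr L2; apply/funext => x; ring.
Qed.

Lemma loc2Z (c : R) v : loc2 v -> loc2 (fun x => c * v x).
Proof.
move=> [mv lv]; split; first by apply: measurable_funM => //; exact: measurable_cst.
move=> r r0; have := L2Z c (lv r r0); congr L2; apply/funext => x; ring.
Qed.

Lemma loc2_norm v : loc2 v -> loc2 (fun x => `|v x|).
Proof.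
move=> [mv lv]; split; first exact: measurableT_comp.
move=> r r0; have [_ L] := lv r r0; split.
  apply: measurable_funM; last exact: measurableT_comp.
  by apply: measurable_ind; exact: measurable_cube.
by apply: L1_eq L => x; rewrite !exprMn real_normK ?num_real.
Qed.

Lemma loc2_sum (I : Type) (s : seq I) (F : I -> rV -> R) :
  (forall i, loc2 (F i)) -> loc2 (fun x => \sum_(i <- s) F i x).
Proof.
move=> lF; elim: s => [|i s IH].
  under [X in loc2 X]eq_fun do rewrite big_nil.
  apply: L2_loc2; split; first exact: measurable_cst.
  by apply: L1_eq (L1_0 _) => x; rewrite expr0n.
by under [X in loc2 X]eq_fun do rewrite big_cons; exact: loc2D.
Qed.

Lemma loc2M v w : loc2 v -> loc2 w -> loc1 (fun x => v x * w x).
Proof.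
move=> [mv lv] [mw lw]; split; first exact: measurable_funM.
move=> r r0; apply: L1_eq (L2M (lv r r0) (lw r r0)) => x.
by rewrite mulrACA -expr2 ind_sqr.
Qed.

Lemma loc1_mul_bounded v w (M : R) : loc1 v -> measurable_fun setT w ->
  (forall x, `|w x| <= M) -> loc1 (fun x => v x * w x).
Proof.
move=> [mv lv] mw wM; split; first exact: measurable_funM.
move=> r r0; apply: L1_le (L1Z M (L1_norm (lv r r0))).
  apply: measurable_funM; last exact: measurable_funM.
  by apply: measurable_ind; exact: measurable_cube.
by move=> x; rewrite mulrA normrM mulrC ler_wpM2r.
Qed.

Lemma loc1_le v w : measurable_fun setT v -> (forall x, `|v x| <= w x) -> loc1 w -> loc1 v.
Proof.
move=> mv vw [mw lw]; split => // r r0; apply: L1_le (lw r r0).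
  by apply: measurable_funM => //; apply: measurable_ind; exact: measurable_cube.
by move=> x; rewrite normrM (ger0_norm (ind_ge0 _ _)) ler_wpM2l ?ind_ge0.
Qed.

Lemma loc1_norm v : loc1 v -> loc1 (fun x => `|v x|).
Proof.
move=> [mv lv]; split; first exact: measurableT_comp.
move=> r r0; apply: L1_eq (L1_norm (lv r r0)) => x.
by rewrite normrM (ger0_norm (ind_ge0 _ _)).
Qed.

Lemma sqr_sum_le (I : finType) (a : I -> R) :
  (\sum_i `|a i|) ^+ 2 <= #|I|%:R * \sum_i a i ^+ 2.
Proof.
rewrite expr2 mulr_suml.
have -> : #|I|%:R * \sum_i a i ^+ 2 = \sum_i \sum_j (a i ^+ 2 + a j ^+ 2) / 2.
  have h i : \sum_j (a i ^+ 2 + a j ^+ 2) / 2 = (#|I|%:R * a i ^+ 2 + \sum_j a j ^+ 2) / 2.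
    by rewrite -mulr_suml big_split/= sumr_const -[a i ^+ 2 *+ _]mulr_natl.
  under [RHS]eq_bigr do rewrite h.
  rewrite -mulr_suml big_split/= -mulr_sumr sumr_const -[X in _ = (_ + X) / 2]mulr_natl.
  by lra.
apply: ler_sum => i _; rewrite mulr_sumr; apply: ler_sum => j _.
rewrite -(real_normK (num_real (a i))) -(real_normK (num_real (a j))).
have := sqr_ge0 (`|a i| - `|a j|); nra.
Qed.

End local_closure.

Section gradient_square.
Context {R : realType} {N : nat}.
Local Notation rV := 'rV[R]_N.
Implicit Types psi : rV -> R.

(** The squared Euclidean length of the gradient. *)
Definition grad_sqr psi x := \sum_i partial i psi x ^+ 2.

Lemma grad_sqr_ge0 psi x : 0 <= grad_sqr psi x.
Proof. by apply: sumr_ge0 => i _; exact: sqr_ge0. Qed.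

Lemma sum_partial_sqr_le psi x :
  (\sum_i `|partial i psi x|) ^+ 2 <= N%:R * grad_sqr psi x.
Proof. by have := sqr_sum_le (fun i => partial i psi x); rewrite card_ord. Qed.

Lemma measurable_grad_sqr psi : Cc 1 psi -> measurable_fun setT (grad_sqr psi).
Proof.
by move=> Cpsi; apply: measurable_sum => i; apply: measurable_funX; exact: (Cc1_partial_loc1 i Cpsi).1.
Qed.

Lemma grad_sqr_le psi r m x : vanish r psi -> (forall i x, `|partial i psi x| <= m) ->
  grad_sqr psi x <= N%:R * m ^+ 2 /\ (r < `|x| -> grad_sqr psi x = 0).
Proof.
move=> vp pm; split => [|xr].
  apply: (@le_trans _ _ (\sum_(i < N) m ^+ 2)); last first.
    by rewrite sumr_const card_ord -[leLHS]mulr_natl.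
  apply: ler_sum => i _; have m0 : 0 <= m by apply: le_trans (pm i x).
  by rewrite -[leLHS]real_normK ?num_real// lerXn2r ?nnegrE.
by rewrite /grad_sqr big1// => i _; rewrite (vanish_partial i vp xr) expr0n.
Qed.

End gradient_square.

(** * Decay of the weighted integrals on large cubes *)

Section decay.
Context {R : realType} {N : nat}.
Local Notation rV := 'rV[R]_N.
Local Notation mu := (lebesgue_rV R N).

Variables (c g : rV -> R) (K kappa A : R).
Hypotheses (mc : measurable_fun setT c) (mg : measurable_fun setT g).
Hypotheses (c0 : forall x, 0 < c x) (g0 : forall x, 0 < g x) (K0 : 0 < K)
  (kappa0 : 0 < kappa) (A0 : 0 <= A).
Hypothesis gc : forall x, g x ^+ 2 <= A * c x `^ kappa.
Hypothesis Nk : N%:R < 2 + 2 * kappa.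
Hypotheses (lcg : loc1 (fun x => c x * g x ^+ 2)) (lg : loc1 (fun x => g x ^+ 2)).
Hypothesis caccioppoli : forall t : R, 0 < t ->
  \int[mu]_x (c x * (g x * bumpN t x) ^+ 2) <=
  K * \int[mu]_x (g x ^+ 2 * grad_sqr (bumpN t) x).

Lemma grad_sqr_bumpN_le : exists2 C : R, 0 <= C & forall (t : R) (x : rV), 0 < t ->
  grad_sqr (bumpN t) x `^ (1 + kappa) <= C * t `^ (2 * (1 + kappa)) * (bumpN t x ^+ 2) `^ kappa
  /\ (bumpN t x = 0 -> grad_sqr (bumpN t) x = 0).
Proof.
pose s := (1 + kappa)^-1.
have k1 : 0 < 1 + kappa by rewrite addr_gt0.
have s01 : 0 < s < 1 by rewrite invr_gt0 k1 invf_lt1// ltrDl.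
have [C C0 HC] := @bumpN_partial_le R N s s01.
exists ((N%:R * C ^+ 2) `^ (1 + kappa)); first exact: powR_ge0.
move=> t x t0; set b := bumpN t x.
have b0 : 0 <= b := bumpN_ge0 t x.
have le : grad_sqr (bumpN t) x <= N%:R * C ^+ 2 * (t ^+ 2 * (b `^ (1 - s)) ^+ 2).
  apply: (@le_trans _ _ (\sum_(i < N) (t * C * b `^ (1 - s)) ^+ 2)).
    apply: ler_sum => i _; rewrite -[leLHS]real_normK ?num_real//.
    have tC : 0 <= t * C by rewrite mulr_ge0// ltW.
    by rewrite lerXn2r ?nnegrE ?HC// mulr_ge0 ?powR_ge0.
  rewrite sumr_const card_ord -[leLHS]mulr_natl.
  set B := b `^ (1 - s).
  have -> : N%:R * (t * C * B) ^+ 2 = N%:R * C ^+ 2 * (t ^+ 2 * B ^+ 2) by ring.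
  exact: lexx.
split.
  apply: le_trans (ge0_ler_powR (ltW k1) _ _ le) _.
  - by rewrite nnegrE grad_sqr_ge0.
  - by rewrite nnegrE; apply: le_trans le; exact: grad_sqr_ge0.
  have e1 : (t ^+ 2) `^ (1 + kappa) = t `^ (2 * (1 + kappa)).
    by rewrite -(powR_mulrn 2 (ltW t0)) -powRrM.
  have e2 : ((b `^ (1 - s)) ^+ 2) `^ (1 + kappa) = (b ^+ 2) `^ kappa.
    rewrite -(powR_mulrn 2 (powR_ge0 b (1 - s))) -(powR_mulrn 2 b0) -!powRrM.
    have -> // : (1 - s) * (2%:R * (1 + kappa)) = 2%:R * kappa.
    have sk : s * (1 + kappa) = 1 by rewrite mulVf// gt_eqF.
    by rewrite mulrCA mulrBl mul1r sk addrAC subrr add0r.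
  have B0 : 0 <= (b `^ (1 - s)) ^+ 2 by exact: sqr_ge0.
  have t20 : 0 <= t ^+ 2 by exact: sqr_ge0.
  have C20 : 0 <= N%:R * C ^+ 2 by rewrite mulr_ge0// sqr_ge0.
  by rewrite (powRM _ C20 (mulr_ge0 t20 B0)) (powRM _ t20 B0) e1 e2 mulrA.
move=> bx0; apply/eqP; rewrite eq_le grad_sqr_ge0 andbT.
move: le; rewrite bx0 powR0 ?expr0n/= ?mulr0//.
by rewrite subr_eq0 eq_sym lt_eqF// (andP s01).2.
Qed.

Lemma gradient_absorbed : exists2 D : R, 0 <= D & forall (t : R) (x : rV), 0 < t ->
  K * (g x ^+ 2 * grad_sqr (bumpN t) x) <=
  2^-1 * (c x * (g x * bumpN t x) ^+ 2) + D * t `^ (2 * (1 + kappa)) * ind (cube t^-1) x.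
Proof.
have [C C0 HC] := grad_sqr_bumpN_le.
have D0 : 0 <= K * A * (2 * K) `^ kappa * C.
  by rewrite mulr_ge0// mulr_ge0 ?powR_ge0// mulr_ge0// ltW.
exists (K * A * (2 * K) `^ kappa * C) => // t x t0.
have [Zb bZ] := HC t x t0; move: Zb bZ.
set Z := grad_sqr _ x; set b := bumpN t x; set tau := t `^ _ => Zb bZ.
have Z0 : 0 <= Z by exact: grad_sqr_ge0.
have tau0 : 0 <= tau by exact: powR_ge0.
have lhs0 : 0 <= 2^-1 * (c x * (g x * b) ^+ 2).
  by rewrite mulr_ge0// mulr_ge0 ?sqr_ge0// ltW.
have rhs0 : 0 <= K * A * (2 * K) `^ kappa * C * tau * ind (cube t^-1) x.
  by rewrite mulr_ge0 ?ind_ge0// mulr_ge0.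
have [b0|bn0] := eqVneq b 0; first by rewrite bZ// !mulr0 addr_ge0.
have bp : 0 < b by rewrite lt_def bn0 bumpN_ge0.
have b2 : 0 < b ^+ 2 by rewrite exprn_gt0.
have -> : ind (cube t^-1) x = 1.
  rewrite ind_cube; have [//|xt] := leP `|x| t^-1.
  by move: bn0; rewrite /b (bumpN_vanish t0 xt) eqxx.
rewrite mulr1; have [small|large] := leP (K * Z) (2^-1 * (c x * b ^+ 2)).
  apply: ler_wpDr; first by rewrite mulr_ge0.
  have := ler_wpM2l (sqr_ge0 (g x)) small; rewrite exprMn; lra.
apply: ler_wpDl => //.
have cle : c x <= 2 * K * Z / b ^+ 2 by rewrite ler_pdivlMr//; lra.
have cle' : c x `^ kappa <= (2 * K) `^ kappa * (Z `^ kappa / (b ^+ 2) `^ kappa).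
  have KK : 0 <= 2 * K by rewrite mulr_ge0// ltW.
  apply: le_trans (ge0_ler_powR (ltW kappa0) _ _ cle) _.
  - by rewrite nnegrE ltW.
  - by rewrite nnegrE divr_ge0 ?mulr_ge0// ltW.
  have b2' : 0 <= (b ^+ 2)^-1 by rewrite invr_ge0 ltW.
  have ib : ((b ^+ 2)^-1) `^ kappa = ((b ^+ 2) `^ kappa)^-1.
    by rewrite -(powR_inv1 (ltW b2)) -powRrM mulN1r powRN.
  by rewrite (powRM _ (mulr_ge0 KK Z0) b2') (powRM _ KK Z0) ib mulrA.
have bk0 : 0 < (b ^+ 2) `^ kappa by exact: powR_gt0.
have ZZ : Z * Z `^ kappa = Z `^ (1 + kappa).
  have k1 : 0 < 1 + kappa by rewrite addr_gt0.
  by rewrite -(mulr_powRB1 Z0 k1) addrAC subrr add0r.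
apply: (@le_trans _ _ (K * (A * ((2 * K) `^ kappa * (Z `^ kappa / (b ^+ 2) `^ kappa)) * Z))).
  apply: ler_wpM2l; first exact: ltW.
  by apply: ler_wpM2r => //; apply: le_trans (gc x) _; apply: ler_wpM2l.
have -> : K * (A * ((2 * K) `^ kappa * (Z `^ kappa / (b ^+ 2) `^ kappa)) * Z) =
  K * A * (2 * K) `^ kappa * (Z * Z `^ kappa / (b ^+ 2) `^ kappa) by ring.
rewrite -[leRHS]mulrA; apply: ler_wpM2l.
  by rewrite mulr_ge0 ?powR_ge0// mulr_ge0// ltW.
by rewrite ZZ ler_pdivrMr.
Qed.

Lemma decay : False.
Proof.
have [D D0 HD] := gradient_absorbed.
pose e := 2 * (1 + kappa) - N%:R.
have e0 : 0 < e by rewrite subr_gt0 mulrDr mulr1.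
pose J := \int[mu]_x (ind (cube 1) x * (c x * g x ^+ 2)).
have LJ : L1 mu (fun x => ind (cube 1) x * (c x * g x ^+ 2)) by exact: lcg.2.
have J0 : 0 < J.
  apply: (Rintegral_gt0 (r := 1)) LJ _ _ _ => //.
    by move=> x; rewrite mulr_ge0 ?ind_ge0// mulr_ge0 ?sqr_ge0// ltW.
  apply: aeW => x x1; rewrite ind_cube x1 mul1r mulr_gt0// exprn_gt0//.
pose beta : R := (bump (2^-1 : R) ^+ N) ^+ 2.
have beta0 : 0 < beta by rewrite !exprn_gt0// bump_gt0// gtr0_norm// invf_lt1// ltr1n.
have est t : 0 < t <= 2^-1 -> beta * J <= 2 * D * 2 ^+ N * t `^ e.
  move=> /andP[t0 t2]; have it0 : 0 <= t^-1 by rewrite invr_ge0 ltW.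
  have Cb : Cc 1 (bumpN (N := N) t) := bumpN_Cc_infty t0 1%N.
  have [r [m [r0 vb m0 bm dbm]]] := Cc1_bounds Cb.
  have mb : measurable_fun setT (bumpN (N := N) t) by exact: (Cc1_loc1 Cb).1.
  have LI : L1 mu (fun x => c x * (g x * bumpN t x) ^+ 2).
    apply: L1_eq (loc1M (M := m ^+ 2) (r := r) (f := fun x => bumpN t x ^+ 2) lcg _ _ (ltW r0) _).
    - by move=> x; rewrite exprMn [RHS]mulrA.
    - exact: measurable_funX.
    - by move=> x; rewrite normrX lerXn2r ?nnegrE.
    - by move=> x /vb ->; rewrite expr0n.
  have LZ : L1 mu (fun x => g x ^+ 2 * grad_sqr (bumpN t) x).
    apply: (loc1M (M := N%:R * m ^+ 2) (r := r)) => //.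
    - exact: measurable_grad_sqr.
    - by move=> x; rewrite ger0_norm ?grad_sqr_ge0//; have [] := grad_sqr_le x vb dbm.
    - exact: ltW.
    - by move=> x xr; have [_ ->] := grad_sqr_le x vb dbm.
  have Lc : L1 mu (ind (cube t^-1)) by exact: L1_ind_cube.
  set I := \int[mu]_x (c x * (g x * bumpN t x) ^+ 2).
  have JI : beta * J <= I.
    rewrite -RintegralZl//; apply: le_Rintegral => //; first exact: L1Z.
    move=> x _; rewrite ind_cube; have [x1|_] := leP `|x| 1; last first.
      by rewrite mul0r mulr0 mulr_ge0 ?sqr_ge0// ltW.
    rewrite mul1r exprMn mulrCA ler_pM2l// mulrC ler_pM2l ?exprn_gt0//.
    rewrite lerXn2r ?nnegrE ?bumpN_ge0 ?exprn_ge0 ?bump_ge0//.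
    by apply: bumpN_ge => //; apply: le_trans t2; rewrite -[leRHS]mulr1 ler_pM2l.
  have II : I <= 2^-1 * I + D * t `^ (2 * (1 + kappa)) * (2 * t^-1) ^+ N.
    apply: le_trans (caccioppoli t0) _; rewrite -RintegralZl//.
    have -> : (2 * t^-1) ^+ N = \int[mu]_x (ind (cube t^-1) x).
      rewrite /Rintegral /ind integral_indic//; last exact: measurable_cube.
      by rewrite setIT; have -> := congr1 fine (@mu_cube R N _ it0).
    rewrite -!RintegralZl// -(RintegralD measurableT (L1Z _ LI) (L1Z _ Lc)).
    apply: le_Rintegral => //; [exact: L1Z|by apply: L1D; exact: L1Z|].
    by move=> x _; exact: HD.
  apply: le_trans JI _.
  have -> : 2 * D * 2 ^+ N * t `^ e = 2 * (D * t `^ (2 * (1 + kappa)) * (2 * t^-1) ^+ N).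
    rewrite /e powRB; last by rewrite (gt_eqF t0) implybT.
    by rewrite powR_mulrn ?ltW// exprMn exprVn; ring.
  by lra.
pose M := 2 * D * 2 ^+ N + 1.
have M0 : 0 < M by rewrite /M ltr_wpDl// !mulr_ge0// exprn_ge0.
pose eta := beta * J / (2 * M).
have eta0 : 0 < eta by rewrite divr_gt0// mulr_gt0.
pose t := Num.min 2^-1 (eta `^ e^-1).
have t0 : 0 < t by rewrite lt_min invr_gt0 ltr0n powR_gt0.
have te : t `^ e <= eta.
  have tle : t <= eta `^ e^-1 by rewrite ge_min lexx orbT.
  apply: le_trans (ge0_ler_powR (ltW e0) _ _ tle) _; rewrite ?nnegrE ?powR_ge0 ?(ltW t0)//.
  by rewrite -powRrM mulVf ?gt_eqF// powRr1// ltW.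
have MM : 2 * D * 2 ^+ N <= M by rewrite lerDl.
have h : 2 * D * 2 ^+ N * t `^ e <= M * eta.
  by apply: ler_pM; rewrite ?powR_ge0 ?mulr_ge0 ?exprn_ge0.
have Meta : M * eta = beta * J / 2 by rewrite /eta; field; rewrite gt_eqF.
have tt : 0 < t <= 2^-1 by rewrite t0 ge_min lexx.
have bJ : 0 < beta * J by rewrite mulr_gt0.
have := le_trans (est t tt) h; rewrite Meta; lra.
Qed.

End decay.

(** * The Caccioppoli inequality *)

Section finsler_integrals.
Context {R : realType} {N : nat}.
Local Notation rV := 'rV[R]_N.
Local Notation mu := (lebesgue_rV R N).
Variable F : rV -> R.
Hypothesis hF : finsler_norm F.
Variables (u : rV -> R) (du : rV -> rV).
Hypotheses (lu : loc2 u) (ldu : forall i, loc2 (fun x => du x ord0 i))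
  (wu : weak_grad u du) (u0 : forall x, 0 < u x).
Variable f : R -> R.
Hypotheses (lf : loc1 (fun x => f (u x))) (lf' : loc1 (fun x => derive1 f (u x))).
Hypothesis weq : forall phi, Cc_infty phi ->
  (\int[mu]_x (F (du x) * dot (grad F (du x)) (grad phi x))%:E =
   \int[mu]_x (f (u x) * phi x)%:E)%E.

Hypothesis stab : forall phi, Cc 1 phi ->
  (0 <= \int[mu]_x (stability_integrand F f u du phi x)%:E)%E.
Variable C : R.
Hypotheses (C0 : 0 <= C) (F1C : forall i xi, `|partial i F xi| <= C)
  (F2C : forall i j xi, `|F xi * partial j (partial i F) xi| <= C).

Let mdu : measurable_fun setT du.
Proof. by apply/measurable_fun_rVP => i; exact: (ldu i).1. Qed.

Lemma measurable_finsler_comp (k : rV -> R) :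
  (forall xi, xi != 0 -> {for xi, continuous k}) ->
  measurable_fun setT (fun x => k (du x)).
Proof. by move=> kc; apply: measurableT_comp mdu; exact: measurable_punctured. Qed.

Definition Fdu x := F (du x).

Lemma measurable_Fdu : measurable_fun setT Fdu.
Proof.
apply: measurable_finsler_comp => xi xi0.
by apply: differentiable_continuous; exact: (finsler_diff hF).
Qed.

Lemma measurable_dFdu i : measurable_fun setT (fun x => partial i F (du x)).
Proof.
apply: (measurable_finsler_comp (k := partial i F)) => xi xi0.
by apply: differentiable_continuous; exact: (finsler_diff1 hF).
Qed.

Lemma measurable_d2Fdu i j :
  measurable_fun setT (fun x => F (du x) * partial j (partial i F) (du x)).
Proof.
apply: measurable_funM; first exact: measurable_Fdu.
apply: (measurable_finsler_comp (k := partial j (partial i F))) => xi xi0.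
exact: (finsler_cont2 hF).
Qed.

Lemma Fdu_ge0 x : 0 <= Fdu x.
Proof. exact: (finsler_ge0 hF). Qed.

Lemma loc2_Fdu : loc2 Fdu.
Proof.
apply: (@loc2_le _ _ _ (fun x => C * \sum_i `|du x ord0 i|)).
- exact: measurable_Fdu.
- move=> x; rewrite /Fdu -(euler1 hF (du x)).
  apply: le_trans (ler_norm_sum _ _ _) _; rewrite mulr_sumr; apply: ler_sum => i _.
  by rewrite normrM mulrC ler_wpM2r.
- by apply: loc2Z; apply: loc2_sum => i; exact: loc2_norm.
Qed.

(** The flux F F_xi (du). *)
Definition flux i x := Fdu x * partial i F (du x).

Lemma loc2_flux i : loc2 (flux i).
Proof.
apply: (@loc2_le _ _ _ (fun x => C * Fdu x)).
- by apply: measurable_funM; [exact: measurable_Fdu|exact: measurable_dFdu].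
- move=> x; rewrite normrM mulrC (ger0_norm (Fdu_ge0 x)).
  by rewrite ler_wpM2r ?Fdu_ge0.
- exact: loc2Z loc2_Fdu.
Qed.

Lemma weak_equation_C1 phi : Cc 1 phi ->
  \int[mu]_x (\sum_i flux i x * partial i phi x) = \int[mu]_x (f (u x) * phi x).
Proof.
move: phi; apply: weak_identity_C1 => //; first by move=> i; exact: loc2_loc1 (loc2_flux i).
move=> phi Cphi; rewrite /Rintegral -(weq Cphi); congr fine.
apply: eq_integral => x _; congr (_%:E).
rewrite /dot mulr_sumr; apply: eq_bigr => i _.
by rewrite /flux !mxE mulrA.
Qed.

(** The derivative of psi in the direction F_xi(du). *)
Definition flux_dir (psi : rV -> R) x := \sum_i partial i F (du x) * partial i psi x.

Lemma flux_dir_sqr_le psi x : flux_dir psi x ^+ 2 <= C ^+ 2 * N%:R * grad_sqr psi x.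
Proof.
rewrite -[leLHS]real_normK ?num_real//.
apply: (@le_trans _ _ ((C * \sum_i `|partial i psi x|) ^+ 2)).
  rewrite lerXn2r ?nnegrE ?mulr_ge0 ?sumr_ge0//.
  apply: le_trans (ler_norm_sum _ _ _) _; rewrite mulr_sumr; apply: ler_sum => i _.
  by rewrite normrM ler_wpM2r.
by rewrite exprMn -mulrA ler_wpM2l ?sqr_ge0// sum_partial_sqr_le.
Qed.

Lemma hessian_term_le psi x :
  \sum_i \sum_j F (du x) * partial j (partial i F) (du x) *
     (partial i psi x * partial j psi x) <= C * N%:R * grad_sqr psi x.
Proof.
apply: (@le_trans _ _ (C * (\sum_i `|partial i psi x|) ^+ 2)); last first.
  by rewrite -mulrA ler_wpM2l// sum_partial_sqr_le.
rewrite expr2 mulr_suml mulr_sumr; apply: ler_sum => i _.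
rewrite mulr_sumr mulr_sumr; apply: ler_sum => j _.
apply: le_trans (ler_norm _) _; rewrite normrM.
by apply: ler_pM => //; rewrite normrM.
Qed.

Definition quad i j x := partial i F (du x) * partial j F (du x)
  + F (du x) * partial j (partial i F) (du x).

Lemma measurable_quad i j : measurable_fun setT (quad i j).
Proof.
apply: measurable_funD; last exact: measurable_d2Fdu.
by apply: measurable_funM; exact: measurable_dFdu.
Qed.

Lemma quad_le i j x : `|quad i j x| <= C ^+ 2 + C.
Proof.
apply: le_trans (ler_normD _ _) _; apply: lerD; last exact: F2C.
by rewrite normrM expr2 ler_pM.
Qed.

Lemma stability_C1 phi : Cc 1 phi ->
  \int[mu]_x (derive1 f (u x) * phi x ^+ 2) <=
  \int[mu]_x (\sum_i \sum_j quad i j x * (partial i phi x * partial j phi x)).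
Proof.
move=> Cphi; have [r [m [r0 vp m0 pm dpm]]] := Cc1_bounds Cphi.
have Lp i : L2 mu (partial i phi).
  exact: (L2_of_vanish (Cc1_partial_loc1 i Cphi).1 (dpm i) (ltW r0) (vanish_partial i vp)).
have Lq i j : L1 mu (fun x => quad i j x * (partial i phi x * partial j phi x)).
  apply: L1_eq (L2M (L2Mb (measurable_quad i j) (quad_le i j) (Lp i)) (Lp j)) => x.
  by rewrite mulrA.
have LS : L1 mu (fun x => \sum_i \sum_j quad i j x * (partial i phi x * partial j phi x)).
  by apply: L1_sum => i; exact: L1_sum.
have Lc : L1 mu (fun x => derive1 f (u x) * phi x ^+ 2).
  apply: (loc1M (M := m ^+ 2) (r := r) lf').
  - by apply: measurable_funX; exact: (Cc1_loc1 Cphi).1.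
  - by move=> x; rewrite normrX lerXn2r ?nnegrE.
  - exact: ltW.
  - by move=> x /vp ->; rewrite expr0n.
rewrite -subr_ge0 -RintegralB// -lee_fin (EFin_Rintegral (L1B LS Lc)).
have := stab Cphi; congr (_ <= _)%E; apply: eq_integral => x _; congr (_%:E).
rewrite /stability_integrand; congr (_ - _).
rewrite -big_split/=; apply: eq_bigr => i _.
rewrite -big_split/=; apply: eq_bigr => j _.
rewrite /quad; move: (partial i phi x) (partial j phi x) => a b.
by rewrite mulrDl !mulrA.
Qed.

Lemma L2_loc2_bounded (v w : rV -> R) (M r : R) : loc2 v -> measurable_fun setT w ->
  (forall x, `|w x| <= M) -> 0 <= r -> vanish r w -> L2 mu (fun x => w x * v x).
Proof.
move=> lv mw wM r0 vw; have := L2Mb mw wM (lv.2 r r0).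
congr L2; apply/funext => x; rewrite [in RHS](vanish_ind x vw); ring.
Qed.

Section bounded_test.
Variables (G dG : R -> R) (M : R).
Hypotheses (GP : forall t : R, 0 < t -> is_derive t (1 : R) G (dG t))
  (cdG : forall t : R, 0 < t -> {for t, continuous dG})
  (GM : forall t : R, 0 < t -> `|G t| <= M) (dGM : forall t : R, 0 < t -> `|dG t| <= M).
Variable psi : rV -> R.
Hypothesis Cpsi : Cc 1 psi.

Local Notation E := (test_grad u du G dG psi).

Lemma Cc1_sqr : Cc 1 (fun x => psi x ^+ 2) /\
  forall i x, partial i (fun x => psi x ^+ 2) x = 2 * psi x * partial i psi x.
Proof.
have /class_C1P[dpsi cdpsi] := Cpsi.1.
have dp i x : partial i (fun x => psi x ^+ 2) x = 2 * psi x * partial i psi x.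
  by rewrite (partialM i (dpsi x) (dpsi x)); ring.
split => //; split.
  apply/class_C1P; split; first by move=> x; apply: differentiableM; exact: dpsi.
  move=> i; rewrite (funext (dp i)).
  apply: continuous_mul => //; apply: continuous_mul; first exact: cst_continuous.
  by move=> x; exact: differentiable_continuous.
have [r r0 vp] := compact_vanish Cpsi.2.
by apply: (vanish_compact (ltW r0)) => x /vp ->; rewrite expr0n.
Qed.

Lemma test_grad_radial x :
  \sum_i partial i F (du x) * E i x = dG (u x) * psi x * Fdu x + G (u x) * flux_dir psi x.
Proof.
rewrite /test_grad /flux_dir /Fdu -(euler1 hF (du x)) !mulr_sumr -big_split/=.
by apply: eq_bigr => i _; ring.
Qed.

(** Stability tested with G(u) psi.  By Euler's identities the second-order
    term only sees the gradient of psi. *)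
Lemma test_grad_hessian x :
  \sum_i \sum_j F (du x) * partial j (partial i F) (du x) * (E i x * E j x) =
  G (u x) ^+ 2 * \sum_i \sum_j F (du x) * partial j (partial i F) (du x) *
     (partial i psi x * partial j psi x).
Proof.
have [d0|d0] := eqVneq (du x) 0.
  rewrite d0 finsler0//; rewrite !big1 ?mulr0// => i _; rewrite big1// => j _;
    by rewrite !mul0r.
pose a := dG (u x) * psi x; pose b := G (u x).
pose q i j := F (du x) * partial j (partial i F) (du x).
have e1 i : \sum_j q i j * du x ord0 j = 0.
  transitivity (F (du x) * \sum_j du x ord0 j * partial j (partial i F) (du x)).
    by rewrite mulr_sumr; apply: eq_bigr => j _; rewrite /q; ring.
  by rewrite (euler2 hF i d0) mulr0.
have e2 j : \sum_i q i j * du x ord0 i = 0.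
  transitivity (F (du x) * \sum_i du x ord0 i * partial j (partial i F) (du x)).
    by rewrite mulr_sumr; apply: eq_bigr => i _; rewrite /q; ring.
  by rewrite (euler2' hF j d0) mulr0.
have expand : \sum_i \sum_j q i j * (E i x * E j x) =
   \sum_i a * E i x * \sum_j q i j * du x ord0 j
   + \sum_j a * b * partial j psi x * \sum_i q i j * du x ord0 i
   + b ^+ 2 * \sum_i \sum_j q i j * (partial i psi x * partial j psi x).
  rewrite mulr_sumr; under [X in _ = _ + X + _]eq_bigr do rewrite mulr_sumr.
  rewrite [X in _ = _ + X + _]exchange_big/= -!big_split/=; apply: eq_bigr => i _.
  rewrite !mulr_sumr -!big_split/=; apply: eq_bigr => j _.
  rewrite /test_grad -/a -/b; move: a b (q i j) (du x ord0 i) (du x ord0 j)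
    (partial i psi x) (partial j psi x) => a b z di dj pi pj; ring.
have z1 : \sum_i a * E i x * \sum_j q i j * du x ord0 j = 0.
  by apply: big1 => i _; rewrite e1 mulr0.
have z2 : \sum_j a * b * partial j psi x * \sum_i q i j * du x ord0 i = 0.
  by apply: big1 => j _; rewrite e2 mulr0.
have drop (X Y Z W : R) : W = X + Y + Z -> X = 0 -> Y = 0 -> W = Z.
  by move=> -> -> ->; rewrite !add0r.
exact: drop expand z1 z2.
Qed.

Lemma measurable_flux_dir : measurable_fun setT (flux_dir psi).
Proof.
apply: measurable_sum => i; apply: measurable_funM; first exact: measurable_dFdu.
exact: (Cc1_partial_loc1 i Cpsi).1.
Qed.

Let cG (t : R) : 0 < t -> {for t, continuous G}.
Proof. by move=> /GP /dfun_continuous. Qed.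

Let mGu : measurable_fun setT (fun x => G (u x)).
Proof. by apply: measurable_comp_gt0 => //; exact: lu.1. Qed.

Let mdGu : measurable_fun setT (fun x => dG (u x)).
Proof. by apply: measurable_comp_gt0 => //; exact: lu.1. Qed.

Definition stab_const := C ^+ 2 * N%:R + C * N%:R.

Lemma stability_tested (d : R) : 0 < d ->
  \int[mu]_x (derive1 f (u x) * (G (u x) * psi x) ^+ 2) <=
  \int[mu]_x ((1 + d) * (dG (u x) * psi x * Fdu x) ^+ 2
     + stab_const * (1 + d^-1) * (G (u x) ^+ 2 * grad_sqr psi x)).
Proof.
move=> d0; have [r [m [r0 vp m0 pm dpm]]] := Cc1_bounds Cpsi.
have M0 : 0 <= M by apply: le_trans (GM (@ltr01 R)).
apply: le_trans (quadratic_nonlinear lu ldu wu u0 GP cdG GM dGM Cpsi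
  measurable_quad quad_le lf' stability_C1) _.
apply: le_Rintegral => //.
- apply: L1_sum => i; apply: L1_sum => j.
  exact: (L1_quadratic_test_grad lu ldu u0 GP cdG GM dGM Cpsi i j (measurable_quad i j) (quad_le i j)).
- apply: L1D; apply: L1Z.
    have mw : measurable_fun setT (fun x => dG (u x) * psi x).
      by apply: measurable_funM => //; exact: (Cc1_loc1 Cpsi).1.
    have bw x : `|dG (u x) * psi x| <= M * m by rewrite normrM ler_pM// dGM.
    have vw : vanish r (fun x => dG (u x) * psi x) by move=> x /vp ->; rewrite mulr0.
    exact: (L2_loc2_bounded loc2_Fdu mw bw (ltW r0) vw).2.
  apply: (@L1_of_vanish _ _ _ (M ^+ 2 * (N%:R * m ^+ 2)) r).
  + by apply: measurable_funM; [exact: measurable_funX|exact: measurable_grad_sqr Cpsi].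
  + move=> x; rewrite normrM (ger0_norm (grad_sqr_ge0 _ _)) ler_pM ?grad_sqr_ge0//.
      by rewrite normrX lerXn2r ?nnegrE// GM.
    by have [] := grad_sqr_le x vp dpm.
  + exact: ltW.
  + by move=> x xr; have [_ ->] := grad_sqr_le x vp dpm; rewrite ?mulr0.
move=> x _.
have -> : \sum_i \sum_j quad i j x * (E i x * E j x) =
   (\sum_i partial i F (du x) * E i x) ^+ 2 +
   \sum_i \sum_j F (du x) * partial j (partial i F) (du x) * (E i x * E j x).
  rewrite expr2 mulr_suml -big_split/=; apply: eq_bigr => i _.
  rewrite mulr_sumr -big_split/=; apply: eq_bigr => j _.
  by rewrite /quad; move: (E i x) (E j x) => a b; ring.
rewrite test_grad_hessian test_grad_radial.
have h1 := flux_dir_sqr_le psi x; have h2 := hessian_term_le psi x.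
move: h1 h2; rewrite /stab_const.
set D := flux_dir psi x; set Z := grad_sqr psi x; set W := \sum_i _.
set A := dG (u x) * psi x * Fdu x; set B := G (u x) => h1 h2.
have hB : B ^+ 2 * W <= B ^+ 2 * (C * N%:R * Z) by rewrite ler_wpM2l ?sqr_ge0.
have hD : B ^+ 2 * D ^+ 2 <= B ^+ 2 * (C ^+ 2 * N%:R * Z) by rewrite ler_wpM2l ?sqr_ge0.
have hAB : (A + B * D) ^+ 2 <= (1 + d) * A ^+ 2 + (1 + d^-1) * (B ^+ 2 * D ^+ 2).
  have e : (1 + d) * A ^+ 2 + (1 + d^-1) * (B ^+ 2 * D ^+ 2) - (A + B * D) ^+ 2 =
      d^-1 * (d * A - B * D) ^+ 2 by field; rewrite gt_eqF.
  by rewrite -subr_ge0 e mulr_ge0 ?sqr_ge0// invr_ge0 ltW.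
have d'0 : 0 <= d^-1 by rewrite invr_ge0 ltW.
apply: le_trans (lerD hAB hB) _; rewrite -addrA lerD2l.
apply: le_trans (lerD (ler_wpM2l _ hD) (lexx _)) _; first by rewrite addr_ge0.
have Z0 : 0 <= B ^+ 2 * (C * N%:R * Z).
  by rewrite mulr_ge0 ?sqr_ge0// mulr_ge0 ?grad_sqr_ge0// mulr_ge0.
rewrite -subr_ge0.
have -> : (C ^+ 2 * N%:R + C * N%:R) * (1 + d^-1) * (B ^+ 2 * Z) -
   ((1 + d^-1) * (B ^+ 2 * (C ^+ 2 * N%:R * Z)) + B ^+ 2 * (C * N%:R * Z)) =
   d^-1 * (B ^+ 2 * (C * N%:R * Z)) by ring.
by rewrite mulr_ge0.
Qed.

(** The equation tested with G(u) psi^2. *)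
Lemma equation_tested :
  \int[mu]_x (dG (u x) * psi x ^+ 2 * Fdu x ^+ 2
     + 2 * G (u x) * psi x * Fdu x * flux_dir psi x) =
  \int[mu]_x (f (u x) * (G (u x) * psi x ^+ 2)).
Proof.
have [Cpsi2 dpsi2] := Cc1_sqr.
rewrite -(weak_identity_nonlinear lu ldu wu u0 GP cdG GM dGM Cpsi2 loc2_flux lf weak_equation_C1).
apply: eq_Rintegral => x _.
have -> : \sum_i flux i x * test_grad u du G dG (fun x => psi x ^+ 2) i x =
   Fdu x * (dG (u x) * psi x ^+ 2 * Fdu x + G (u x) * flux_dir (fun x => psi x ^+ 2) x).
  rewrite /test_grad /flux_dir /flux {3}/Fdu -(euler1 hF (du x)) !mulr_sumr -big_split/=.
  by rewrite mulr_sumr; apply: eq_bigr => i _; ring.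
have -> : flux_dir (fun x => psi x ^+ 2) x = 2 * psi x * flux_dir psi x.
  rewrite /flux_dir mulr_sumr; apply: eq_bigr => i _; rewrite dpsi2; ring.
by ring.
Qed.

End bounded_test.

Section linear_growth.
Variables (G dG : R -> R) (M : R).
Hypotheses (GP : forall t : R, 0 < t -> is_derive t (1 : R) G (dG t))
  (cdG : forall t : R, 0 < t -> {for t, continuous dG})
  (GM : forall t : R, 0 < t -> `|G t| <= M * (1 + t))
  (dGM : forall t : R, 0 < t -> `|dG t| <= M).
Variable psi : rV -> R.
Hypothesis Cpsi : Cc 1 psi.

Let mG : measurable_fun setT (fun x => G (u x)).
Proof.
by apply: measurable_comp_gt0 lu.1 u0 => t /GP /dfun_continuous.
Qed.

Let mdG : measurable_fun setT (fun x => dG (u x)).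
Proof. exact: measurable_comp_gt0 lu.1 u0. Qed.

Let mpsi : measurable_fun setT psi.
Proof. exact: (Cc1_loc1 Cpsi).1. Qed.

Let mD : measurable_fun setT (flux_dir psi).
Proof. exact: measurable_flux_dir. Qed.

Let mZ : measurable_fun setT (grad_sqr psi).
Proof. exact: measurable_grad_sqr. Qed.

Let mF : measurable_fun setT Fdu.
Proof. exact: measurable_Fdu. Qed.

Let M0 : 0 <= M.
Proof. by apply: le_trans (dGM (@ltr01 R)). Qed.

Let E1 x := (psi x * Fdu x) ^+ 2.
Let E2 x := (1 + u x) ^+ 2 * grad_sqr psi x.

Let E1_ge0 x : 0 <= E1 x.
Proof. exact: sqr_ge0. Qed.

Let E2_ge0 x : 0 <= E2 x.
Proof. by rewrite mulr_ge0 ?sqr_ge0// grad_sqr_ge0. Qed.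

Let L1_E1 : L1 mu E1.
Proof.
have [r [m [r0 vp m0 pm _]]] := Cc1_bounds Cpsi.
exact: (L2_loc2_bounded loc2_Fdu mpsi pm (ltW r0) vp).2.
Qed.

Let L1_E2 : L1 mu E2.
Proof.
have [r [m [r0 vp m0 pm dpm]]] := Cc1_bounds Cpsi.
have l1 : loc2 (fun x => 1 + u x).
  by apply: loc2D => //; exact: loc2_cst.
apply: (loc1M (M := N%:R * m ^+ 2) (r := r)) => //.
- exact: loc2M.
- by move=> x; rewrite ger0_norm ?grad_sqr_ge0//; have [] := grad_sqr_le x vp dpm.
- exact: ltW.
- by move=> x xr; have [_ ->] := grad_sqr_le x vp dpm.
Qed.

Let cross_le (y : R) x : `|y| <= M * (1 + u x) ->
  `|2 * y * psi x * Fdu x * flux_dir psi x| <= M * (E1 x + C ^+ 2 * N%:R * E2 x).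
Proof.
move=> yM; have hD := flux_dir_sqr_le psi x.
have u1 : 0 < 1 + u x by rewrite addr_gt0.
have -> : 2 * y * psi x * Fdu x * flux_dir psi x =
  y * (2 * (psi x * Fdu x) * flux_dir psi x) by ring.
rewrite normrM; set a := psi x * Fdu x; set D := flux_dir psi x.
apply: (@le_trans _ _ (M * ((1 + u x) * `|2 * a * D|))).
  by rewrite mulrA ler_wpM2r.
apply: ler_wpM2l => //; rewrite -(gtr0_norm u1) -normrM.
have : 0 <= (a - (1 + u x) * D) ^+ 2 by exact: sqr_ge0.
have : 0 <= (a + (1 + u x) * D) ^+ 2 by exact: sqr_ge0.
have : (1 + u x) ^+ 2 * D ^+ 2 <= (1 + u x) ^+ 2 * (C ^+ 2 * N%:R * grad_sqr psi x).
  by rewrite ler_wpM2l ?sqr_ge0.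
rewrite /E1 /E2 -/a.
have -> : (1 + u x) ^+ 2 * (C ^+ 2 * N%:R * grad_sqr psi x) =
  C ^+ 2 * N%:R * ((1 + u x) ^+ 2 * grad_sqr psi x) by ring.
set B := C ^+ 2 * _ * _ => hB h1 h2.
have -> : (1 + u x) * (2 * a * D) = 2 * (a * ((1 + u x) * D)) by ring.
rewrite ler_norml; apply/andP; split.
  move: h1 hB; rewrite sqrrD exprMn; lra.
move: h2 hB; rewrite sqrrB exprMn; lra.
Qed.

Lemma L1_square_term : L1 mu (fun x => (dG (u x) * psi x * Fdu x) ^+ 2).
Proof.
apply: L1_le (L1Z (M ^+ 2) L1_E1) => [|x].
  by apply: measurable_funX; do 2 apply: measurable_funM => //.
rewrite ger0_norm ?sqr_ge0// -mulrA exprMn ler_wpM2r ?sqr_ge0//.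
by rewrite -[leLHS]real_normK ?num_real// lerXn2r ?nnegrE ?dGM.
Qed.

Lemma L1_principal_term : L1 mu (fun x => dG (u x) * psi x ^+ 2 * Fdu x ^+ 2).
Proof.
apply: L1_le (L1Z M L1_E1) => [|x].
  by do 2 apply: measurable_funM => //; exact: measurable_funX.
by rewrite -mulrA -exprMn normrM (ger0_norm (sqr_ge0 _)) ler_wpM2r ?sqr_ge0 ?dGM.
Qed.

Lemma L1_gradient_term : L1 mu (fun x => G (u x) ^+ 2 * grad_sqr psi x).
Proof.
apply: L1_le (L1Z (M ^+ 2) L1_E2) => [|x].
  by apply: measurable_funM => //; exact: measurable_funX.
rewrite (ger0_norm (mulr_ge0 (sqr_ge0 _) (grad_sqr_ge0 _ _))) /E2 mulrA -exprMn.
rewrite ler_wpM2r ?grad_sqr_ge0// -[leLHS]real_normK ?num_real//.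
by rewrite lerXn2r ?nnegrE ?GM// mulr_ge0// addr_ge0// ltW.
Qed.

Lemma L1_cross_term : L1 mu (fun x => 2 * G (u x) * psi x * Fdu x * flux_dir psi x).
Proof.
apply: L1_le (L1Z M (L1D L1_E1 (L1Z (C ^+ 2 * N%:R) L1_E2))) => [|x].
  by do 3 apply: measurable_funM => //; apply: measurable_funM => //; exact: measurable_cst.
by apply: cross_le; exact: GM.
Qed.

Let Gn n := damped n G.
Let dGn n := damped' n G dG.

Let GnP n (t : R) : 0 < t -> is_derive t (1 : R) (Gn n) (dGn n t).
Proof. by move=> t0; exact: is_derive_damped (GP t0). Qed.

Let cdGn n (t : R) : 0 < t -> {for t, continuous (dGn n)}.
Proof.
by move=> t0; apply: damped'_continuous => //; [exact: dfun_continuous (GP t0)|exact: cdG].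
Qed.

Let GnM1 n (t : R) : 0 < t -> `|Gn n t| <= M * (1 + t).
Proof. by move=> t0; apply: le_trans (GM t0); exact: damped_le. Qed.

Let dGnM2 n (t : R) : 0 < t -> `|dGn n t| <= 2 * M.
Proof. by move=> t0; apply: damped'_le => //; [exact: GM|exact: dGM]. Qed.

Let GnM n (t : R) : 0 < t -> `|Gn n t| <= M * n.+1%:R + 2 * M.
Proof.
move=> t0; apply: ler_wpDr; first by rewrite mulr_ge0.
by apply: damped_bounded => //; exact: GM.
Qed.

Let dGnM n (t : R) : 0 < t -> `|dGn n t| <= M * n.+1%:R + 2 * M.
Proof. by move=> t0; apply: le_trans (dGnM2 n t0) _; rewrite lerDr mulr_ge0. Qed.

Let mGn n : measurable_fun setT (fun x => Gn n (u x)).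
Proof. by apply: measurable_comp_gt0 lu.1 u0 => t /(GnP n) /dfun_continuous. Qed.

Let mdGn n : measurable_fun setT (fun x => dGn n (u x)).
Proof. by apply: measurable_comp_gt0 lu.1 u0 => t; exact: cdGn. Qed.

Let equation_lhs_le (y z : R) x : `|z| <= 2 * M -> `|y| <= M * (1 + u x) ->
  `|z * psi x ^+ 2 * Fdu x ^+ 2 + 2 * y * psi x * Fdu x * flux_dir psi x|
  <= 2 * M * E1 x + M * (E1 x + C ^+ 2 * N%:R * E2 x).
Proof.
move=> zM yM; apply: le_trans (ler_normD _ _) _; apply: lerD; last exact: cross_le.
by rewrite -mulrA -exprMn normrM (ger0_norm (sqr_ge0 _)) ler_wpM2r ?sqr_ge0.
Qed.

(** Both tested identities pass to the limit in the damped functions, by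
    dominated convergence. *)
Lemma equation_linear : loc1 (fun x => f (u x) * G (u x)) ->
  \int[mu]_x (dG (u x) * psi x ^+ 2 * Fdu x ^+ 2
     + 2 * G (u x) * psi x * Fdu x * flux_dir psi x) =
  \int[mu]_x (f (u x) * (G (u x) * psi x ^+ 2)).
Proof.
move=> lfG; have [r [m [r0 vp m0 pm _]]] := Cc1_bounds Cpsi.
have LB : L1 mu (fun x => `|f (u x) * G (u x)| * psi x ^+ 2).
  have lfG' : loc1 (fun x => `|f (u x) * G (u x)|).
    exact: loc1_norm.
  apply: (loc1M (M := m ^+ 2) (r := r)) => //.
  - exact: measurable_funX.
  - by move=> x; rewrite normrX lerXn2r ?nnegrE.
  - exact: ltW.
  - by move=> x /vp ->; rewrite expr0n.
have [_ c1] : L1 mu (fun x => dG (u x) * psi x ^+ 2 * Fdu x ^+ 2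
     + 2 * G (u x) * psi x * Fdu x * flux_dir psi x) /\
  (fun n => \int[mu]_x (dGn n (u x) * psi x ^+ 2 * Fdu x ^+ 2
     + 2 * Gn n (u x) * psi x * Fdu x * flux_dir psi x)) @ \oo -->
  \int[mu]_x (dG (u x) * psi x ^+ 2 * Fdu x ^+ 2
     + 2 * G (u x) * psi x * Fdu x * flux_dir psi x).
  apply: (@Rdominated_cvg _ _ _ _ _ _ (fun x => 2 * M * E1 x + M * (E1 x + C ^+ 2 * N%:R * E2 x))).
  - move=> n; apply: measurable_funD.
      by do 2 apply: measurable_funM => //; exact: measurable_funX.
    by do 3 apply: measurable_funM => //; apply: measurable_funM => //; exact: measurable_cst.
  - apply: measurable_funD.
      by do 2 apply: measurable_funM => //; exact: measurable_funX.
    by do 3 apply: measurable_funM => //; apply: measurable_funM => //; exact: measurable_cst.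
  - apply: aeW => x; have h1 := @damped_cvg R G (u x); have h2 := @damped'_cvg R G dG (u x).
    apply: cvgD; first by do 2 (apply: cvgM; last exact: cvg_cst); exact: h2.
    by do 3 (apply: cvgM; last exact: cvg_cst); apply: cvgM; [exact: cvg_cst|exact: h1].
  - by apply: L1D; [exact: L1Z|apply: L1Z; apply: L1D => //; exact: L1Z].
  - by move=> n x; apply: equation_lhs_le; [exact: dGnM2|exact: GnM1].
have [_ c2] : L1 mu (fun x => f (u x) * (G (u x) * psi x ^+ 2)) /\
  (fun n => \int[mu]_x (f (u x) * (Gn n (u x) * psi x ^+ 2))) @ \oo -->
  \int[mu]_x (f (u x) * (G (u x) * psi x ^+ 2)).
  apply: (@Rdominated_cvg _ _ _ _ _ _ (fun x => `|f (u x) * G (u x)| * psi x ^+ 2)) => //.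
  - move=> n; apply: measurable_funM; first exact: lf.1.
    by apply: measurable_funM => //; exact: measurable_funX.
  - apply: measurable_funM; first exact: lf.1.
    by apply: measurable_funM => //; exact: measurable_funX.
  - apply: aeW => x; apply: cvgM; first exact: cvg_cst.
    by apply: cvgM; [exact: (@damped_cvg R G (u x))|exact: cvg_cst].
  - move=> n x; rewrite mulrA normrM (ger0_norm (sqr_ge0 (psi x))) ler_wpM2r ?sqr_ge0//.
    rewrite [X in X <= _]normrM [X in _ <= X]normrM.
    by apply: ler_wpM2l => //; exact: damped_le.
have eqn n := equation_tested (@GnP n) (@cdGn n) (@GnM n) (@dGnM n) Cpsi.
by rewrite (funext eqn) in c1; exact: cvg_unique c1 c2.
Qed.

Lemma stability_linear (d : R) : loc1 (fun x => derive1 f (u x) * G (u x) ^+ 2) -> 0 < d ->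
  \int[mu]_x (derive1 f (u x) * (G (u x) * psi x) ^+ 2) <=
  \int[mu]_x ((1 + d) * (dG (u x) * psi x * Fdu x) ^+ 2
     + stab_const * (1 + d^-1) * (G (u x) ^+ 2 * grad_sqr psi x)).
Proof.
move=> lfG d0; have [r [m [r0 vp m0 pm _]]] := Cc1_bounds Cpsi.
have LY : L1 mu (fun x => `|derive1 f (u x) * G (u x) ^+ 2| * psi x ^+ 2).
  have lfG' : loc1 (fun x => `|derive1 f (u x) * G (u x) ^+ 2|).
    exact: loc1_norm.
  apply: (loc1M (M := m ^+ 2) (r := r)) => //.
  - exact: measurable_funX.
  - by move=> x; rewrite normrX lerXn2r ?nnegrE.
  - exact: ltW.
  - by move=> x /vp ->; rewrite expr0n.
have K0 : 0 <= stab_const * (1 + d^-1).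
  rewrite /stab_const -mulrDl; apply: mulr_ge0; last by rewrite addr_ge0// invr_ge0 ltW.
  by rewrite mulr_ge0// addr_ge0 ?sqr_ge0.
have [_ c1] : L1 mu (fun x => derive1 f (u x) * (G (u x) * psi x) ^+ 2) /\
  (fun n => \int[mu]_x (derive1 f (u x) * (Gn n (u x) * psi x) ^+ 2)) @ \oo -->
  \int[mu]_x (derive1 f (u x) * (G (u x) * psi x) ^+ 2).
  apply: (@Rdominated_cvg _ _ _ _ _ _
     (fun x => `|derive1 f (u x) * G (u x) ^+ 2| * psi x ^+ 2)) => //.
  - move=> n; apply: measurable_funM; first exact: lf'.1.
    by apply: measurable_funX; exact: measurable_funM.
  - apply: measurable_funM; first exact: lf'.1.
    by apply: measurable_funX; exact: measurable_funM.
  - apply: aeW => x; apply: cvgM; first exact: cvg_cst.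
    by apply: cvg_sqr; apply: cvgM; [exact: (@damped_cvg R G (u x))|exact: cvg_cst].
  - move=> n x; rewrite exprMn mulrA normrM (ger0_norm (sqr_ge0 (psi x))) ler_wpM2r ?sqr_ge0//.
    rewrite [X in X <= _]normrM [X in _ <= X]normrM 2!normrX.
    by apply: ler_wpM2l => //; rewrite lerXn2r ?nnegrE//; exact: damped_le.
have [_ c2] : L1 mu (fun x => (1 + d) * (dG (u x) * psi x * Fdu x) ^+ 2
     + stab_const * (1 + d^-1) * (G (u x) ^+ 2 * grad_sqr psi x)) /\
  (fun n => \int[mu]_x ((1 + d) * (dGn n (u x) * psi x * Fdu x) ^+ 2
     + stab_const * (1 + d^-1) * (Gn n (u x) ^+ 2 * grad_sqr psi x))) @ \oo -->
  \int[mu]_x ((1 + d) * (dG (u x) * psi x * Fdu x) ^+ 2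
     + stab_const * (1 + d^-1) * (G (u x) ^+ 2 * grad_sqr psi x)).
  apply: (@Rdominated_cvg _ _ _ _ _ _ (fun x => (1 + d) * ((2 * M) ^+ 2 * E1 x)
      + stab_const * (1 + d^-1) * (M ^+ 2 * E2 x))).
  - move=> n; apply: measurable_funD; apply: measurable_funM; try exact: measurable_cst.
      by apply: measurable_funX; do 2 apply: measurable_funM => //.
    by apply: measurable_funM => //; exact: measurable_funX.
  - apply: measurable_funD; apply: measurable_funM; try exact: measurable_cst.
      by apply: measurable_funX; do 2 apply: measurable_funM => //.
    by apply: measurable_funM => //; exact: measurable_funX.
  - apply: aeW => x; have h1 := @damped_cvg R G (u x); have h2 := @damped'_cvg R G dG (u x).
    apply: cvgD; (apply: cvgM; first exact: cvg_cst).
      by apply: cvg_sqr; do 2 (apply: cvgM; last exact: cvg_cst); exact: h2.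
    by apply: cvgM; [exact: cvg_sqr|exact: cvg_cst].
  - by apply: L1D; do 2 apply: L1Z.
  - have d1 : 0 <= 1 + d by rewrite addr_ge0// ltW.
    move=> n x; rewrite ger0_norm; last first.
      apply: addr_ge0; first exact: mulr_ge0 (sqr_ge0 _).
      by apply: mulr_ge0 => //; exact: mulr_ge0 (sqr_ge0 _) (grad_sqr_ge0 _ _).
    apply: lerD; apply: ler_wpM2l => //.
      rewrite -mulrA exprMn ler_wpM2r ?sqr_ge0//.
      by rewrite -[leLHS]real_normK ?num_real// lerXn2r ?nnegrE ?dGnM2// mulr_ge0.
    rewrite /E2 mulrA -exprMn ler_wpM2r ?grad_sqr_ge0// -[leLHS]real_normK ?num_real//.
    by rewrite lerXn2r ?nnegrE ?GnM1// mulr_ge0// addr_ge0// ltW.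
apply: (ler_cvg_to c1 c2); apply: nearW => n.
exact: (stability_tested (@GnP n) (@cdGn n) (@GnM n) (@dGnM n) Cpsi d0).
Qed.

(** When f G is nonnegative the left side of the tested equation bounds the
    right side, whose integrability is thus gained rather than assumed. *)
Lemma L1_of_equation : (forall t, 0 < t -> 0 <= f t * G t) ->
  L1 mu (fun x => f (u x) * G (u x) * psi x ^+ 2).
Proof.
move=> fG0; have [r [m [r0 vp m0 pm _]]] := Cc1_bounds Cpsi.
have rearrange n x : f (u x) * (Gn n (u x) * psi x ^+ 2) =
  f (u x) * G (u x) * psi x ^+ 2 * damp n (u x) by rewrite /Gn /damped; ring.
have Ln n : L1 mu (fun x => f (u x) * (Gn n (u x) * psi x ^+ 2)).
  apply: (loc1M (M := (M * n.+1%:R + 2 * M) * m ^+ 2) (r := r)) => //.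
  - by apply: measurable_funM => //; exact: measurable_funX.
  - by move=> x; rewrite normrM ler_pM// ?GnM// normrX lerXn2r ?nnegrE.
  - exact: ltW.
  - by move=> x /vp ->; rewrite expr0n mulr0.
apply: (@L1_bounded_monotone _ _ _ _ (fun n x => f (u x) * (Gn n (u x) * psi x ^+ 2)) _
  (\int[mu]_x (2 * M * E1 x + M * (E1 x + C ^+ 2 * N%:R * E2 x)))) => //.
- apply: measurable_funM; last exact: measurable_funX.
  by apply: measurable_funM => //; exact: lf.1.
- move=> n x; rewrite rearrange mulr_ge0 ?(ltW (damp_gt0 _ _))//.
  by rewrite mulr_ge0 ?sqr_ge0 ?fG0.
- move=> x n k nk; rewrite !rearrange; apply: ler_wpM2l.
    by rewrite mulr_ge0 ?sqr_ge0 ?fG0.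
  exact: damp_homo.
- move=> x; have := @damped_cvg R G (u x) => h.
  rewrite -mulrA; apply: cvgM; first exact: cvg_cst.
  by apply: cvgM; [exact: h|exact: cvg_cst].
- move=> n; rewrite -(equation_tested (@GnP n) (@cdGn n) (@GnM n) (@dGnM n) Cpsi).
  have LD : L1 mu (fun x => 2 * M * E1 x + M * (E1 x + C ^+ 2 * N%:R * E2 x)).
    by apply: L1D; [exact: L1Z|apply: L1Z; apply: L1D => //; exact: L1Z].
  have le x := equation_lhs_le (dGnM2 n (u0 x)) (GnM1 n (u0 x)).
  apply: le_Rintegral => //.
    apply: L1_le LD => //; apply: measurable_funD.
      by do 2 apply: measurable_funM => //; exact: measurable_funX.
    by do 3 apply: measurable_funM => //; apply: measurable_funM => //; exact: measurable_cst.
  by move=> x _; apply: le_trans (ler_norm _) (le x).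
Qed.

End linear_growth.

Lemma norm_le_amgm (X P Q e : R) : 0 < e -> 0 <= P -> 0 <= Q -> X ^+ 2 <= 4 * (P * Q) ->
  `|X| <= e * P + Q / e.
Proof.
move=> e0 P0 Q0 XPQ; have s0 : 0 <= e * P + Q / e.
  by rewrite addr_ge0 ?mulr_ge0 ?invr_ge0 ?(ltW e0).
rewrite -(@ler_pXn2r _ 2) ?nnegrE// real_normK ?num_real//.
apply: le_trans XPQ _; rewrite -subr_ge0.
have -> : (e * P + Q / e) ^+ 2 - 4 * (P * Q) = (e * P - Q / e) ^+ 2.
  by field; rewrite gt_eqF.
exact: sqr_ge0.
Qed.

(** The Caccioppoli inequality: G is the multiplier in the stability
    inequality, H the one in the equation. *)
Lemma caccioppoli (theta L M : R) (G dG H dH : R -> R) :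
  0 <= theta < 1 -> 0 <= L ->
  (forall t : R, 0 < t -> is_derive t (1 : R) G (dG t)) ->
  (forall t : R, 0 < t -> is_derive t (1 : R) H (dH t)) ->
  (forall t : R, 0 < t -> {for t, continuous dG}) ->
  (forall t : R, 0 < t -> {for t, continuous dH}) ->
  (forall t : R, 0 < t -> `|G t| <= M * (1 + t)) -> (forall t : R, 0 < t -> `|dG t| <= M) ->
  (forall t : R, 0 < t -> `|H t| <= M * (1 + t)) -> (forall t : R, 0 < t -> `|dH t| <= M) ->
  (forall t : R, 0 < t -> dG t ^+ 2 <= dH t) ->
  (forall t : R, 0 < t -> H t ^+ 2 <= L * (dH t * G t ^+ 2)) ->
  (forall t : R, 0 < t -> f t * H t <= theta * (derive1 f t * G t ^+ 2)) ->
  loc1 (fun x => derive1 f (u x) * G (u x) ^+ 2) -> loc1 (fun x => f (u x) * H (u x)) ->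
  exists2 K, 0 < K & forall psi, Cc 1 psi ->
    \int[mu]_x (derive1 f (u x) * (G (u x) * psi x) ^+ 2) <=
    K * \int[mu]_x (G (u x) ^+ 2 * grad_sqr psi x).
Proof.
move=> theta01 L0 GP HP cdG cdH GM dGM HM dHM dGH HG fH lfG lfH.
pose e := (1 - theta) / (2 * (1 + theta)).
pose l := L * (C ^+ 2 * N%:R).
have [th0 th1] := andP theta01.
have e0 : 0 < e by rewrite divr_gt0 ?subr_gt0// mulr_gt0// ltr_pwDl.
have e1 : e <= 1 by rewrite /e ler_pdivrMr ?mulr_gt0 ?ltr_pwDl//; lra.
have l0 : 0 <= l by rewrite /l !mulr_ge0 ?sqr_ge0.
have S0 : 0 <= stab_const by rewrite /stab_const -mulrDl mulr_ge0// addr_ge0 ?sqr_ge0.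
pose K := 2 / (1 - theta) * ((1 + e) * (l / e) + (1 - e) * (stab_const * (1 + e^-1))).
have K0 : 0 <= K.
  have ie0 : 0 <= e^-1 by rewrite invr_ge0 ltW.
  have h1 : 0 <= (1 + e) * (l / e).
    by apply: mulr_ge0; [rewrite addr_ge0// ltW|exact: mulr_ge0].
  have h2 : 0 <= stab_const * (1 + e^-1) by apply: mulr_ge0 => //; rewrite addr_ge0.
  have h3 : 0 <= 2 / (1 - theta) by rewrite divr_ge0 ?subr_ge0 ?(ltW th1).
  by apply: mulr_ge0 => //; apply: addr_ge0 => //; rewrite mulr_ge0 ?subr_ge0.
exists (K + 1); first by rewrite ltr_wpDl.
move=> psi Cpsi; have [r [m [r0 vp m0 pm _]]] := Cc1_bounds Cpsi.
have mpsi2 : measurable_fun setT (fun x => psi x ^+ 2).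
  by apply: measurable_funX; exact: (Cc1_loc1 Cpsi).1.
have pm2 x : `|psi x ^+ 2| <= m ^+ 2 by rewrite normrX lerXn2r ?nnegrE.
have vp2 : vanish r (fun x => psi x ^+ 2) by move=> x /vp ->; rewrite expr0n.
have LY : L1 mu (fun x => derive1 f (u x) * (G (u x) * psi x) ^+ 2).
  by apply: L1_eq (loc1M lfG mpsi2 pm2 (ltW r0) vp2) => x; rewrite exprMn [RHS]mulrA.
have LB : L1 mu (fun x => f (u x) * (H (u x) * psi x ^+ 2)).
  by apply: L1_eq (loc1M lfH mpsi2 pm2 (ltW r0) vp2) => x; rewrite [RHS]mulrA.
have LZ := L1_gradient_term GP GM dGM Cpsi.
have le := absorption theta01 S0 l0 LY (L1_principal_term cdH dHM Cpsi)
  (L1_square_term cdG dGM Cpsi) LZ (L1_cross_term HP HM dHM Cpsi) LB.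
have Z0 x : 0 <= G (u x) ^+ 2 * grad_sqr psi x.
  exact: mulr_ge0 (sqr_ge0 _) (grad_sqr_ge0 _ _).
apply: (@le_trans _ _ (K * \int[mu]_x (G (u x) ^+ 2 * grad_sqr psi x))); last first.
  by apply: ler_wpM2r; [exact: Rintegral_ge0|rewrite lerDl].
apply: le => //.
- move=> x; rewrite -[leRHS]mulrA.
  have -> : (dG (u x) * psi x * Fdu x) ^+ 2 = dG (u x) ^+ 2 * (psi x ^+ 2 * Fdu x ^+ 2) by ring.
  by apply: ler_wpM2r; [exact: mulr_ge0 (sqr_ge0 _) (sqr_ge0 _)|exact: dGH].
- move=> d x d0; rewrite [l / d * _]mulrAC; apply: norm_le_amgm => //.
  + rewrite mulr_ge0 ?sqr_ge0// mulr_ge0 ?sqr_ge0//.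
    by apply: le_trans (dGH _ (u0 x)); exact: sqr_ge0.
  + exact: mulr_ge0.
  + have hD := flux_dir_sqr_le psi x; have hH := HG _ (u0 x).
    have -> : (2 * H (u x) * psi x * Fdu x * flux_dir psi x) ^+ 2 =
      4 * ((psi x * Fdu x) ^+ 2 * (H (u x) ^+ 2 * flux_dir psi x ^+ 2)) by ring.
    have -> : dH (u x) * psi x ^+ 2 * Fdu x ^+ 2 * (l * (G (u x) ^+ 2 * grad_sqr psi x)) =
      (psi x * Fdu x) ^+ 2 * ((L * (dH (u x) * G (u x) ^+ 2)) *
         (C ^+ 2 * N%:R * grad_sqr psi x)) by rewrite /l; ring.
    rewrite ler_pM2l// ler_wpM2l ?sqr_ge0// ler_pM ?sqr_ge0//.
- move=> x; rewrite mulrA.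
  have -> : theta * (derive1 f (u x) * (G (u x) * psi x) ^+ 2) =
    theta * (derive1 f (u x) * G (u x) ^+ 2) * psi x ^+ 2 by ring.
  by apply: ler_wpM2r; [exact: sqr_ge0|exact: fH].
- by move=> d d0; exact: (stability_linear GP cdG GM dGM Cpsi lfG d0).
- exact: (equation_linear HP cdH HM dHM Cpsi lfH).
Qed.

Lemma loc1_of_equation (M : R) (G dG : R -> R) :
  (forall t : R, 0 < t -> is_derive t (1 : R) G (dG t)) ->
  (forall t : R, 0 < t -> {for t, continuous dG}) ->
  (forall t : R, 0 < t -> `|G t| <= M * (1 + t)) -> (forall t : R, 0 < t -> `|dG t| <= M) ->
  (forall t : R, 0 < t -> 0 <= f t * G t) ->
  loc1 (fun x => f (u x) * G (u x)).
Proof.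
move=> GP cdG GM dGM fG0; have mfG : measurable_fun setT (fun x => f (u x) * G (u x)).
  apply: measurable_funM; first exact: lf.1.
  by apply: measurable_comp_gt0 lu.1 u0 => t /GP /dfun_continuous.
split => // r r0; pose t : R := (2 * (r + 1))^-1.
have r1 : 0 < r + 1 by rewrite ltr_wpDl.
have t0 : 0 < t by rewrite invr_gt0 mulr_gt0.
have L := L1_of_equation GP cdG GM dGM (bumpN_Cc_infty t0 1%N) fG0.
pose b : R := bump 2^-1 ^+ N.
have b0 : 0 < b by rewrite exprn_gt0// bump_gt0// gtr0_norm ?invr_gt0// invf_lt1// ltr1n.
apply: L1_le (L1Z (b ^- 2) L) => [|x].
  by apply: measurable_funM => //; apply: measurable_ind; exact: measurable_cube.
rewrite ger0_norm; last by rewrite mulr_ge0 ?ind_ge0 ?fG0.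
have fGx := fG0 _ (u0 x).
rewrite ind_cube; have [xr|_] := leP `|x| r; last first.
  rewrite mul0r; apply: mulr_ge0; first by rewrite invr_ge0 exprn_ge0// ltW.
  by rewrite mulr_ge0// sqr_ge0.
rewrite mul1r mulrCA -[leLHS]mulr1; apply: ler_wpM2l => //.
have b20 : 0 < b ^+ 2 by exact: exprn_gt0.
rewrite ler_pdivlMl// mulr1; rewrite lerXn2r// ?nnegrE ?bumpN_ge0 ?(ltW b0)//.
apply: bumpN_ge => //; rewrite /t invfM -mulrA ger_pMr ?invr_gt0//.
by rewrite ler_pdivrMl// mulr1 (le_trans xr)// lerDl.
Qed.

(** Multipliers for which the Caccioppoli inequality holds exclude a solution
    once G^2 grows no faster than a power kappa of f' exceeding (N - 2) / 2. *)
Lemma nonexistence (theta L M kappa A : R) (G dG H dH : R -> R) :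
  0 <= theta < 1 -> 0 <= L ->
  (forall t : R, 0 < t -> is_derive t (1 : R) G (dG t)) ->
  (forall t : R, 0 < t -> is_derive t (1 : R) H (dH t)) ->
  (forall t : R, 0 < t -> {for t, continuous dG}) ->
  (forall t : R, 0 < t -> {for t, continuous dH}) ->
  (forall t : R, 0 < t -> `|G t| <= M * (1 + t)) -> (forall t : R, 0 < t -> `|dG t| <= M) ->
  (forall t : R, 0 < t -> `|H t| <= M * (1 + t)) -> (forall t : R, 0 < t -> `|dH t| <= M) ->
  (forall t : R, 0 < t -> dG t ^+ 2 <= dH t) ->
  (forall t : R, 0 < t -> H t ^+ 2 <= L * (dH t * G t ^+ 2)) ->
  (forall t : R, 0 < t -> f t * H t <= theta * (derive1 f t * G t ^+ 2)) ->
  loc1 (fun x => derive1 f (u x) * G (u x) ^+ 2) -> loc1 (fun x => f (u x) * H (u x)) ->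
  0 < kappa -> 0 <= A -> N%:R < 2 + 2 * kappa ->
  (forall t : R, 0 < t -> 0 < derive1 f t) -> (forall t : R, 0 < t -> 0 < G t) ->
  (forall t : R, 0 < t -> G t ^+ 2 <= A * derive1 f t `^ kappa) -> False.
Proof.
move=> theta01 L0 GP HP cdG cdH GM dGM HM dHM dGH HG fH lfG lfH kappa0 A0 Nk f'0 G0 Gf'.
have [K K0 HK] := caccioppoli theta01 L0 GP HP cdG cdH GM dGM HM dHM dGH HG fH lfG lfH.
have mG : measurable_fun setT (fun x => G (u x)).
  by apply: measurable_comp_gt0 lu.1 u0 => t /GP /dfun_continuous.
have lG : loc1 (fun x => G (u x) ^+ 2).
  have l1 : loc2 (fun x => M * (1 + u x)).
    by apply: loc2Z; apply: loc2D => //; exact: loc2_cst.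
  have l2 : loc2 (fun x => G (u x)) by apply: loc2_le l1 => // x; exact: GM.
  exact: (loc2M l2 l2).
apply: (@decay R N (fun x => derive1 f (u x)) (fun x => G (u x)) K kappa A) => //.
- by move=> x; exact: f'0.
- by move=> x; exact: G0.
- by move=> x; exact: Gf'.
- by move=> t t0; apply: HK; exact: bumpN_Cc_infty t0 1%N.
Qed.
End finsler_integrals.

(** * The two nonlinearities *)

Section powers.
Context {R : realType}.
Implicit Types (p g t : R).

Lemma is_derive_powR p t : 0 < t ->
  is_derive t (1 : R) (fun y => y `^ p) (p * t `^ (p - 1)).
Proof.
by move=> t0; apply: (is_derive_eq1 (dfun_powR p t0 (dfun_id t))); rewrite mulr1.
Qed.

Lemma derive1_powR p t : 0 < t -> derive1 (fun y => y `^ p) t = p * t `^ (p - 1).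
Proof. by move=> t0; rewrite derive1E; have [_ ->] := is_derive_powR p t0. Qed.

Lemma derive1_NpowRN p t : 0 < t ->
  derive1 (fun y => - y `^ (- p)) t = p * t `^ (- p - 1).
Proof.
move=> t0; rewrite derive1E; have [_ ->] := dfunN (is_derive_powR (- p) t0).
by rewrite mulNr opprK.
Qed.

Lemma powR_divr p t : 0 < t -> t `^ (p - 1) = t `^ p / t.
Proof.
move=> t0; rewrite powRB; last by rewrite (gt_eqF t0) implybT.
by rewrite powRr1 ?ltW.
Qed.

Lemma inv_powR_mul p k t : 0 < p -> 0 <= t -> p `^ (- k) * (p * t) `^ k = t `^ k.
Proof.
move=> p0 t0; rewrite powRM ?(ltW p0)// mulrA powRN mulVf ?mul1r//.
by rewrite gt_eqF// powR_gt0.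
Qed.

(** The multiplier behaves like (t + 1)^-g and not like the singular t^-g. *)
Definition mult_neg g t : R := (t + 1) `^ (- g).
Definition mult_neg' g t : R := - g * (mult_neg g t / (t + 1)).

(** Both t^g near 0 and linear at infinity. *)
Definition mult_pos g t : R := t * (t / (t + 1)) `^ (g - 1).
Definition log_slope g t : R := 1 + (g - 1) / (t + 1).
Definition mult_pos' g t : R := log_slope g t * (mult_pos g t / t).

Lemma is_derive_mult_neg g t : 0 < t ->
  is_derive t (1 : R) (mult_neg g) (mult_neg' g t).
Proof.
move=> t0; have s0 : 0 < t + 1 by rewrite addr_gt0.
apply: (is_derive_eq1 (dfun_powR (f := fun y => y + 1) (- g) s0 (dfunD (dfun_id t) (dfun_cst 1 t)))).
by rewrite powR_divr// addr0 mulr1.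
Qed.

Lemma is_derive_inv_succ t : 0 < t ->
  is_derive t (1 : R) (fun y => (y + 1)^-1) (- ((t + 1) ^- 2)).
Proof.
move=> t0; have s0 : t + 1 != 0 by rewrite gt_eqF// addr_gt0.
apply: (is_derive_eq1 (dfunV (f := fun y => y + 1) s0 (dfunD (dfun_id t) (dfun_cst 1 t)))).
by rewrite addr0 mul1r.
Qed.

Lemma is_derive_inv t : 0 < t -> is_derive t (1 : R) (fun y => y^-1) (- (t ^- 2)).
Proof.
move=> t0; have n0 : t != 0 by rewrite gt_eqF.
by apply: (is_derive_eq1 (dfunV (f := id) n0 (dfun_id t))); rewrite mul1r.
Qed.

Lemma is_derive_mult_pos g t : 0 < t ->
  is_derive t (1 : R) (mult_pos g) (mult_pos' g t).
Proof.
move=> t0; have s0 : 0 < t + 1 by rewrite addr_gt0.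
have q0 : 0 < t / (t + 1) by rewrite divr_gt0.
have dq := dfunM (dfun_id t) (is_derive_inv_succ t0).
apply: (is_derive_eq1 (dfunM (dfun_id t) (dfun_powR (f := fun y => y / (y + 1)) (g - 1) q0 dq))).
rewrite powR_divr// /mult_pos' /log_slope /mult_pos.
set P := (t / (t + 1)) `^ (g - 1); field.
by rewrite !gt_eqF.
Qed.

Lemma mult_pos_bounds g t : 1 <= g -> 0 < t ->
  [/\ 0 < mult_pos g t, mult_pos g t <= t, mult_pos g t <= t `^ g &
      1 <= log_slope g t <= g].
Proof.
move=> g1 t0; have s0 : 0 < t + 1 by rewrite addr_gt0.
have q0 : 0 < t / (t + 1) by rewrite divr_gt0.
have gm : 0 <= g - 1 by rewrite subr_ge0.
split.
- by rewrite mulr_gt0// powR_gt0.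
- rewrite /mult_pos ger_pMr// -[leRHS](powRr0 (t / (t + 1))).
  have q1 : 0 < t / (t + 1) <= 1 by rewrite q0/= ler_pdivrMr// mul1r lerDl ler01.
  exact: (ger_powR q1 gm).
- have -> : t `^ g = t * t `^ (g - 1).
    by rewrite mulr_powRB1 ?(ltW t0)// (lt_le_trans ltr01).
  rewrite ler_pM2l//; apply: ge0_ler_powR; rewrite ?nnegrE ?(ltW q0) ?(ltW t0)//.
  by rewrite ler_pdivrMr// ler_pMr// lerDr ltW.
- rewrite /log_slope lerDl divr_ge0 ?(ltW s0)//= -lerBrDl ler_pdivrMr//.
  by rewrite mulrDr mulr1 lerDr mulr_ge0 ?(ltW t0).
Qed.

End powers.

Section cases.
Context {R : realType} {N : nat}.
Local Notation rV := 'rV[R]_N.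
Local Notation mu := (lebesgue_rV R N).
Variables (F : rV -> R) (u : rV -> R) (du : rV -> rV).
Hypotheses (hF : finsler_norm F) (u0 : forall x, 0 < u x).

Lemma no_stable_solution_neg (p g : R) (f := fun t : R => - t `^ (- p)) :
  0 < p -> 0 < g -> g ^+ 2 < p * (2 * g + 1) -> N%:R < 2 + 4 * g / (p + 1) ->
  weak_solution F f u du -> stable F f u du -> False.
Proof.
move=> p0 g0 gp Ng [[/Lloc2P lu ldu wu] /Lloc1P lf weq] [/Lloc1P lf' stab].
have {}ldu i : loc2 (fun x => du x ord0 i) by apply: Lloc2P.
have [C C0 [F1C F2C]] := finsler_bounded hF.
have f' t : 0 < t -> derive1 f t = p * t `^ (- p - 1) by exact: derive1_NpowRN.
pose c := g ^+ 2 / (2 * g + 1).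
have g21 : 0 < 2 * g + 1 by rewrite addr_gt0// mulr_gt0.
have g2 : 0 < g ^+ 2 by rewrite exprn_gt0.
have c0 : 0 < c by rewrite divr_gt0.
have cE : c * (2 * g + 1) = g ^+ 2 by rewrite mulfVK// gt_eqF.
have s0 (t : R) : 0 < t -> 0 < t + 1 by move=> t0; rewrite addr_gt0.
pose G := mult_neg g; pose dG := mult_neg' g.
pose H t := - c * (G t ^+ 2 / (t + 1)).
pose dH t := g ^+ 2 * (G t / (t + 1)) ^+ 2.
have GP (t : R) : 0 < t -> is_derive t (1 : R) G (dG t) by exact: is_derive_mult_neg.
have qP (t : R) : 0 < t -> is_derive t (1 : R) (fun y => G y / (y + 1))
    (G t * - ((t + 1) ^- 2) + (t + 1)^-1 * dG t).
  by move=> t0; exact: dfunM (GP t t0) (is_derive_inv_succ t0).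
have HP (t : R) : 0 < t -> is_derive t (1 : R) H (dH t).
  move=> t0; have t1 := s0 t t0.
  apply: (is_derive_eq1 (dfunZ (- c) (dfunM (dfunX 2 (GP t t0)) (is_derive_inv_succ t0)))).
  by rewrite /dH -cE /dG /mult_neg' -/G; field; rewrite gt_eqF.
have G0 t : 0 < t -> 0 < G t by move=> t0; rewrite powR_gt0 ?s0.
have G1 t : 0 < t -> G t <= 1.
  move=> t0; rewrite -[leRHS](powRr0 (t + 1)); apply: ler_powR.
    by rewrite lerDr ltW.
  by rewrite oppr_le0 ltW.
have q01 t : 0 < t -> 0 < G t / (t + 1) <= 1.
  move=> t0; rewrite divr_gt0 ?G0 ?s0//= ler_pdivrMr ?s0// mul1r.
  by apply: le_trans (G1 t t0) _; rewrite lerDr ltW.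
have cg : c <= g ^+ 2 by rewrite -cE ler_peMr ?(ltW c0)// lerDr mulr_ge0// ltW.
pose M := 1 + g + g ^+ 2.
have M1 : 1 <= M by rewrite /M -addrA lerDl addr_ge0// ltW.
have Mg : g <= M by rewrite /M addrAC lerDr addr_ge0// ltW.
have Mg2 : g ^+ 2 <= M by rewrite /M lerDr addr_ge0// ltW.
have M0 : 0 <= M by apply: le_trans M1.
have MM (t : R) : 0 < t -> M <= M * (1 + t) by move=> t0; rewrite ler_peMr// lerDl ltW.
have GM (t : R) : 0 < t -> `|G t| <= M * (1 + t).
  by move=> t0; rewrite gtr0_norm ?G0//; apply: le_trans (MM t t0); apply: le_trans M1; exact: G1.
have Hc (t : R) : 0 < t -> `|H t| <= c.
  move=> t0; rewrite normrM normrN (gtr0_norm c0) -[leRHS]mulr1; apply: ler_wpM2l; first exact: ltW.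
  have [q0 q1] := andP (q01 t t0); rewrite expr2 -mulrA normrM !gtr0_norm ?G0//.
  by rewrite -[leRHS]mulr1; apply: ler_pM; rewrite ?(ltW q0) ?(ltW (G0 t t0)) ?G1.
apply: (nonexistence hF lu ldu wu u0 lf lf' weq stab C0 F1C F2C (theta := c / p)
  (L := c / (2 * g + 1)) (M := M) (kappa := 2 * g / (p + 1))
  (A := p `^ (- (2 * g / (p + 1)))) (G := G) (dG := dG) (H := H) (dH := dH)) => //.
- rewrite divr_ge0 ?(ltW c0) ?(ltW p0)//= ltr_pdivrMr// mul1r.
  by rewrite /c ltr_pdivrMr.
- by rewrite divr_ge0 ?(ltW c0) ?(ltW g21).
- by move=> t t0; exact: dfun_continuous (dfunZ (- g) (qP t t0)).
- by move=> t t0; exact: dfun_continuous (dfunZ (g ^+ 2) (dfunX 2 (qP t t0))).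
- move=> t t0; rewrite /dG /mult_neg' normrM normrN (gtr0_norm g0).
  apply: le_trans Mg; rewrite -[leRHS]mulr1; apply: ler_wpM2l; first exact: ltW.
  by have [q0 q1] := andP (q01 t t0); rewrite gtr0_norm.
- by move=> t t0; apply: le_trans (Hc t t0) _; apply: le_trans (MM t t0); exact: le_trans Mg2.
- move=> t t0; rewrite /dH; have [q0 q1] := andP (q01 t t0).
  rewrite (ger0_norm (mulr_ge0 (sqr_ge0 g) (sqr_ge0 _))); apply: le_trans Mg2; rewrite ler_piMr ?(ltW g2)//.
  by rewrite exprn_ile1 ?(ltW q0).
- by move=> t t0; rewrite /dG /mult_neg' exprMn sqrrN.
- move=> t t0; have t1 := s0 t t0; rewrite /H /dH.
  rewrite le_eqVlt; apply/orP; left; apply/eqP; rewrite -cE; field.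
  by rewrite !gt_eqF.
- move=> t t0; have t1 := s0 t t0; have P0 : 0 < t `^ (- p) by exact: powR_gt0.
  rewrite f'// powR_divr//.
  have -> : f t * H t = c * (t `^ (- p) * G t ^+ 2) * (t + 1)^-1 by rewrite /f /H; ring.
  have -> : c / p * (p * (t `^ (- p) / t) * G t ^+ 2) = c * (t `^ (- p) * G t ^+ 2) * t^-1.
    by field; rewrite !gt_eqF.
  apply: ler_wpM2l; last by rewrite lef_pV2 ?posrE// lerDl.
  exact: mulr_ge0 (ltW c0) (mulr_ge0 (ltW P0) (sqr_ge0 _)).
- apply: (loc1_mul_bounded (M := 1)) => //.
    apply: measurable_funX; apply: measurable_comp_gt0 lu.1 u0 => t t0.
    exact: dfun_continuous (GP t t0).
  by move=> x; rewrite normrX exprn_ile1// gtr0_norm ?G0 ?G1.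
- apply: (loc1_mul_bounded (M := c)) => //; last by move=> x; exact: Hc.
  by apply: measurable_comp_gt0 lu.1 u0 => t t0; exact: dfun_continuous (HP t t0).
- by rewrite divr_gt0 ?mulr_gt0 ?addr_gt0.
- exact: powR_ge0.
- by apply: lt_le_trans Ng _; rewrite lerD2l le_eqVlt; apply/orP; left; apply/eqP; ring.
- by move=> t t0; rewrite f'// mulr_gt0 ?powR_gt0.
- move=> t t0; rewrite f'// inv_powR_mul ?powR_ge0//.
  have t1 := s0 t t0.
  have -> : G t ^+ 2 = (t + 1) `^ (- (2 * g)).
    by rewrite /G /mult_neg -(powR_mulrn 2 (powR_ge0 _ _)) -powRrM mulNr mulrC.
  have -> : (t `^ (- p - 1)) `^ (2 * g / (p + 1)) = t `^ (- (2 * g)).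
    by rewrite -powRrM; congr (_ `^ _); field; rewrite gt_eqF// addr_gt0.
  rewrite 2!powRN lef_pV2 ?posrE ?powR_gt0//.
  by apply: ge0_ler_powR; rewrite ?nnegrE ?mulr_ge0 ?(ltW g0) ?(ltW t0) ?(ltW t1) ?lerDl.
Qed.

Lemma no_stable_solution_pos (p g : R) (f := fun t : R => t `^ p) :
  1 < p -> 1 <= g -> g ^+ 2 < p * (2 * g - 1) -> N%:R < 2 + 4 * g / (p - 1) ->
  weak_solution F f u du -> stable F f u du -> False.
Proof.
move=> p1 g1 gp Ng [[/Lloc2P lu ldu wu] /Lloc1P lf weq] [/Lloc1P lf' stab].
have {}ldu i : loc2 (fun x => du x ord0 i) by apply: Lloc2P.
have [C C0 [F1C F2C]] := finsler_bounded hF.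
have p0 : 0 < p by apply: lt_trans p1.
have g0 : 0 < g by apply: lt_le_trans g1.
have f' t : 0 < t -> derive1 f t = p * (t `^ p / t).
  by move=> t0; rewrite derive1_powR// powR_divr.
pose c := g ^+ 2 / (2 * g - 1).
have g21 : 0 < 2 * g - 1 by lra.
have g2 : 0 < g ^+ 2 by rewrite exprn_gt0.
have c0 : 0 < c by rewrite divr_gt0.
have cE : c * (2 * g - 1) = g ^+ 2 by rewrite mulfVK// gt_eqF.
pose G := mult_pos g; pose dG := mult_pos' g.
pose H t := c * (G t ^+ 2 / t).
pose dH t := c * (2 * log_slope g t - 1) * (G t / t) ^+ 2.
have GP (t : R) : 0 < t -> is_derive t (1 : R) G (dG t) by exact: is_derive_mult_pos.
have sP (t : R) : 0 < t ->
    is_derive t (1 : R) (log_slope g) (0 + (g - 1) * - ((t + 1) ^- 2)).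
  by move=> t0; exact: dfunD (dfun_cst 1 t) (dfunZ (g - 1) (is_derive_inv_succ t0)).
have qP (t : R) : 0 < t -> is_derive t (1 : R) (fun y => G y / y)
    (G t * - (t ^- 2) + t^-1 * dG t).
  by move=> t0; exact: dfunM (GP t t0) (is_derive_inv t0).
have HP (t : R) : 0 < t -> is_derive t (1 : R) H (dH t).
  move=> t0.
  apply: (is_derive_eq1 (dfunZ c (dfunM (dfunX 2 (GP t t0)) (is_derive_inv t0)))).
  by rewrite /dH /dG /mult_pos' -/G; field; rewrite gt_eqF.
have bnd t (t0 : 0 < t) := mult_pos_bounds g1 t0.
have G0 t : 0 < t -> 0 < G t by move=> /bnd[].
have Gt t : 0 < t -> G t <= t by move=> /bnd[].
have q01 t : 0 < t -> 0 < G t / t <= 1.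
  by move=> t0; rewrite divr_gt0 ?G0//= ler_pdivrMr// mul1r Gt.
have sg t : 0 < t -> 1 <= log_slope g t <= g by move=> /bnd[].
pose M := 1 + g + g ^+ 2.
have M1 : 1 <= M by rewrite /M -addrA lerDl addr_ge0// ltW.
have Mg : g <= M by rewrite /M addrAC lerDr addr_ge0// ltW.
have Mg2 : g ^+ 2 <= M by rewrite /M lerDr addr_ge0// ltW.
have M0 : 0 <= M by apply: le_trans M1.
have cg : c <= g ^+ 2 by rewrite -cE ler_peMr ?(ltW c0)//; lra.
have MM (t a : R) : 0 < t -> 0 <= a <= t -> a <= M * (1 + t).
  move=> t0 /andP[a0 at_]; apply: (@le_trans _ _ (1 * (1 + t))).
    by rewrite mul1r (le_trans at_)// lerDr.
  by rewrite ler_wpM2r// addr_ge0// ltW.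
have Hle (t : R) : 0 < t -> 0 <= H t <= c * t.
  move=> t0; have [q0 q1] := andP (q01 t t0).
  have Gp := ltW (G0 t t0).
  rewrite /H expr2 -mulrA (mulr_ge0 (ltW c0) (mulr_ge0 Gp (ltW q0)))/=.
  apply: ler_wpM2l; first exact: ltW.
  by rewrite -[leRHS]mulr1; apply: ler_pM; rewrite ?(ltW q0) ?(ltW (G0 t t0)) ?Gt.
have lfu : loc1 (fun x => f (u x) * u x).
  apply: (loc1_of_equation hF lu ldu wu u0 lf weq C0 F1C (M := 1) (G := id) (dG := fun=> 1)) => //.
  - by move=> t _; exact: cst_continuous.
  - by move=> t t0; rewrite mul1r gtr0_norm// lerDr.
  - by move=> t _; rewrite normr1.
  - by move=> t t0; rewrite mulr_ge0 ?powR_ge0// ltW.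
have mG : measurable_fun setT (fun x => G (u x)).
  by apply: measurable_comp_gt0 lu.1 u0 => t t0; exact: dfun_continuous (GP t t0).
have mH : measurable_fun setT (fun x => H (u x)).
  by apply: measurable_comp_gt0 lu.1 u0 => t t0; exact: dfun_continuous (HP t t0).
have f'G t : 0 < t -> derive1 f t * G t ^+ 2 = p / c * (f t * H t).
  by move=> t0; rewrite f'// /H /f; field; rewrite !gt_eqF.
have lfH : loc1 (fun x => f (u x) * H (u x)).
  apply: (loc1_le _ _ (loc1Z c lfu)); first by apply: measurable_funM => //; exact: lf.1.
  move=> x; have [H0 Hc] := andP (Hle _ (u0 x)).
  by rewrite (ger0_norm (mulr_ge0 (powR_ge0 _ _) H0)) [leRHS]mulrCA ler_wpM2l ?powR_ge0.
apply: (nonexistence hF lu ldu wu u0 lf lf' weq stab C0 F1C F2C (theta := c / p)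
  (L := c) (M := M) (kappa := 2 * g / (p - 1))
  (A := p `^ (- (2 * g / (p - 1)))) (G := G) (dG := dG) (H := H) (dH := dH)) => //.
- rewrite divr_ge0 ?(ltW c0) ?(ltW p0)//= ltr_pdivrMr// mul1r.
  by rewrite /c ltr_pdivrMr.
- exact: ltW.
- by move=> t t0; exact: dfun_continuous (dfunM (sP t t0) (qP t t0)).
- move=> t t0; have dw := dfunZ c (dfunB (dfunZ 2 (sP t t0)) (dfun_cst 1 t)).
  exact: dfun_continuous (dfunM dw (dfunX 2 (qP t t0))).
- by move=> t t0; rewrite gtr0_norm ?G0//; apply: MM => //; rewrite (ltW (G0 t t0)) Gt.
- move=> t t0; have [q0 q1] := andP (q01 t t0); have [s1 s2] := andP (sg t t0).
  rewrite /dG /mult_pos' ger0_norm; last by rewrite mulr_ge0 ?(ltW q0)// (le_trans _ s1).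
  apply: le_trans Mg; rewrite -[leRHS]mulr1; apply: ler_pM => //; last exact: ltW.
  exact: le_trans s1.
- move=> t t0; have [H0 Hc] := andP (Hle t t0); rewrite ger0_norm//.
  apply: le_trans Hc _; apply: ler_pM; rewrite ?(ltW c0) ?(ltW t0)//.
    exact: le_trans cg Mg2.
  by rewrite lerDr.
- move=> t t0; have [q0 q1] := andP (q01 t t0); have [s1 s2] := andP (sg t t0).
  have w0 : 0 <= c * (2 * log_slope g t - 1) by rewrite mulr_ge0 ?(ltW c0)//; lra.
  rewrite /dH (ger0_norm (mulr_ge0 w0 (sqr_ge0 _))); apply: le_trans Mg2; rewrite -cE.
  rewrite -[leRHS]mulr1; apply: ler_pM; rewrite ?sqr_ge0 ?exprn_ile1 ?(ltW q0)//.
  by apply: ler_wpM2l; [exact: ltW|lra].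
- move=> t t0; have [s1 s2] := andP (sg t t0).
  rewrite /dG /mult_pos' exprMn /dH ler_wpM2r ?sqr_ge0//.
  rewrite /c mulrAC ler_pdivlMr// -subr_ge0.
  set s := log_slope g t in s1 s2 *.
  have -> : g ^+ 2 * (2 * s - 1) - s ^+ 2 * (2 * g - 1) =
    (g - s) * (g * (s - 1) + s * (g - 1)) by ring.
  have s0 : 0 <= s by apply: le_trans s1.
  by apply: mulr_ge0; rewrite ?subr_ge0//; apply: addr_ge0; apply: mulr_ge0;
    rewrite ?subr_ge0 ?(ltW g0).
- move=> t t0; have [s1 s2] := andP (sg t t0).
  have -> : H t ^+ 2 = c ^+ 2 * ((G t / t) ^+ 2 * G t ^+ 2) * 1.
    by rewrite /H; field; rewrite gt_eqF.
  have -> : c * (dH t * G t ^+ 2) =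
    c ^+ 2 * ((G t / t) ^+ 2 * G t ^+ 2) * (2 * log_slope g t - 1) by rewrite /dH; ring.
  apply: ler_wpM2l; last by lra.
  exact: mulr_ge0 (sqr_ge0 _) (mulr_ge0 (sqr_ge0 _) (sqr_ge0 _)).
- move=> t t0; rewrite f'G// le_eqVlt; apply/orP; left; apply/eqP.
  by field; rewrite !gt_eqF.
- have -> : (fun x => derive1 f (u x) * G (u x) ^+ 2) = (fun x => p / c * (f (u x) * H (u x))).
    by apply/funext => x; exact: f'G.
  exact: loc1Z.
- by rewrite divr_gt0 ?mulr_gt0 ?subr_gt0.
- exact: powR_ge0.
- by apply: lt_le_trans Ng _; rewrite lerD2l le_eqVlt; apply/orP; left; apply/eqP; ring.
- by move=> t t0; rewrite f'// mulr_gt0 ?divr_gt0 ?powR_gt0.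
- move=> t t0; rewrite derive1_powR// inv_powR_mul ?powR_ge0//.
  have -> : (t `^ (p - 1)) `^ (2 * g / (p - 1)) = (t `^ g) ^+ 2.
    rewrite -powRrM -(powR_mulrn 2 (powR_ge0 _ _)) -powRrM; congr (_ `^ _).
    by field; rewrite gt_eqF// subr_gt0.
  by have [G0' _ Gg _] := bnd t t0; rewrite lerXn2r ?nnegrE ?powR_ge0 ?(ltW G0').
Qed.

End cases.

(** * A representative that is positive everywhere *)

Section positive_representative.
Context {R : realType} {N : nat}.
Local Notation rV := 'rV[R]_N.
Local Notation mu := (lebesgue_rV R N).

Lemma compact_measurable (K : set rV) : compact K -> measurable K.
Proof.
move=> /(compact_closed (@norm_hausdorff _ _)) cK; rewrite -[K]setCK.
by apply: measurableC; apply: open_measurable_rV; exact: closed_openC.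
Qed.

Lemma Lloc_ae p (v w : rV -> R) : measurable_fun setT w ->
  {ae mu, forall x, v x = w x} -> Lloc p v -> Lloc p w.
Proof.
move=> mw vw [mv lv]; split => // K cK; have mK := compact_measurable cK.
suff <- : (\int[mu]_(x in K) (`|v x| ^+ p)%:E = \int[mu]_(x in K) (`|w x| ^+ p)%:E)%E.
  exact: lv.
apply: ae_eq_integral => //.
- by apply/measurable_EFinP; apply: measurable_funX; apply: measurableT_comp => //;
    exact: measurable_funTS.
- by apply/measurable_EFinP; apply: measurable_funX; apply: measurableT_comp => //;
    exact: measurable_funTS.
- by apply: filterS vw => x /= -> _.
Qed.

Variables (F : rV -> R) (f : R -> R) (u : rV -> R) (du : rV -> rV).
Hypothesis hF : finsler_norm F.

Lemma positive_representative : {ae mu, forall x, 0 < u x} ->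
  weak_solution F f u du -> stable F f u du ->
  exists2 w, forall x, 0 < w x & weak_solution F f w du /\ stable F f w du.
Proof.
move=> upos [[lu ldu wu] lf weq] [lf' stab].
have ldu2 i : loc2 (fun x => du x ord0 i) by apply: Lloc2P.
pose rep (h : R -> R) x := if 0 < u x then h (u x) else h 1.
have mrep h : measurable_fun setT (h \o u) -> measurable_fun setT (rep h).
  move=> mh; apply: measurable_fun_ifT => //.
  by apply: measurable_fun_ltr; [exact: measurable_cst|exact: lu.1].
have arep h : {ae mu, forall x, h (u x) = rep h x} by apply: filterS upos => x; rewrite /rep => ->.
pose w := rep id.
have hw h x : h (w x) = rep h x by rewrite /w /rep; case: ifP.
have lw p h : Lloc p (h \o u) -> Lloc p (h \o w).
  move=> lh; have -> : h \o w = rep h by apply/funext => x; exact: hw.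
  by apply: (Lloc_ae _ (arep h) lh); apply: mrep; exact: lh.1.
have testE (h : R -> R) (phi : rV -> R) : measurable_fun setT (h \o u) -> measurable_fun setT phi ->
    (\int[mu]_x (h (u x) * phi x)%:E = \int[mu]_x (h (w x) * phi x)%:E)%E.
  move=> mh mphi; apply: Rintegral_ae_eq.
  - exact: measurable_funM.
  - apply: measurable_funM => //; under eq_fun do rewrite hw; exact: mrep.
  - by apply: filterS (arep h) => x /= ->; rewrite hw.
exists w; first by move=> x; rewrite /w /rep; case: ifP.
split; split.
- split; [exact: (lw 2%N id)|exact: ldu|].
  move=> phi Cphi i; rewrite -(wu phi Cphi i) -(testE id)//; first exact: lu.1.
  exact: Cc_infty_measurable (Cc_inftyS i Cphi).
- exact: lw.
- move=> phi Cphi; rewrite (weq phi Cphi); apply: testE; first exact: lf.1.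
  exact: Cc_infty_measurable.
- exact: lw.
- move=> phi Cphi; have mphi := (Cc1_loc1 Cphi).1.
  have mp i : measurable_fun setT (partial i phi) := (Cc1_partial_loc1 i Cphi).1.
  have mF := measurable_dFdu hF ldu2; have mF2 := measurable_d2Fdu hF ldu2.
  suff -> : (\int[mu]_x (stability_integrand F f w du phi x)%:E =
    \int[mu]_x (stability_integrand F f u du phi x)%:E)%E by exact: stab.
  have mS v : measurable_fun setT (derive1 f \o v) ->
      measurable_fun setT (stability_integrand F f v du phi).
    move=> mv; apply: measurable_funB; last by apply: measurable_funM => //; exact: measurable_funX.
    apply: measurable_funD; apply: measurable_sum => i; apply: measurable_sum => j.
      by do 3 apply: measurable_funM => //.
    by do 2 apply: measurable_funM => //.
  apply: Rintegral_ae_eq; [exact: mS (lw 1%N _ lf').1|exact: mS lf'.1|].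
  by apply: filterS (arep (derive1 f)) => x /=; rewrite /stability_integrand hw => ->.
Qed.

End positive_representative.

(** The admissible exponents form a nonempty interval: N bounds g from below and
    the quadratic inequality g^2 < p (2 g +- 1) bounds it from above. *)
Lemma exponent_exists {R : realType} (p d S : R) (n : R) : 0 <= p -> 0 < d -> 0 < S ->
  n < 2 + 4 * (p + S) / d ->
  exists g, [/\ p <= g, (g - p) ^+ 2 < S ^+ 2 & n < 2 + 4 * g / d].
Proof.
move=> p0 d0 S0 nS; pose m := (n - 2) * d / 4.
have mS : m < p + S.
  rewrite /m ltr_pdivrMr// -ltr_pdivlMr//.
  by move: nS; rewrite -ltrBlDl; have -> : (p + S) * 4 / d = 4 * (p + S) / d by ring.
pose k := Num.max p m; have kS : k < p + S by rewrite gt_max mS andbT ltrDl.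
have pk : p <= k by rewrite le_max lexx.
have mk : m <= k by rewrite le_max lexx orbT.
exists ((k + (p + S)) / 2); split; first lra.
  by rewrite ltr_pXn2r ?nnegrE ?(ltW S0)//; lra.
have : m < (k + (p + S)) / 2 by lra.
rewrite /m; set g := (k + _) / 2 => mg.
rewrite -ltrBlDl ltr_pdivlMr//; lra.
Qed.

Theorem theorem1p4 (R : realType) (N : nat) (F : 'rV[R]_N -> R) :
  (0 < N)%N -> finsler_norm F ->
  (forall p : R, 3 < p ->
     N%:R < (6 * p + 4 * Num.sqrt (p ^+ 2 - p) - 2) / (p - 1) ->
     ~ has_positive_stable_weak_solution F (fun t => t `^ p)) /\
  (forall p : R, 1 / 3 < p ->
     N%:R < (6 * p + 4 * Num.sqrt (p ^+ 2 + p) + 2) / (p + 1) ->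
     ~ has_positive_stable_weak_solution F (fun t => - t `^ (- p))).
Proof.
move=> _ hF; split=> p p_gt N_lt [u [du [upos sol st]]];
  have [w w0 [wsol wst]] := positive_representative hF upos sol st.
- have p1 : 1 < p by lra.
  have D0 : 0 < p ^+ 2 - p by rewrite expr2 -[X in _ - X]mulr1 -mulrBr mulr_gt0; lra.
  have S0 : 0 < Num.sqrt (p ^+ 2 - p) by rewrite sqrtr_gt0.
  have d0 : 0 < p - 1 by rewrite subr_gt0.
  have p0 : 0 <= p by lra.
  have [|g [pg gS Ng]] := exponent_exists (n := N%:R) p0 d0 S0.
    apply: lt_le_trans N_lt _; rewrite le_eqVlt; apply/orP; left; apply/eqP.
    by field; rewrite gt_eqF.
  apply: (no_stable_solution_pos hF w0 p1 (g := g) _ _ Ng wsol wst); first lra.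
  by move: gS; rewrite sqr_sqrtr ?(ltW D0)// sqrrB; lra.
- have p0 : 0 < p by lra.
  have D0 : 0 < p ^+ 2 + p by rewrite addr_gt0// exprn_gt0.
  have S0 : 0 < Num.sqrt (p ^+ 2 + p) by rewrite sqrtr_gt0.
  have d0 : 0 < p + 1 by rewrite addr_gt0.
  have [|g [pg gS Ng]] := exponent_exists (n := N%:R) (ltW p0) d0 S0.
    apply: lt_le_trans N_lt _; rewrite le_eqVlt; apply/orP; left; apply/eqP.
    by field; rewrite gt_eqF.
  apply: (no_stable_solution_neg hF w0 p0 (g := g) _ _ Ng wsol wst); first lra.
  by move: gS; rewrite sqr_sqrtr ?(ltW D0)// sqrrB; lra.
Qed.
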